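(* Let $(\mu_0,\mu_1)\in\mathcal P(\mathcal X_0)\times\mathcal P(\mathcal X_1)$ have full support. Let $(\mu_{0,n},\mu_{1,n})_{n\in\mathbb N}\subset\mathcal P(\mathcal X_0)\times\mathcal P(\mathcal X_1)$ be a sequence of (random) pairs of probability measures such that $\sqrt n\big((w_{\mu_{0,n}},w_{\mu_{1,n}})-(w_{\mu_0},w_{\mu_1})\big)\stackrel{d}{\to}(G_{\mu_0},G_{\mu_1})$ for some pair of random vectors in $\mathbb R^{N_0}\times\mathbb R^{N_1}$. Then: (1) $$\sqrt n\big(\mathsf{GW}_p(\mu_{0,n},\mu_{1,n})^p-\mathsf{GW}_p(\mu_0,\mu_1)^p\big)\stackrel{d}{\to}\inf_{\pi^\star\in\Pi^\star(\mu_0,\mu_1)}\ \sup_{(\varphi_0,\varphi_1)\in\mathcal D_{\pi^\star}}\big\{v_{\varphi_0}^{\intercal}G_{\mu_0}+v_{\varphi_1}^{\intercal}G_{\mu_1}\big\},$$ where $\Pi^\star(\mu_0,\mu_1)$ is the set of optimal plans for $\mathsf{GW}_p(\mu_0,\mu_1)$ and $\mathcal D_{\pi^\star}$ is the set of OT potentials for $\mathsf{OT}_{c_{\pi^\star}}(\mu_0,\mu_1)$ with $c_{\pi^\star}(x,y)=2\int\Delta(x,y,x',y')\,d\pi^\star(x',y')$. (2) If $\varepsilon>0$, $$\sqrt n\big(\mathsf{EGW}_p^\varepsilon(\mu_{0,n},\mu_{1,n})-\mathsf{EGW}_p^\varepsilon(\mu_0,\mu_1)\big)\stackrel{d}{\to}\inf_{\pi^\star\in\Pi^\star(\mu_0,\mu_1)}\big\{v_{\varphi_0^{\pi^\star}}^{\intercal}G_{\mu_0}+v_{\varphi_1^{\pi^\star}}^{\intercal}G_{\mu_1}\big\},$$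 where $\Pi^\star(\mu_0,\mu_1)$ is now the set of optimal plans for $\mathsf{EGW}_p^\varepsilon(\mu_0,\mu_1)$ and $(\varphi_0^{\pi^\star},\varphi_1^{\pi^\star})$ is the unique (up to additive constants) pair of EOT potentials for $\mathsf{EOT}^\varepsilon_{c_{\pi^\star}}(\mu_0,\mu_1)$, with $c_{\pi^\star}$ given by the same formula.
   Context: $\mathcal X_i=\{x_i^{(1)},\dots,x_i^{(N_i)}\}$ ($i=0,1$) are finite sets, $\mathcal P(\mathcal X_i)$ the probability measures on $\mathcal X_i$, $p>0$, $\kappa_i:\mathcal X_i\times\mathcal X_i\to\mathbb R$, and $\Delta(x,y,x',y')=|\kappa_0(x,x')-\kappa_1(y,y')|^p$, assumed throughout to satisfy $\Delta(x,y,x',y')=\Delta(x',y',x,y)$. For $\eta\in\mathcal P(\mathcal X_i)$, $w_\eta=(\eta(\{x_i^{(1)}\}),\dots,\eta(\{x_i^{(N_i)}\}))$; for $f:\mathcal X_i\to\mathbb R$, $v_f=(f(x_i^{(1)}),\dots,f(x_i^{(N_i)}))$. $\Pi(\mu_0,\mu_1)$ is the set of couplings. For $\varepsilon\ge0$, $\mathsf{EGW}_p^\varepsilon(\mu_0,\mu_1)=\inf_{\pi\in\Pi(\mu_0,\mu_1)}\int\Delta\,d\pi\otimes\pi+\varepsilon\,\mathsf{KL}(\pi\|\mu_0\otimes\mu_1)$ and $\mathsf{GW}_p(\mu_0,\mu_1)^p=\mathsf{EGW}_p^0(\mu_0,\mu_1)$; optimal plans are minimizing couplings. For $c:\mathcal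 X_0\times\mathcal X_1\to\mathbb R$: $\mathsf{OT}_c(\mu_0,\mu_1)=\inf_{\pi\in\Pi(\mu_0,\mu_1)}\int c\,d\pi$, and OT potentials are maximizers of $\int\varphi_0d\mu_0+\int\varphi_1d\mu_1$ over pairs of functions $(\varphi_0,\varphi_1)$ on $\mathcal X_0,\mathcal X_1$ with $\varphi_0(x)+\varphi_1(y)\le c(x,y)$ for all $(x,y)$; $\mathsf{EOT}_c^\varepsilon(\mu_0,\mu_1)=\inf_{\pi\in\Pi(\mu_0,\mu_1)}\int c\,d\pi+\varepsilon\mathsf{KL}(\pi\|\mu_0\otimes\mu_1)$, and EOT potentials are maximizers over pairs of functions of $\int\varphi_0d\mu_0+\int\varphi_1d\mu_1-\varepsilon\int e^{(\varphi_0(x)+\varphi_1(y)-c(x,y))/\varepsilon}d\mu_0\otimes\mu_1(x,y)+\varepsilon$; they are unique up to replacing $(\varphi_0,\varphi_1)$ by $(\varphi_0+a,\varphi_1-a)$, $a\in\mathbb R$, when $\mu_0,\mu_1$ have full support. *)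

(* Defs.v *)
From HB Require Import structures.
From mathcomp Require Import all_boot all_order all_algebra.
From mathcomp Require Import all_classical all_reals all_analysis.
Import Order.TTheory GRing.Theory Num.Theory.
Import numFieldNormedType.Exports.

Set Implicit Arguments.
Unset Strict Implicit.
Unset Printing Implicit Defensive.

Local Open Scope classical_set_scope.
Local Open Scope ring_scope.

(* A probability measure on a finite set is given by its point masses. *)
Record fprob (R : realType) (X : finType) := FProb {
  pmass :> X -> R;
  pmass_ge0 : forall x, 0 <= pmass x;
  pmass_sum1 : \sum_x pmass x = 1 }.

Definition full_support (R : realType) (X : finType) (mu : fprob R X) : Prop :=
  forall x, 0 < mu x.

Definition integ (R : realType) (X : finType) (mu : fprob R X) (f : X -> R) : R :=
  \sum_x f x * mu x.

Section Product.
Context (R : realType) (X Y : finType) (mu : fprob R X) (nu : fprob R Y).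

Let pm (z : X * Y) : R := mu z.1 * nu z.2.

Lemma fprob_prod_ge0 z : 0 <= pm z.
Proof. by rewrite mulr_ge0// pmass_ge0. Qed.

Lemma fprob_prod_sum1 : \sum_z pm z = 1.
Proof.
rewrite -(pair_bigA _ (fun x y => mu x * nu y))/= -[RHS](pmass_sum1 mu).
by apply: eq_bigr => x _; rewrite -mulr_sumr pmass_sum1 mulr1.
Qed.

Definition fprob_prod : fprob R (X * Y)%type :=
  FProb fprob_prod_ge0 fprob_prod_sum1.
End Product.

Definition coupling (R : realType) (X0 X1 : finType)
    (mu0 : fprob R X0) (mu1 : fprob R X1) : set (fprob R (X0 * X1)%type) :=
  [set pi | (forall x, \sum_y pi (x, y) = mu0 x) /\
            (forall y, \sum_x pi (x, y) = mu1 y)].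

(* The usual formula for KL(a || b) when a is absolutely continuous with respect
   to b; points with a x = 0 contribute 0. It is only applied to a coupling of
   mu0 and mu1 against mu0 (x) mu1, where absolute continuity always holds, so
   the value +oo does not arise. *)
Definition KL (R : realType) (X : finType) (a b : fprob R X) : R :=
  integ a (fun x => ln (a x / b x)).

Section GromovWasserstein.
Context (R : realType) (X0 X1 : finType).
Context (p : R) (k0 : X0 -> X0 -> R) (k1 : X1 -> X1 -> R).

Definition Delta (x : X0) (y : X1) (x' : X0) (y' : X1) : R :=
  `|k0 x x' - k1 y y'| `^ p.

Definition EGW_cost (eps : R) (mu0 : fprob R X0) (mu1 : fprob R X1)
    (pi : fprob R (X0 * X1)%type) : R :=
  integ (fprob_prod pi pi) (fun u => Delta u.1.1 u.1.2 u.2.1 u.2.2)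
  + eps * KL pi (fprob_prod mu0 mu1).

Definition EGW (eps : R) (mu0 : fprob R X0) (mu1 : fprob R X1) : R :=
  inf [set EGW_cost eps mu0 mu1 pi | pi in coupling mu0 mu1].

Definition GW (mu0 : fprob R X0) (mu1 : fprob R X1) : R :=
  EGW 0 mu0 mu1 `^ p^-1.

(* Optimal plans for EGW at eps, and for GW when eps = 0. *)
Definition optimal_plans (eps : R) (mu0 : fprob R X0) (mu1 : fprob R X1) :
    set (fprob R (X0 * X1)%type) :=
  [set pi | coupling mu0 mu1 pi /\
    forall pi', coupling mu0 mu1 pi' ->
      EGW_cost eps mu0 mu1 pi <= EGW_cost eps mu0 mu1 pi'].

Definition plan_cost (pi : fprob R (X0 * X1)%type) (x : X0) (y : X1) : R :=
  2 * integ pi (fun z => Delta x y z.1 z.2).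

End GromovWasserstein.

Section Potentials.
Context (R : realType) (X0 X1 : finType).
Context (c : X0 -> X1 -> R) (mu0 : fprob R X0) (mu1 : fprob R X1).

Definition OT_dual (phi : (X0 -> R) * (X1 -> R)) : R :=
  integ mu0 phi.1 + integ mu1 phi.2.

Definition OT_feasible : set ((X0 -> R) * (X1 -> R)) :=
  [set phi | forall x y, phi.1 x + phi.2 y <= c x y].

Definition OT_potentials : set ((X0 -> R) * (X1 -> R)) :=
  [set phi | OT_feasible phi /\
    forall psi, OT_feasible psi -> OT_dual psi <= OT_dual phi].

Definition EOT_dual (eps : R) (phi : (X0 -> R) * (X1 -> R)) : R :=
  integ mu0 phi.1 + integ mu1 phi.2
  - eps * integ (fprob_prod mu0 mu1)
            (fun z => expR ((phi.1 z.1 + phi.2 z.2 - c z.1 z.2) / eps))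
  + eps.

Definition EOT_potentials (eps : R) : set ((X0 -> R) * (X1 -> R)) :=
  [set phi | forall psi, EOT_dual eps psi <= EOT_dual eps phi].

End Potentials.

(* Coordinates follow the enumeration of X; with N = #|X|, fvec (pmass eta) is
   w_eta and fvec f is v_f. *)
Definition fvec (R : realType) (X : finType) (f : X -> R) : 'cV[R]_#|X| :=
  \col_i f (enum_val i).

Definition dotv (R : realType) (n : nat) (v g : 'cV[R]_n) : R :=
  (v^T *m g) ord0 ord0.

Definition random_element d (Om : measurableType d) (T : topologicalType)
    (X : Om -> T) : Prop :=
  forall U : set T, open U -> measurable (X @^-1` U).

(* The X n and Y may live on different probability spaces. *)
Definition cvg_in_distribution (R : realType) (T : topologicalType)
    (d : nat -> measure_display) (Om : forall n, measurableType (d n))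
    (P : forall n, probability (Om n) R) (X : forall n, Om n -> T)
    (d' : measure_display) (Om' : measurableType d')
    (P' : probability Om' R) (Y : Om' -> T) : Prop :=
  [/\ forall n, random_element (X n),
      random_element Y &
      forall f : T -> R, continuous f -> (exists M, forall t, `|f t| <= M) ->
        ('E_(P n)[f \o X n])%E @[n --> \oo] --> ('E_P'[f \o Y])%E].

(* Main.v *)
Require Import Defs.
From HB Require Import structures.
From mathcomp Require Import all_boot all_order all_algebra.
From mathcomp Require Import all_classical all_reals all_analysis.
From mathcomp Require Import measurable_realfun ring lra.
Import Order.TTheory GRing.Theory Num.Theory.
Import numFieldNormedType.Exports.

Set Implicit Arguments.
Unset Strict Implicit.
Unset Printing Implicit Defensive.

Local Open Scope classical_set_scope.
Local Open Scope ring_scope.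

(* Both value functions are expanded to first order at (mu0, mu1), uniformly in
   the perturbation, and the expansion is transferred to distributions by
   truncation (delta method).

   Upper bound: an optimal plan pi is moved in a direction eta with the prescribed
   marginals h. For eps > 0 every optimal plan is positive and any eta will do;
   for eps = 0, Farkas' lemma provides an eta that is nonnegative off the support
   of pi and whose linearised cost is the supremum over the OT potentials.

   Lower bound: optimal plans of the perturbed problems accumulate, along an
   ultrafilter, at an optimal plan pi0 of the limit problem. For eps > 0 the
   functional is smooth at pi0. For eps = 0 the problem is a nonconvex quadratic
   program; after fixing the support S of the perturbed plans, the first-order
   conditions with respect to S are linear in the plan and the quadratic form
   depends only on the marginals of a plan satisfying them. Hence along a ray
   the perturbed values are attained on the segment from pi0 to a fixed plan, and
   weak duality with the potentials at pi0 bounds the slope from below. *)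

(** * Entropy function and the Farkas lemma *)

(** The two problems need different treatments of the direction of perturbation. With entropy the
    value is controlled here only by a 1/2-Hölder modulus, so converging directions are put into the
    difference quotient itself, whose base point may move as well. Without entropy the value is
    Lipschitz and the direction can be frozen first; this matters because the segment argument needs
    marginals that move exactly on a line. Ultrafilters replace repeated extraction of subsequences:
    limits of plans, limits of directions and the constancy of a support all hold along one filter.
    Potentials carry free additive constants, so off the directions of zero total mass the limit
    functional may be infinite. The limit vector is almost surely such a direction, but being a
    random element is a statement about every sample point; hence a continuous extension of the
    functional for the delta method, and separate measurability arguments for the infimum itself. *)

Section XLogX.
Context (R : realType).
Implicit Types x y a b u : R.

Definition xlnx x := x * ln x.

Lemma xlnx0 : xlnx 0 = 0. Proof. by rewrite /xlnx mul0r. Qed.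

Lemma xlnx_le0 x : 0 <= x -> x <= 1 -> xlnx x <= 0.
Proof. by move=> x0 x1; rewrite /xlnx mulr_ge0_le0// ln_le0. Qed.

Lemma ln_le_subr1 x : 0 < x -> ln x <= x - 1.
Proof.
by move=> x0; rewrite -{1}(subrK 1 x) addrC le_ln1Dx// ltrBrDl subrr.
Qed.

(** Convexity, from [ln u <= u - 1] at [u = b / a]. The endpoint [a = 0] is included because optimal
    plans may a priori vanish somewhere. *)
Lemma xlnx_tangent a b : 0 <= a -> 0 < b ->
  xlnx b + (a - b) * (ln b + 1) <= xlnx a.
Proof.
rewrite le_eqVlt => /predU1P[<-|a0] b0; rewrite /xlnx; first by nra.
have /ln_le_subr1 : 0 < b / a by rewrite divr_gt0.
rewrite ln_div ?posrE// => /(ler_wpM2l (ltW a0)).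
have -> : a * (b / a - 1) = b - a by field; rewrite gt_eqF.
nra.
Qed.

(** Write [ln x] as twice the logarithm of the square root and apply [ln u <= u - 1] to the inverse
    of that root. *)
Lemma xlnx_ge_sqrt x : 0 <= x -> - (2 * Num.sqrt x) <= xlnx x.
Proof.
rewrite le_eqVlt => /predU1P[<-|x0]; first by rewrite sqrtr0 xlnx0 mulr0 oppr0.
have s0 : 0 < Num.sqrt x by rewrite sqrtr_gt0.
have xE : x = Num.sqrt x * Num.sqrt x by rewrite -expr2 sqr_sqrtr// ltW.
have lnE : ln x = ln (Num.sqrt x) + ln (Num.sqrt x) by rewrite -lnM ?posrE// -xE.
rewrite /xlnx lnE.
have : 0 < (Num.sqrt x)^-1 by rewrite invr_gt0.
move=> /ln_le_subr1; rewrite lnV ?posrE// => /(ler_wpM2l (ltW x0)).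
have : x * (Num.sqrt x)^-1 = Num.sqrt x by rewrite {1}xE mulfK// gt_eqF.
nra.
Qed.

(** The slope is infinite at 0, so no Lipschitz bound holds; the exponent 1/2 is enough for
    continuity of the value. *)
Lemma xlnx_holder_le x y : 0 <= x -> x <= y -> y <= 1 ->
  `|xlnx x - xlnx y| <= 2 * Num.sqrt (y - x).
Proof.
move=> x0; rewrite le_eqVlt => /predU1P[<- _|xy y1].
  by rewrite !subrr normr0 sqrtr0 mulr0.
have y0 : 0 < y by apply: le_lt_trans xy.
have s0 : 0 < y - x by rewrite subr_gt0.
have s1 : y - x <= 1 by lra.
have lny : ln y <= 0 by rewrite ln_le0.
have sq : y - x <= Num.sqrt (y - x).
  have : Num.sqrt (y - x) <= Num.sqrt 1 by rewrite ler_sqrt.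
  have := sqr_sqrtr (ltW s0); have := sqrtr_ge0 (y - x); rewrite expr2 sqrtr1.
  by nra.
rewrite ler_norml; apply/andP; split; last first.
  have := xlnx_tangent x0 y0.
  have := xlnx_ge_sqrt (ltW s0).
  (* Monotonicity of [ln] gives [xlnx x - xlnx y <= - (y - x) * ln y <= - xlnx (y - x)], which
     [xlnx_ge_sqrt] bounds. *)
  have lnsy : ln (y - x) <= ln y by rewrite ler_ln ?posrE//; lra.
  have lnxy : x * ln x <= x * ln y.
    move: x0; rewrite le_eqVlt => /predU1P[<-|x0]; first by rewrite !mul0r.
    by rewrite ler_pM2l// ler_ln ?posrE// ltW.
  by rewrite /xlnx; nra.
have := xlnx_tangent x0 y0; rewrite /xlnx.
nra.
Qed.

Lemma xlnx_holder x y : 0 <= x <= 1 -> 0 <= y <= 1 ->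
  `|xlnx x - xlnx y| <= 2 * Num.sqrt `|x - y|.
Proof.
move=> /andP[x0 x1] /andP[y0 y1]; have [xy|/ltW yx] := leP x y.
  by rewrite (distrC x y) [`|y - x|]ger0_norm ?subr_ge0// xlnx_holder_le.
by rewrite distrC [`|x - y|]ger0_norm ?subr_ge0// xlnx_holder_le.
Qed.

End XLogX.

Section Farkas.
Context (R : realType).

(* Bartl's induction: when the last constraint a_m matters, some x has
   a_i x <= 0 for i < m, a_m x = 1 and f x > 0; replacing each functional l by
   l - (l x) a_m removes that constraint. *)
Lemma farkas_nat (T : finType) (m : nat) (a : nat -> T -> R) (f : T -> R) :
  (forall x : T -> R, (forall i, (i < m)%N -> \sum_t a i t * x t <= 0) ->
     \sum_t f t * x t <= 0) ->
  exists l : nat -> R, (forall i, 0 <= l i) /\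
    forall t, f t = \sum_(i < m) l i * a i t.
Proof.
elim: m a f => [|m IH] a f H.
  exists (fun=> 0); split=> // t; rewrite big_ord0.
  (* With no constraints left, [f] itself is an admissible test vector, so its squared norm is at
     most 0. *)
  have := H f (fun i => fun h => False_ind _ (Bool.diff_false_true h)) => Hf.
  have /psumr_eq0P/= : forall s, true -> 0 <= f s * f s.
    by move=> s _; rewrite -expr2 sqr_ge0.
  have f0 : \sum_(s : T) f s * f s = 0.
    by apply/eqP; rewrite eq_le Hf/=; apply: sumr_ge0 => s _; rewrite -expr2 sqr_ge0.
  move=> /(_ f0 t isT)/eqP; rewrite mulf_eq0 orbb => /eqP //.
have [/IH[l [l0 lE]]|] := pselect (forall x : T -> R,
    (forall i, (i < m)%N -> \sum_t a i t * x t <= 0) -> \sum_t f t * x t <= 0).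
  exists (fun i => if (i < m)%N then l i else 0); split=> [i|t].
    by case: ifP.
  rewrite big_ord_recr/= ltnn mul0r addr0 lE.
  by apply: eq_bigr => i _; rewrite ltn_ord.
move=> /existsNP[x0 /not_implyP[x0le /negP]]; rewrite -ltNge => fx0.
have ax0 : 0 < \sum_t a m t * x0 t.
  rewrite ltNge; apply/negP => h; move: fx0; rewrite ltNge => /negP; apply.
  by apply: H => i; rewrite ltnS leq_eqVlt => /predU1P[->//|/x0le].
set A := \sum_t a m t * x0 t in ax0.
pose dot (g y : T -> R) := \sum_t g t * y t.
pose red (g : T -> R) t := g t - (dot g x0 / A) * a m t.
have dotred g w : dot (red g) w = dot g (fun t => w t - (dot (a m) w / A) * x0 t).
  rewrite /red; set c := dot g x0 / A; set e := dot (a m) w / A.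
  transitivity (dot g w - c * dot (a m) w).
    by rewrite /dot mulr_sumr -sumrB; apply: eq_bigr => t _; rewrite mulrBl mulrA.
  transitivity (dot g w - e * dot g x0); first by rewrite /c /e; ring.
  by rewrite /dot mulr_sumr -sumrB; apply: eq_bigr => t _; rewrite mulrBr (mulrCA e).
(* By [dotred], pairing a reduced functional with [w] is pairing the original one with the
   projection of [w] along [x0] onto the kernel of [a m]; there the last constraint holds with
   equality. *)
have [w wle|l [l0 lE]] := IH (fun i => red (a i)) (red f).
  rewrite -/(dot (red f) w) dotred; apply: H => i.
  rewrite ltnS leq_eqVlt => /predU1P[->|im].
    rewrite (_ : \sum_t _ = 0)//.
    under eq_bigr do rewrite mulrBr mulrCA.
    by rewrite sumrB -mulr_sumr -/A divfK ?gt_eqF// subrr.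
  by have := wle _ im; rewrite -/(dot (red (a i)) w) dotred.
(* The coefficient of [a m] after undoing the reduction; it is nonnegative because [f] is positive
   and every earlier [a i] nonpositive at [x0]. *)
pose lm := (dot f x0 - \sum_(i < m) l i * dot (a i) x0) / A.
exists (fun i => if (i < m)%N then l i else if i == m then lm else 0); split.
  move=> i; case: ifP => // _; case: ifP => // _.
  rewrite divr_ge0 ?(ltW ax0)// subr_ge0 (le_trans _ (ltW fx0))//.
  by apply: sumr_le0 => j _; rewrite mulr_ge0_le0// x0le.
move=> t; rewrite big_ord_recr/= ltnn eqxx.
rewrite (eq_bigr (fun i : 'I_m => l i * a i t)); last by move=> i _; rewrite ltn_ord.
have := lE t; rewrite /red => /eqP; rewrite subr_eq => /eqP ->.
rewrite (eq_bigr (fun i : 'I_m => l i * a i t - l i * dot (a i) x0 / A * a m t)); last first.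
  by move=> i _; rewrite mulrBr !mulrA.
rewrite sumrB -addrA; congr (_ + _).
by rewrite -!mulr_suml /lm; ring.
Qed.

Lemma farkas (T I : finType) (a : I -> T -> R) (f : T -> R) :
  (forall x : T -> R, (forall i, \sum_t a i t * x t <= 0) ->
     \sum_t f t * x t <= 0) ->
  exists l : I -> R, (forall i, 0 <= l i) /\ forall t, f t = \sum_i l i * a i t.
Proof.
move=> H.
pose b (k : nat) : T -> R :=
  if insub k is Some i then a (enum_val (i : 'I_#|I|)) else fun=> 0.
have bE (i : 'I_#|I|) : b i = a (enum_val i) by rewrite /b valK.
have [x xle|l [l0 lE]] := @farkas_nat T #|I| b f.
  apply: H => i; have := xle (enum_rank i) (ltn_ord _).
  by rewrite bE enum_rankK.
exists (fun i => l (enum_rank i)); split=> // t.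
rewrite lE (reindex (@enum_rank I))/=; last exact: onW_bij (@enum_rank_bij I).
by apply: eq_bigr => i _; rewrite bE enum_rankK.
Qed.

End Farkas.

(** * Gluing of couplings, quadratic forms and ultrafilter limits *)

Section PairSums.
Context (R : realType) (X Y : finType).

Lemma sum_pair (f : X * Y -> R) : \sum_z f z = \sum_x \sum_y f (x, y).
Proof. by rewrite pair_bigA; apply: eq_bigr => -[]. Qed.

Lemma sum_pair_swap (f : X * Y -> R) : \sum_z f z = \sum_y \sum_x f (x, y).
Proof. by rewrite sum_pair exchange_big. Qed.

(** Couplings of plain mass functions, so that perturbed marginals can be coupled without being
    packed as probability measures. *)
Definition cpl (a0 : X -> R) (a1 : Y -> R) (q : X * Y -> R) :=
  [/\ forall z, 0 <= q z, forall x, \sum_y q (x, y) = a0 x &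
      forall y, \sum_x q (x, y) = a1 y].

Definition l1 (T : finType) (f : T -> R) := \sum_t `|f t|.

Lemma l1_ge0 (T : finType) (f : T -> R) : 0 <= l1 f.
Proof. by apply: sumr_ge0. Qed.

Lemma le_l1 (T : finType) (f : T -> R) t : `|f t| <= l1 f.
Proof. by rewrite /l1 (bigD1 t)//= lerDl sumr_ge0. Qed.

Lemma sum_le_l1 (T : finType) (f : T -> R) : `|\sum_t f t| <= l1 f.
Proof. exact: ler_norm_sum. Qed.

(** Shrink rows and columns of [q] until both marginals lie below the targets, then add the
    normalised product of the two deficits. If [r] is the distance of the marginals, shrinking loses
    at most [r] of mass and the deficit is at most [2 r], whence the factor 3. *)
Lemma cpl_glue (a0 b0 : X -> R) (a1 b1 : Y -> R) (q : X * Y -> R) :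
  cpl a0 a1 q -> (forall x, 0 <= b0 x) -> (forall y, 0 <= b1 y) ->
  \sum_x b0 x = \sum_y b1 y ->
  exists2 q', cpl b0 b1 q' &
    l1 (fun z => q' z - q z) <=
      3 * (l1 (fun x => b0 x - a0 x) + l1 (fun y => b1 y - a1 y)).
Proof.
move=> [q0 qa0 qa1] b00 b10 bE.
have a00 x : 0 <= a0 x by rewrite -qa0 sumr_ge0.
have a10 y : 0 <= a1 y by rewrite -qa1 sumr_ge0.
(* For [a = 0] the quotient is 0 by convention; this is harmless, since the corresponding row or
   column of [q] is null. *)
pose al (a b : R) := Num.min 1 (b / a).
have al1 a b : al a b <= 1 by rewrite /al ge_min lexx.
have al0 a b : 0 <= a -> 0 <= b -> 0 <= al a b.
  by move=> ? ?; rewrite /al le_min ler01 divr_ge0.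
have alb a b : 0 <= a -> 0 <= b -> a * al a b <= b.
  rewrite le_eqVlt => /predU1P[<-|ap] bp; first by rewrite mul0r.
  apply: (@le_trans _ _ (a * (b / a))).
    by rewrite (ler_wpM2l (ltW ap))// /al ge_min lexx orbT.
  by rewrite mulrC divfK// gt_eqF.
have ald a b : 0 <= a -> 0 <= b -> a * (1 - al a b) <= `|b - a|.
  rewrite le_eqVlt => /predU1P[<-|ap] bp; first by rewrite mul0r.
  rewrite /al; case: (leP 1 (b / a)) => h; first by rewrite subrr mulr0.
  by rewrite mulrBr mulr1 mulrC divfK ?gt_eqF// distrC ler_norm.
pose q1 z := q z * (al (a0 z.1) (b0 z.1) * al (a1 z.2) (b1 z.2)).
pose u (x : X) := al (a0 x) (b0 x); pose v (y : Y) := al (a1 y) (b1 y).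
have q10 z : 0 <= q1 z by rewrite /q1 !mulr_ge0 ?al0.
have q1a x : \sum_y q1 (x, y) <= b0 x.
  apply: le_trans (alb _ _ (a00 x) (b00 x)); rewrite -/(u x) -(qa0 x) mulr_suml.
  by apply: ler_sum => y _; rewrite /q1/= ler_wpM2l// ler_piMr ?al1// al0.
have q1b y : \sum_x q1 (x, y) <= b1 y.
  apply: le_trans (alb _ _ (a10 y) (b10 y)); rewrite -/(v y) -(qa1 y) mulr_suml.
  by apply: ler_sum => x _; rewrite /q1/= ler_wpM2l// ler_piMl ?al1// al0.
pose r0 x := b0 x - \sum_y q1 (x, y); pose r1 y := b1 y - \sum_x q1 (x, y).
have r00 x : 0 <= r0 x by rewrite subr_ge0.
have r10 y : 0 <= r1 y by rewrite subr_ge0.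
pose m := \sum_x r0 x.
have m1 : \sum_y r1 y = m.
  by rewrite /m /r0 /r1 !sumrB -bE exchange_big.
have m0 : 0 <= m by apply: sumr_ge0.
(* Covers the case [m = 0], where the deficits vanish and the division by [m] returns 0. *)
have rm (T : finType) (r : T -> R) t : (forall t, 0 <= r t) -> \sum_t r t = m ->
    r t * (m / m) = r t.
  move=> rp rE; have [mE|mN] := eqVneq m 0; last by rewrite divff// mulr1.
  suff -> : r t = 0 by rewrite mul0r.
  apply: (@psumr_eq0P _ _ xpredT r) => //; by rewrite rE.
pose q' z := q1 z + r0 z.1 * r1 z.2 / m.
exists q'.
  split=> [z|x|y].
  - by rewrite addr_ge0// divr_ge0// mulr_ge0.
  - rewrite /q' big_split/= -mulr_suml -mulr_sumr m1 -mulrA rm//.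
    by rewrite /r0 addrC subrK.
  - rewrite /q' big_split/= -mulr_suml -mulr_suml -/m -mulrA mulrCA.
    by rewrite rm// /r1 addrC subrK.
set r := (X in 3 * X).
have lost : \sum_z (q z - q1 z) <= r.
  apply: (@le_trans _ _ (\sum_z (q z * (1 - u z.1) + q z * (1 - v z.2)))).
    apply: ler_sum => z _; rewrite /q1 -/(u z.1) -/(v z.2) -mulrDr.
    rewrite -[X in X - _](mulr1 (q z)) -mulrBr ler_wpM2l//.
    have : 0 <= (1 - u z.1) * (1 - v z.2) by rewrite mulr_ge0 ?subr_ge0 ?al1.
    by nra.
  rewrite big_split/=; apply: lerD.
    rewrite sum_pair; apply: ler_sum => x _ /=.
    by rewrite -mulr_suml qa0; apply: ald.
  rewrite sum_pair_swap; apply: ler_sum => y _ /=.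
  by rewrite -mulr_suml qa1; apply: ald.
(* The deficit is the change of total mass of the first marginal plus the mass lost by shrinking,
   each at most [r]. *)
have mr : m <= 2 * r.
  have -> : m = \sum_x (b0 x - a0 x) + \sum_z (q z - q1 z).
    rewrite !sumrB (sum_pair q) (sum_pair q1) /m /r0 sumrB.
    under [\sum_x \sum_y q _]eq_bigr do rewrite qa0.
    by rewrite addrA subrK.
  have : \sum_x (b0 x - a0 x) <= l1 (fun x => b0 x - a0 x).
    by apply: le_trans (sum_le_l1 _); rewrite ler_norm.
  have := l1_ge0 (fun y => b1 y - a1 y).
  by move: lost; rewrite /r; lra.
apply: (@le_trans _ _ (\sum_z ((q z - q1 z) + r0 z.1 * r1 z.2 / m))).
  apply: ler_sum => z _.
  have h0 : 0 <= r0 z.1 * r1 z.2 / m by rewrite divr_ge0// mulr_ge0.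
  have h1 : q1 z <= q z by rewrite /q1 ler_piMr// mulr_ile1 ?al0 ?al1.
  by rewrite /q' ler_norml; lra.
rewrite big_split/= [X in _ + X](_ : _ = m).
  by move: lost mr; lra.
rewrite sum_pair /= /m; apply: eq_bigr => x _.
by rewrite -mulr_suml -mulr_sumr m1 -mulrA rm.
Qed.

End PairSums.

Section BilinearForm.
Context (R : realType) (Z : finType) (D : Z -> Z -> R).
Hypothesis Dsym : forall z z', D z z' = D z' z.

Definition bform (a b : Z -> R) := \sum_z \sum_z' D z z' * (a z * b z').

Lemma bformC a b : bform a b = bform b a.
Proof.
rewrite /bform exchange_big; apply: eq_bigr => z _; apply: eq_bigr => z' _.
by rewrite Dsym (mulrC (a _)).
Qed.

Lemma bformDl a b c s :
  bform (fun z => a z + s * b z) c = bform a c + s * bform b c.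
Proof.
rewrite /bform mulr_sumr -big_split/=; apply: eq_bigr => z _.
rewrite mulr_sumr -big_split/=; apply: eq_bigr => z' _; ring.
Qed.

Lemma bformDr a b c s :
  bform c (fun z => a z + s * b z) = bform c a + s * bform c b.
Proof. by rewrite bformC bformDl !(bformC c). Qed.

Lemma bform_sqD a b s : bform (fun z => a z + s * b z) (fun z => a z + s * b z) =
  bform a a + 2 * s * bform a b + s ^+ 2 * bform b b.
Proof. by rewrite bformDl !bformDr (bformC b a); ring. Qed.

Definition bsum := \sum_z \sum_z' `|D z z'|.

Lemma bsum_ge0 : 0 <= bsum.
Proof. by apply: sumr_ge0 => z _; apply: sumr_ge0. Qed.

Lemma D_le_bsum z z' : `|D z z'| <= bsum.
Proof.
rewrite /bsum (bigD1 z)//= (bigD1 z')//= -addrA lerDl addr_ge0 ?sumr_ge0// => i _.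
exact: sumr_ge0.
Qed.

Lemma bform_le a b : `|bform a b| <= bsum * (l1 a * l1 b).
Proof.
have -> : bsum * (l1 a * l1 b) = \sum_z \sum_z' bsum * (`|a z| * `|b z'|).
  rewrite /l1; move: bsum => S; rewrite mulr_suml mulr_sumr; apply: eq_bigr => z _.
  by rewrite !mulr_sumr.
apply: le_trans (ler_norm_sum _ _ _) _; apply: ler_sum => z _.
apply: le_trans (ler_norm_sum _ _ _) _; apply: ler_sum => z' _.
by rewrite !normrM ler_wpM2r ?mulr_ge0// D_le_bsum.
Qed.

End BilinearForm.

Section Ultra.
Context (R : realType) (F : set_system nat) (UF : UltraFilter F).
Let PF : ProperFilter F := ultra_proper.
#[local] Existing Instance PF.

(** Compactness of the segment gives a cluster point, and an ultrafilter converges to each of its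
    cluster points. *)
Lemma ultra_cvg (u : nat -> R) M : (forall k, `|u k| <= M) ->
  exists l : R, u @ F --> l.
Proof.
move=> uM.
have [] := @segment_compact R (- M) M (u @ F) _.
  suff : F (u @^-1` `[- M, M]%classic) by [].
  by apply: filterS filterT => k _ /=; rewrite in_itv/= -ler_norml uM.
move=> l [_ lcl]; exists l => U nU.
have [//|FU] := in_ultra_setVsetC (u @^-1` U) UF.
by have [x [hx Ux]] := lcl (~` U) U FU nU; case: (hx Ux).
Qed.

(** Pigeonhole: otherwise all complements of the fibres, hence their empty finite intersection,
    would belong to [F]. It later freezes the support of the optimal plans. *)
Lemma ultra_finite (T : finType) (f : nat -> T) : exists t, F [set k | f k = t].
Proof.
apply: contrapT => /forallNP h.
have hC t : F (~` [set k | f k = t]) by have [/h|] := in_ultra_setVsetC [set k | f k = t] UF.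
have : forall s : seq T, F [set k | f k \notin s].
  elim=> [|t s IH]; first by apply: filterS filterT.
  apply: filterS (filterI (hC t) IH) => k [/= /eqP kt ks].
  by rewrite inE negb_or kt.
by move=> /(_ (enum T)) /filter_ex[k /=]; rewrite mem_enum.
Qed.

End Ultra.

Lemma cvg_sumr (R : realType) (I : finType) (T : Type) (F : set_system T)
    {FF : Filter F} (f : I -> T -> R) (l : I -> R) :
  (forall i, f i @ F --> l i) ->
  (fun t => \sum_i f i t) @ F --> \sum_i l i.
Proof.
move=> fl; elim: (index_enum I) => [|i s IH].
  under eq_fun do rewrite big_nil; rewrite big_nil; exact: cvg_cst.
by under eq_fun do rewrite big_cons; rewrite big_cons; apply: cvgD.
Qed.

Lemma l1_cvg0 (R : realType) (T : finType) (F : set_system nat) {FF : Filter F}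
    (u : nat -> T -> R) (v : T -> R) : (forall x, (fun k => u k x) @ F --> v x) ->
  (fun k => l1 (fun x => u k x - v x)) @ F --> (0 : R).
Proof.
move=> h; rewrite (_ : 0 = \sum_(t : T) `|v t - v t|); last first.
  by rewrite big1// => t _; rewrite subrr normr0.
by apply: cvg_sumr => t; apply: cvg_norm; apply: cvgB => //; exact: cvg_cst.
Qed.

Section XlnxLimits.
Context (R : realType) (T : Type) (F : set_system T) (FF : Filter F).

Lemma xlnx_cvg (u : T -> R) (a : R) : (forall k, 0 <= u k <= 1) -> 0 <= a <= 1 ->
  u @ F --> a -> (fun k => xlnx (u k)) @ F --> xlnx a.
Proof.
move=> u01 a01 ua; apply/cvgrPdist_le => e e0.
have : (fun k => 2 * Num.sqrt `|a - u k|) @ F --> 2 * Num.sqrt `|a - a|.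
  apply: cvgM; first exact: cvg_cst.
  apply: (continuous_cvg _ (@sqrt_continuous R _)).
  by apply: cvg_norm; apply: cvgB => //; exact: cvg_cst.
rewrite subrr normr0 sqrtr0 mulr0 => /cvgrPdist_le /(_ _ e0).
apply: filterS => k; rewrite sub0r normrN ger0_norm ?mulr_ge0//.
by apply: le_trans; exact: xlnx_holder.
Qed.

(* The increment quotient of xlnx is squeezed between its tangent slopes at the
   two endpoints. *)
Lemma xlnx_quotient (a u t : T -> R) (a0 u0 : R) : 0 < a0 ->
  a @ F --> a0 -> u @ F --> u0 -> t @ F --> (0 : R) -> (forall k, 0 < t k) ->
  (fun k => (xlnx (a k + t k * u k) - xlnx (a k)) / t k) @ F --> u0 * (ln a0 + 1).
Proof.
move=> a0p aa uu tt tp.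
have att : (fun k => a k + t k * u k) @ F --> a0.
  by rewrite -[a0]addr0 -(mul0r u0); apply: cvgD => //; apply: cvgM.
have lnc (b : T -> R) : b @ F --> a0 ->
    (fun k => u k * (ln (b k) + 1)) @ F --> u0 * (ln a0 + 1).
  move=> bb; apply: cvgM => //; apply: cvgD; last exact: cvg_cst.
  exact: (continuous_cvg _ (continuous_ln a0p)).
apply: (squeeze_cvgr _ (lnc _ aa) (lnc _ att)).
have h1 := @cvgr_gt _ _ _ FF _ a0 aa 0 a0p; have h2 := @cvgr_gt _ _ _ FF _ a0 att 0 a0p.
near=> k.
have ak : 0 < a k by near: k.
have atk : 0 < a k + t k * u k by near: k.
have tk := tp k.
rewrite ler_pdivlMr// ler_pdivrMr//.
have := xlnx_tangent (ltW atk) ak; have := xlnx_tangent (ltW ak) atk.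
by rewrite mulrC; nra.
Unshelve. all: by end_near. Qed.

End XlnxLimits.

(** * Existence, modulus of continuity and stability of optimal plans *)

Section FiniteProbabilities.
Context (R : realType).

Lemma pmass_le1 (T : finType) (mu : fprob R T) t : mu t <= 1.
Proof.
rewrite -(pmass_sum1 mu) (bigD1 t)//= lerDl; apply: sumr_ge0 => *; exact: pmass_ge0.
Qed.

Lemma pmass01 (T : finType) (mu : fprob R T) t : 0 <= mu t <= 1.
Proof. by rewrite pmass_ge0 pmass_le1. Qed.

Lemma l1_pmass (T : finType) (mu : fprob R T) : l1 mu = 1.
Proof.
by rewrite -(pmass_sum1 mu); apply: eq_bigr => t _; rewrite ger0_norm// pmass_ge0.
Qed.

Lemma fprob_of (T : finType) (q : T -> R) : (forall t, 0 <= q t) ->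
  \sum_t q t = 1 -> exists mu : fprob R T, pmass mu = q.
Proof. by move=> q0 q1; exists (FProb q0 q1). Qed.

Lemma fprob_inhabited (T : finType) (mu : fprob R T) : exists t : T, True.
Proof.
apply: contrapT => /forallNP no; have := pmass_sum1 mu.
rewrite big1; last by move=> t _; case: (no t).
by move=> /eqP; rewrite eq_sym oner_eq0.
Qed.

Lemma fprob_ultra (F : set_system nat) (UF : UltraFilter F) (T : finType)
    (mu : nat -> fprob R T) :
  exists nu : fprob R T, forall t, (fun k => mu k t) @ F --> nu t.
Proof.
have PF := @ultra_proper _ _ UF.
have h t : exists l : R, (fun k => mu k t) @ F --> l.
  apply: (@ultra_cvg R F UF _ 1) => k.
  by rewrite ger0_norm ?pmass_ge0// pmass_le1.
have [l lP] := choice h.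
have l0 t : 0 <= l t.
  apply: (cvgr_to_ge (lP t)); apply: filterE => k; exact: pmass_ge0.
have lE : \sum_t l t = 1.
  have : (fun k => \sum_t mu k t) @ F --> \sum_t l t by apply: cvg_sumr.
  under eq_fun do rewrite pmass_sum1; move=> c.
  by apply: (cvg_unique _ c (cvg_cst _)).
by exists (FProb l0 lE).
Qed.

Context (X0 X1 : finType).
Implicit Types (nu : fprob R X0) (rho : fprob R X1) (pi : fprob R (X0 * X1)%type).

Lemma couplingP nu rho pi : coupling nu rho pi <-> cpl nu rho pi.
Proof.
split=> [[h0 h1]|[_ h0 h1]]; split=> //; exact: pmass_ge0.
Qed.

Lemma coupling_of nu rho (q : X0 * X1 -> R) : cpl nu rho q ->
  exists2 pi, coupling nu rho pi & pmass pi = q.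
Proof.
move=> [q0 qa qb]; have q1 : \sum_z q z = 1.
  by rewrite sum_pair -(pmass_sum1 nu); apply: eq_bigr.
by have [pi piE] := fprob_of q0 q1; exists pi => //; apply/couplingP; rewrite piE.
Qed.

Lemma coupling_prod nu rho : coupling nu rho (fprob_prod nu rho).
Proof.
split=> [x|y] /=; first by rewrite -mulr_sumr pmass_sum1 mulr1.
by rewrite -mulr_suml pmass_sum1 mul1r.
Qed.

Definition ent (T : finType) (a : T -> R) := \sum_t xlnx (a t).

(** The logarithm of the product density splits, and integrating each part against the plan only
    sees a marginal. Each mass of the plan is below both marginal masses, so logarithms of 0 occur
    only where the plan itself vanishes. *)
Lemma KL_coupling nu rho pi : coupling nu rho pi ->
  KL pi (fprob_prod nu rho) = ent pi - ent nu - ent rho.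
Proof.
move=> [ha hb].
have pia x y : pi (x, y) <= nu x.
  rewrite -ha (bigD1 y)//= lerDl; apply: sumr_ge0 => *; exact: pmass_ge0.
have pib x y : pi (x, y) <= rho y.
  rewrite -hb (bigD1 x)//= lerDl; apply: sumr_ge0 => *; exact: pmass_ge0.
have e0 : ent nu = \sum_z pi z * ln (nu z.1).
  by rewrite sum_pair; apply: eq_bigr => x _ /=; rewrite -mulr_suml ha.
have e1 : ent rho = \sum_z pi z * ln (rho z.2).
  by rewrite sum_pair_swap; apply: eq_bigr => y _ /=; rewrite -mulr_suml hb.
rewrite e0 e1 /KL /integ /ent -!sumrB; apply: eq_bigr => -[x y] _ /=.
have := pmass_ge0 pi (x, y); rewrite le_eqVlt => /predU1P[<-|p0].
  by rewrite xlnx0 !mul0r mulr0 !subrr.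
have n0 := lt_le_trans p0 (pia x y); have n1 := lt_le_trans p0 (pib x y).
rewrite ln_div ?posrE ?mulr_gt0// lnM ?posrE// /xlnx; ring.
Qed.

End FiniteProbabilities.

Section Core.
Context (R : realType) (X0 X1 : finType).
Context (p : R) (k0 : X0 -> X0 -> R) (k1 : X1 -> X1 -> R).
Hypothesis Delta_sym : forall x y x' y',
  Delta p k0 k1 x y x' y' = Delta p k0 k1 x' y' x y.
Implicit Types (nu : fprob R X0) (rho : fprob R X1) (pi : fprob R (X0 * X1)%type).

Definition DD (z z' : X0 * X1) := Delta p k0 k1 z.1 z.2 z'.1 z'.2.

Lemma DDsym z z' : DD z z' = DD z' z. Proof. exact: Delta_sym. Qed.

Lemma DD_ge0 z z' : 0 <= DD z z'. Proof. exact: powR_ge0. Qed.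

(** The cost extended to plain functions, with the marginals as separate arguments, so that plan and
    marginals can be perturbed independently. *)
Definition energy eps (a0 : X0 -> R) (a1 : X1 -> R) (q : X0 * X1 -> R) :=
  bform DD q q + eps * (ent q - ent a0 - ent a1).

Lemma EGW_costE eps nu rho pi : coupling nu rho pi ->
  EGW_cost p k0 k1 eps nu rho pi = energy eps nu rho pi.
Proof.
move=> h; rewrite /EGW_cost KL_coupling// /energy /bform /integ; congr (_ + _).
by rewrite pair_bigA; apply: eq_bigr => -[z z'] _.
Qed.

(** The factor 2 in [plan_cost] is that of the derivative of a quadratic form: the plan cost is the
    gradient of [B] at the plan. *)
Lemma plan_cost_bform pi (q : X0 * X1 -> R) :
  \sum_z plan_cost p k0 k1 pi z.1 z.2 * q z = 2 * bform DD pi q.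
Proof.
rewrite (bformC DDsym) /bform mulr_sumr; apply: eq_bigr => z _.
rewrite /plan_cost /integ -mulrA mulr_suml !mulr_sumr.
by apply: eq_bigr => z' _; rewrite /DD; ring.
Qed.

Lemma ent_le0 (T : finType) (mu : fprob R T) : ent mu <= 0.
Proof. by apply: sumr_le0 => t _; rewrite xlnx_le0 ?pmass_ge0 ?pmass_le1. Qed.

Lemma ent_ge (T : finType) (mu : fprob R T) : - (2 * #|T|%:R) <= ent mu.
Proof.
have -> : - (2 * #|T|%:R) = \sum_(t : T) (- 2 : R).
  by rewrite sumr_const -[RHS]mulr_natr mulNr.
apply: ler_sum => t _; apply: le_trans (xlnx_ge_sqrt (pmass_ge0 mu t)).
by rewrite lerN2 -[leRHS]mulr1 ler_pM2l// -sqrtr1 ler_wsqrtr// pmass_le1.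
Qed.

Section Eps.
Context (eps : R) (eps0 : 0 <= eps).
Local Notation V := (EGW p k0 k1 eps).

Lemma energy_ge nu rho pi : coupling nu rho pi ->
  - (eps * (2 * #|{: X0 * X1}|%:R)) <= energy eps nu rho pi.
Proof.
move=> _; have h : 0 <= bform DD pi pi.
  by do 2![apply: sumr_ge0 => ? _]; rewrite !mulr_ge0 ?DD_ge0 ?pmass_ge0.
rewrite /energy -[leLHS]add0r -mulrN; apply: lerD => //; apply: ler_wpM2l => //.
have := ent_ge pi; have := ent_le0 nu; have := ent_le0 rho; lra.
Qed.

Lemma EGW_has_inf nu rho :
  has_inf [set EGW_cost p k0 k1 eps nu rho pi | pi in coupling nu rho].
Proof.
split; first by eexists; exists (fprob_prod nu rho) => //; exact: coupling_prod.
exists (- (eps * (2 * #|{: X0 * X1}|%:R))) => _ [pi cpi <-].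
by rewrite EGW_costE//; apply: energy_ge.
Qed.

Lemma EGW_le nu rho (q : X0 * X1 -> R) : cpl nu rho q ->
  V nu rho <= energy eps nu rho q.
Proof.
move=> /coupling_of[pi cpi <-]; rewrite -EGW_costE//.
by apply: ge_inf; [case: (EGW_has_inf nu rho)|exists pi].
Qed.

Lemma energy_cvg (F : set_system nat) (FF : Filter F)
   (a0 : nat -> fprob R X0) (a1 : nat -> fprob R X1) (q : nat -> fprob R (X0 * X1)%type)
   nu rho pi :
  (forall x, (fun k => a0 k x) @ F --> nu x) ->
  (forall x, (fun k => a1 k x) @ F --> rho x) ->
  (forall x, (fun k => q k x) @ F --> pi x) ->
  (fun k => energy eps (a0 k) (a1 k) (q k)) @ F --> energy eps nu rho pi.
Proof.
have entc (T : finType) (u : nat -> fprob R T) (v : fprob R T) :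
    (forall x, (fun k => u k x) @ F --> v x) -> (fun k => ent (u k)) @ F --> ent v.
  by move=> h; apply: cvg_sumr => t; apply: xlnx_cvg => // *; exact: pmass01.
move=> h0 h1 hq; apply: cvgD.
  apply: cvg_sumr => z; apply: cvg_sumr => z'; apply: cvgM; first exact: cvg_cst.
  exact: cvgM.
apply: cvgM; first exact: cvg_cst.
by apply: cvgB; [apply: cvgB|]; apply: entc.
Qed.

Lemma coupling_cvg (F : set_system nat) (FF : ProperFilter F)
   (a0 : nat -> fprob R X0) (a1 : nat -> fprob R X1) (q : nat -> fprob R (X0 * X1)%type)
   nu rho pi :
  (forall x, (fun k => a0 k x) @ F --> nu x) ->
  (forall x, (fun k => a1 k x) @ F --> rho x) ->
  (forall x, (fun k => q k x) @ F --> pi x) ->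
  (forall k, coupling (a0 k) (a1 k) (q k)) -> coupling nu rho pi.
Proof.
move=> h0 h1 hq c; split=> [x|y].
  have := h0 x; rewrite (_ : (fun k => a0 k x) = fun k => \sum_y q k (x, y)); last first.
    by apply/funext => k; case: (c k).
  move=> h; apply: (cvg_unique _ _ h) => //; exact: cvg_sumr.
have := h1 y; rewrite (_ : (fun k => a1 k y) = fun k => \sum_x q k (x, y)); last first.
  by apply/funext => k; case: (c k).
move=> h; apply: (cvg_unique _ _ h) => //; exact: cvg_sumr.
Qed.

Lemma nat_ultra : exists F : set_system nat, UltraFilter F /\ \oo `<=` F.
Proof. exact: ultraFilterLemma. Qed.

Lemma ultra_ninfty (F : set_system nat) (u : nat -> R) (l : R) : \oo `<=` F ->
  u @ \oo --> l -> u @ F --> l.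
Proof. by move=> Foo h U /h; exact: Foo. Qed.

Lemma EGW_attained nu rho : exists2 pi, coupling nu rho pi &
  energy eps nu rho pi = V nu rho.
Proof.
have [F [UF Foo]] := nat_ultra; have PF := @ultra_proper _ _ UF.
have h k : exists pi, coupling nu rho pi /\ energy eps nu rho pi < V nu rho + k.+1%:R^-1.
  have kp : 0 < k.+1%:R^-1 :> R by rewrite invr_gt0.
  have [_ [pi cpi <-]] := inf_adherent kp (EGW_has_inf nu rho).
  by rewrite EGW_costE// => ?; exists pi.
have [q qP] := choice h.
have [pi qpi] := fprob_ultra UF q.
have cpi : coupling nu rho pi.
  apply: (@coupling_cvg F PF (fun=> nu) (fun=> rho) q nu rho pi) => // [x|x|k].
  - exact: cvg_cst.
  - exact: cvg_cst.
  - by case: (qP k).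
exists pi => //; apply/eqP; rewrite eq_le EGW_le ?andbT; last exact/couplingP.
have c1 : (fun k => energy eps nu rho (q k)) @ F --> energy eps nu rho pi.
  by apply: energy_cvg => // x; exact: cvg_cst.
have c2 : (fun k => V nu rho + k.+1%:R^-1) @ F --> V nu rho.
  rewrite -[X in _ --> X]addr0; apply: cvgD; first exact: cvg_cst.
  by apply: ultra_ninfty => //; exact: cvg_harmonic.
by apply: (ler_cvg_to c1 c2); apply: filterE => k; case: (qP k) => _ /ltW.
Qed.

Lemma optimalP nu rho pi : optimal_plans p k0 k1 eps nu rho pi <->
  coupling nu rho pi /\ energy eps nu rho pi = V nu rho.
Proof.
split=> [[c h]|[c h]]; split=> //.
  apply/eqP; rewrite eq_le EGW_le ?andbT; last exact/couplingP.
  have [pi' c' <-] := EGW_attained nu rho.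
  by rewrite -!EGW_costE//; exact: h.
by move=> pi' c'; rewrite !EGW_costE// h EGW_le//; exact/couplingP.
Qed.

Lemma optimal_ex nu rho : exists pi, optimal_plans p k0 k1 eps nu rho pi.
Proof. by have [pi c h] := EGW_attained nu rho; exists pi; apply/optimalP. Qed.

Lemma ent_holder (T : finType) (mu nu : fprob R T) r :
  l1 (fun t => mu t - nu t) <= r -> `|ent mu - ent nu| <= #|T|%:R * (2 * Num.sqrt r).
Proof.
move=> h; rewrite /ent -sumrB.
have -> : #|T|%:R * (2 * Num.sqrt r) = \sum_(t : T) (2 * Num.sqrt r).
  by rewrite sumr_const -[RHS]mulr_natl.
apply: le_trans (ler_norm_sum _ _ _) _; apply: ler_sum => t _.
apply: le_trans (xlnx_holder (pmass01 mu t) (pmass01 nu t)) _.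
rewrite ler_pM2l// ler_wsqrtr//; apply: le_trans h.
exact: (le_l1 (fun t => mu t - nu t)).
Qed.

(** 6 is 3 from gluing times 2, the total mass of [pi' + pi] in the polarisation [B(pi', pi') -
    B(pi, pi) = B(pi' - pi, pi' + pi)]. *)
Definition Kq := 6 * bsum DD.
(** The Hölder constant 2 of [xlnx], once for each term of the three entropies. *)
Definition Ke : R := 2 * (#|{: X0 * X1}| + #|X0| + #|X1|)%:R.

(** An optimal plan for the old marginals is glued to the new ones at distance at most [3 r] and
    used as a competitor. At [eps = 0] the bound is Lipschitz. *)
Lemma EGW_modulus_le nu rho nu' rho' r :
  l1 (fun x => nu' x - nu x) + l1 (fun y => rho' y - rho y) <= r ->
  V nu' rho' <= V nu rho + (Kq * r + eps * (Ke * Num.sqrt (3 * r))).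
Proof.
move=> hr.
have l0 := l1_ge0 (fun x => nu' x - nu x); have l1' := l1_ge0 (fun y => rho' y - rho y).
have r0 : 0 <= r by lra.
have [pi cpi <-] := EGW_attained nu rho.
have /couplingP cp := cpi.
have [q' cq' lq] := cpl_glue cp (pmass_ge0 nu') (pmass_ge0 rho')
  (etrans (pmass_sum1 nu') (esym (pmass_sum1 rho'))).
have [pi' cpi' qE] := coupling_of cq'.
have lq' : l1 (fun z => pi' z - pi z) <= 3 * r.
  by rewrite qE; apply: le_trans lq _; rewrite ler_pM2l.
apply: le_trans (EGW_le cq') _; rewrite -qE /energy.
have hB : bform DD pi' pi' - bform DD pi pi <= Kq * r.
  have -> : bform DD pi' pi' - bform DD pi pi =
      bform DD (fun z => pi' z + -1 * pi z) (fun z => pi' z + 1 * pi z).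
    by rewrite bformDl !(bformDr DDsym) (bformC DDsym pi' pi); ring.
  apply: le_trans (ler_norm _) _; apply: le_trans (bform_le _ _ _) _.
  have -> : Kq * r = bsum DD * ((3 * r) * 2) by rewrite /Kq; ring.
  apply: ler_wpM2l; first exact: bsum_ge0.
  apply: ler_pM; rewrite ?l1_ge0//.
    apply: le_trans lq'; rewrite le_eqVlt; apply/orP; left; apply/eqP.
    by apply: eq_bigr => z _; rewrite mulN1r.
  have -> : 2 = l1 pi' + l1 pi by rewrite !l1_pmass.
  by rewrite /l1 -big_split/=; apply: ler_sum => z _; rewrite mul1r ler_normD.
have s3 : Num.sqrt r <= Num.sqrt (3 * r) by rewrite ler_wsqrtr//; lra.
have hz := ent_holder lq'.
have hx : `|ent nu' - ent nu| <= #|X0|%:R * (2 * Num.sqrt (3 * r)).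
  apply: ent_holder; lra.
have hy : `|ent rho' - ent rho| <= #|X1|%:R * (2 * Num.sqrt (3 * r)).
  apply: ent_holder; lra.
have hE : (ent pi' - ent nu' - ent rho') - (ent pi - ent nu - ent rho) <=
    Ke * Num.sqrt (3 * r).
  rewrite /Ke !natrD; move: hz hx hy; rewrite !ler_norml.
  by move=> /andP[? ?] /andP[? ?] /andP[? ?]; lra.
have := ler_wpM2l eps0 hE; rewrite mulrBr; move: hB; lra.
Qed.

Lemma EGW_modulus nu rho nu' rho' r :
  l1 (fun x => nu' x - nu x) + l1 (fun y => rho' y - rho y) <= r ->
  `|V nu' rho' - V nu rho| <= Kq * r + eps * (Ke * Num.sqrt (3 * r)).
Proof.
move=> hr; have h := EGW_modulus_le hr.
have sym (T : finType) (a b : T -> R) : l1 (fun x => a x - b x) = l1 (fun x => b x - a x).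
  by apply: eq_bigr => t _; rewrite distrC.
move: hr; rewrite (sym _ nu') (sym _ rho') => /EGW_modulus_le h'.
by rewrite ler_norml; apply/andP; split; lra.
Qed.

Lemma modulus_small e : 0 < e -> exists2 d, 0 < d &
  forall r, 0 <= r -> r <= d -> Kq * r + eps * (Ke * Num.sqrt (3 * r)) < e.
Proof.
move=> e0; pose g (r : R) := Kq * r + eps * (Ke * Num.sqrt (3 * r)).
have : g r @[r --> (0:R)] --> g 0.
  apply: cvgD; first by apply: cvgM => //; exact: cvg_cst.
  apply: cvgM; first exact: cvg_cst.
  apply: cvgM; first exact: cvg_cst.
  apply: (continuous_cvg _ (@sqrt_continuous R _)).
  by apply: cvgM => //; exact: cvg_cst.
rewrite /g !(mulr0, sqrtr0, addr0) => /cvgrPdist_lt /(_ _ e0).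
move=> /nbhs_ballP[d /= d0 hd]; exists (d / 2); first by rewrite divr_gt0.
move=> r r0 rd.
have := hd r; rewrite /ball/= sub0r normrN ger0_norm// => /(_ ltac:(lra)).
by rewrite sub0r normrN; apply: le_lt_trans; exact: ler_norm.
Qed.

Lemma EGW_cvg (F : set_system nat) (FF : Filter F)
   (a0 : nat -> fprob R X0) (a1 : nat -> fprob R X1) nu rho :
  (forall x, (fun k => a0 k x) @ F --> nu x) ->
  (forall x, (fun k => a1 k x) @ F --> rho x) ->
  (fun k => V (a0 k) (a1 k)) @ F --> V nu rho.
Proof.
move=> h0 h1; apply/cvgrPdist_lt => e e0.
have [d d0 hd] := modulus_small e0.
pose r k := l1 (fun x => a0 k x - nu x) + l1 (fun y => a1 k y - rho y).
have rc : r @ F --> 0 by rewrite -[0]addr0; apply: cvgD; exact: l1_cvg0.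
have := @cvgr_lt _ _ _ FF _ _ rc _ d0.
apply: filterS => k rk; rewrite distrC.
apply: le_lt_trans (EGW_modulus (lexx _)) _.
by apply: hd; [rewrite addr_ge0 ?l1_ge0|exact: ltW].
Qed.

(** Optimality is an equality between energy and value, and both sides pass to the limit. *)
Lemma optimal_cvg (F : set_system nat) (FF : ProperFilter F)
   (a0 : nat -> fprob R X0) (a1 : nat -> fprob R X1) (q : nat -> fprob R (X0 * X1)%type)
   nu rho pi :
  (forall x, (fun k => a0 k x) @ F --> nu x) ->
  (forall x, (fun k => a1 k x) @ F --> rho x) ->
  (forall x, (fun k => q k x) @ F --> pi x) ->
  (forall k, optimal_plans p k0 k1 eps (a0 k) (a1 k) (q k)) ->
  optimal_plans p k0 k1 eps nu rho pi.
Proof.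
move=> h0 h1 hq opt; apply/optimalP; split.
  by apply: (coupling_cvg FF h0 h1 hq) => k; case: (opt k).
have cJ := energy_cvg FF h0 h1 hq; have cV := EGW_cvg FF h0 h1.
apply: (cvg_unique _ cJ) => //.
rewrite (_ : (fun k => energy eps _ _ _) = (fun k => V (a0 k) (a1 k)))//.
by apply/funext => k; have /optimalP[] := opt k.
Qed.

End Eps.
End Core.

(** * Linear duality and the unregularised problem *)

Section LinearProgramming.
Context (R : realType) (X0 X1 : finType).
Implicit Types (q : X0 * X1 -> R) (phi : (X0 -> R) * (X1 -> R)).

Definition marg q (h0 : X0 -> R) (h1 : X1 -> R) :=
  (forall x, \sum_y q (x, y) = h0 x) /\ (forall y, \sum_x q (x, y) = h1 y).

Definition pairf phi (h0 : X0 -> R) (h1 : X1 -> R) : R :=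
  \sum_x phi.1 x * h0 x + \sum_y phi.2 y * h1 y.

Lemma pairf_marg phi q h0 h1 : marg q h0 h1 ->
  pairf phi h0 h1 = \sum_z (phi.1 z.1 + phi.2 z.2) * q z.
Proof.
move=> [m0 m1]; under [RHS]eq_bigr do rewrite mulrDl.
rewrite big_split/= sum_pair (sum_pair_swap (fun z => phi.2 z.2 * q z)) /=.
congr (_ + _); apply: eq_bigr => x _; first by rewrite -m0 mulr_sumr.
by rewrite -m1 mulr_sumr.
Qed.

Lemma pairfZ phi (s : R) h0 h1 :
  pairf phi (fun x => s * h0 x) (fun y => s * h1 y) = s * pairf phi h0 h1.
Proof.
rewrite /pairf mulrDr !mulr_sumr.
by congr (_ + _); apply: eq_bigr => x _; rewrite mulrCA.
Qed.

Lemma pairfD phi g0 g1 h0 h1 :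
  pairf phi (fun x => g0 x + h0 x) (fun y => g1 y + h1 y) =
  pairf phi g0 g1 + pairf phi h0 h1.
Proof.
rewrite /pairf; under eq_bigr do rewrite mulrDr.
under [X in _ + X = _]eq_bigr do rewrite mulrDr.
by rewrite !big_split/=; ring.
Qed.

Lemma marg_lin q q' h0 h1 h0' h1' (s : R) : marg q h0 h1 -> marg q' h0' h1' ->
  marg (fun z => q z + s * q' z) (fun x => h0 x + s * h0' x) (fun y => h1 y + s * h1' y).
Proof.
move=> [m0 m1] [m0' m1']; split=> [x|y].
  by rewrite big_split/= m0 -mulr_sumr m0'.
by rewrite big_split/= m1 -mulr_sumr m1'.
Qed.

Lemma cpl_marg a0 a1 q : cpl a0 a1 q <-> (forall z, 0 <= q z) /\ marg q a0 a1.
Proof. by split=> [[? ? ?]|[? [? ?]]]. Qed.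

Lemma sum_eqZ (T : finType) (t : T) (f : T -> R) : \sum_i (i == t)%:R * f i = f t.
Proof.
rewrite (bigD1 t)//= eqxx mul1r big1 ?addr0// => i /negPf ->.
by rewrite mul0r.
Qed.

Lemma sum_fst_eq (x : X0) q : \sum_z q z * (x == z.1)%:R = \sum_y q (x, y).
Proof.
rewrite sum_pair exchange_big/=; apply: eq_bigr => y _.
by rewrite -(sum_eqZ x (fun i => q (i, y))); apply: eq_bigr => i _; rewrite eq_sym mulrC.
Qed.

Lemma sum_snd_eq (y : X1) q : \sum_z q z * (y == z.2)%:R = \sum_x q (x, y).
Proof.
rewrite sum_pair; apply: eq_bigr => x _.
by rewrite -(sum_eqZ y (fun i => q (x, i))); apply: eq_bigr => i _; rewrite eq_sym mulrC.
Qed.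

Section Dual.
Context (c : X0 -> X1 -> R) (S : pred (X0 * X1)).

(** Dual feasibility with complementary slackness on [S]. When [S] is the support of an optimal
    plan, these are the OT potentials, see [OT_potentialsE]. *)
Definition tight phi := (forall x y, phi.1 x + phi.2 y <= c x y) /\
  forall x y, S (x, y) -> phi.1 x + phi.2 y = c x y.

(** The unknowns are the two potentials and the homogenising variable. The constraints in [I] are
    feasibility at each pair, the reverse inequality on [S], and nonnegativity of the homogenising
    variable. *)
Let T : finType := ((X0 + X1) + 'I_1)%type.
Let I : finType := (((X0 * X1) + (X0 * X1)) + 'I_1)%type.

Let coef (z : X0 * X1) (t : T) : R := match t with
  | inl (inl x) => (x == z.1)%:R
  | inl (inr y) => (y == z.2)%:R
  | inr _ => - c z.1 z.2 end.

Let constr (i : I) (t : T) : R := match i with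
  | inl (inl z) => coef z t
  | inl (inr z) => - (S z)%:R * coef z t
  | inr _ => if t is inr _ then - 1 else 0 end.

(* [s] is the homogenising variable of the linear program. *)
Lemma farkas_dual (f0 : X0 -> R) (f1 : X1 -> R) (m : R) :
  (forall phi (s : R), 0 <= s -> (forall x y, phi.1 x + phi.2 y <= s * c x y) ->
    (forall x y, S (x, y) -> phi.1 x + phi.2 y = s * c x y) ->
    pairf phi f0 f1 <= s * m) ->
  exists eta, [/\ marg eta f0 f1, forall z, ~~ S z -> 0 <= eta z &
    \sum_z c z.1 z.2 * eta z <= m].
Proof.
move=> H; pose f (t : T) : R := match t with
  | inl (inl x) => f0 x | inl (inr y) => f1 y | inr _ => - m end.
have sumT (g : T -> R) : \sum_t g t =
    \sum_x g (inl (inl x)) + \sum_y g (inl (inr y)) + g (inr ord0).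
  by rewrite !big_sumType/= big_ord1.
have sumI (g : I -> R) : \sum_t g t =
    \sum_z (g (inl (inl z)) + g (inl (inr z))) + g (inr ord0).
  by rewrite !big_sumType/= big_ord1 big_split.
have [w wle|l [l0 lE]] := @farkas R T I constr f.
  pose phi := (fun x => w (inl (inl x)), fun y => w (inl (inr y))).
  pose s := w (inr ord0).
  have coefE z : \sum_t coef z t * w t = phi.1 z.1 + phi.2 z.2 - s * c z.1 z.2.
    by rewrite sumT/= !sum_eqZ mulNr (mulrC (c _ _)).
  have s0 : 0 <= s.
    have := wle (inr ord0); rewrite sumT/= !big1 ?add0r; last 2 first.
      by move=> *; rewrite mul0r.
      by move=> *; rewrite mul0r.
    by rewrite mulN1r oppr_le0.
  have le1 x y : phi.1 x + phi.2 y <= s * c x y.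
    by have := wle (inl (inl (x, y))); rewrite coefE subr_le0.
  have := H phi s s0 le1 _; rewrite sumT/= /pairf/=.
  have comm (U : finType) (g g' : U -> R) : \sum_x g x * g' x = \sum_x g' x * g x.
    by apply: eq_bigr => *; rewrite mulrC.
  rewrite (comm _ _ f0) (comm _ _ f1) mulNr -/s (mulrC m) subr_le0; apply.
  move=> x y Sxy; apply/eqP; rewrite eq_le le1/=.
  have := wle (inl (inr (x, y))); rewrite /= Sxy.
  under eq_bigr do rewrite mulN1r mulNr.
  by rewrite sumrN coefE opprB subr_le0.
(* Difference of the multipliers of the two opposite inequalities at [z]; off [S] only the
   nonnegative one remains. *)
pose eta z := l (inl (inl z)) - (S z)%:R * l (inl (inr z)).
have etaE t : \sum_z (l (inl (inl z)) * constr (inl (inl z)) t +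
    l (inl (inr z)) * constr (inl (inr z)) t) = \sum_z eta z * coef z t.
  by apply: eq_bigr => z _ /=; rewrite /eta; ring.
exists eta; split.
- split=> [x|y].
    have := lE (inl (inl x)); rewrite sumI etaE/= mulr0 addr0 => ->.
    by rewrite sum_fst_eq.
  have := lE (inl (inr y)); rewrite sumI etaE/= mulr0 addr0 => ->.
  by rewrite sum_snd_eq.
- by move=> z /negPf Sz; rewrite /eta Sz mul0r subr0.
(* The multiplier of the sign constraint on the homogenising variable is the slack in the cost
   bound. *)
- have := lE (inr ord0); rewrite sumI etaE/= mulrN1.
  under eq_bigr do rewrite mulrN mulrC.
  by rewrite sumrN; have := l0 (inr ord0); lra.
Qed.

Lemma tight_scale phi (s : R) : 0 < s -> (forall x y, phi.1 x + phi.2 y <= s * c x y) ->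
  (forall x y, S (x, y) -> phi.1 x + phi.2 y = s * c x y) ->
  tight (fun x => s^-1 * phi.1 x, fun y => s^-1 * phi.2 y).
Proof.
move=> s0 le1 eq1; split=> x y /=; rewrite -mulrDr mulrC.
  by rewrite ler_pdivrMr// mulrC.
by move=> /eq1 ->; rewrite mulrC mulKf// gt_eqF.
Qed.

(** Farkas with zero marginals and [m = -1]: if no tight pair existed, the alternative would be an
    admissible direction of cost at most -1. *)
Lemma tight_ex :
  (forall s, marg s (fun=> 0) (fun=> 0) -> (forall z, ~~ S z -> 0 <= s z) ->
    0 <= \sum_z c z.1 z.2 * s z) ->
  exists phi, tight phi.
Proof.
move=> H; apply: contrapT => /forallNP no.
have [phi s s0 le1 eq1|eta [m0 eta0]] := @farkas_dual (fun=> 0) (fun=> 0) (-1).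
  move: s0; rewrite le_eqVlt => /predU1P[<-|s0].
    by rewrite mul0r /pairf !big1 ?addr0// => *; rewrite mulr0.
  by have /no[] := tight_scale s0 le1 eq1.
by have := H _ m0 eta0; lra.
Qed.

(** For [s > 0] the homogenised inequality is the hypothesis rescaled. For [s = 0] it concerns
    recession directions of the tight pairs, where the pairing must be nonpositive because it is
    bounded above on tight pairs. *)
Lemma tight_dual h0 h1 M : (exists phi, tight phi) ->
  (forall phi, tight phi -> pairf phi h0 h1 <= M) ->
  exists eta, [/\ marg eta h0 h1, forall z, ~~ S z -> 0 <= eta z &
    \sum_z c z.1 z.2 * eta z <= M].
Proof.
move=> [ps [ps1 ps2]] H; apply: farkas_dual => phi s s0 le1 eq1.
move: s0; rewrite le_eqVlt => /predU1P[s0|s0]; last first.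
  have := H _ (tight_scale s0 le1 eq1).
  rewrite (_ : pairf _ _ _ = s^-1 * pairf phi h0 h1); last first.
    rewrite /pairf/= mulrDr !mulr_sumr.
    by congr (_ + _); apply: eq_bigr => *; rewrite mulrA.
  by rewrite mulrC ler_pdivrMr// mulrC.
(* If the pairing of the recession direction were positive, adding [k] times it to the tight pair
   [ps] would push the pairing beyond [M]; [k] is chosen for an excess of at least 1. *)
rewrite -s0 mul0r leNgt; apply/negP => P0.
pose k := (1 + `|M - pairf ps h0 h1|) / pairf phi h0 h1.
have k0 : 0 <= k by rewrite divr_ge0 ?ltW// ltr_pwDl.
have : pairf (fun x => ps.1 x + k * phi.1 x, fun y => ps.2 y + k * phi.2 y) h0 h1 <= M.
  apply: H; split=> x y /=.
    have := ps1 x y; have := le1 x y; rewrite -s0 mul0r => h1' h2'.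
    have := mulr_ge0_le0 k0 h1'; rewrite mulrDr; lra.
  move=> Sxy; rewrite -(ps2 _ _ Sxy).
  have := eq1 _ _ Sxy; rewrite -s0 mul0r => e; have : k * (phi.1 x + phi.2 y) = 0.
    by rewrite e mulr0.
  rewrite mulrDr; lra.
have -> : pairf (fun x => ps.1 x + k * phi.1 x, fun y => ps.2 y + k * phi.2 y) h0 h1 =
    pairf ps h0 h1 + k * pairf phi h0 h1.
  rewrite /pairf/= mulrDr !mulr_sumr.
  under eq_bigr do rewrite mulrDl -mulrA.
  under [X in _ + X = _]eq_bigr do rewrite mulrDl -mulrA.
  by rewrite !big_split/=; ring.
rewrite /k divfK ?gt_eqF//; have := ler_norm (M - pairf ps h0 h1); lra.
Qed.

End Dual.

(** A direction that is nonnegative wherever [a] vanishes can be followed for a positive time, the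
    least over finitely many coordinates. *)
Lemma small_step (T : finType) (a s : T -> R) : (forall t, 0 <= a t) ->
  (forall t, a t = 0 -> 0 <= s t) ->
  exists2 e : R, 0 < e & forall r, 0 <= r -> r <= e -> forall t, 0 <= a t + r * s t.
Proof.
move=> a0 s0.
suff [e e0 he] : exists2 e : R, 0 < e & forall r, 0 <= r -> r <= e ->
    forall t, t \in enum T -> 0 <= a t + r * s t.
  by exists e => // r r0 re t; apply: he => //; rewrite mem_enum.
elim: (enum T) => [|t l [e e0 IH]]; first by exists 1.
have [e' e'0 he'] : exists2 e : R, 0 < e & forall r, 0 <= r -> r <= e -> 0 <= a t + r * s t.
  have := a0 t; rewrite le_eqVlt => /predU1P[at0|at0].
    by exists 1 => // r r0 _; rewrite addr_ge0// mulr_ge0// s0.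
  have ns : 0 < 1 + `|s t| by rewrite ltr_pwDl.
  exists (a t / (1 + `|s t|)); first by rewrite divr_gt0.
  move=> r r0; rewrite ler_pdivlMr// => h.
  by have := ler_norm (- s t); rewrite normrN => h'; nra.
exists (Num.min e e'); first by rewrite lt_min e0.
move=> r r0; rewrite le_min => /andP[re re'] u; rewrite inE => /predU1P[->|ul].
  exact: he'.
exact: IH.
Qed.

(** Letting [s] tend to 0 in this form reads off first-order conditions without differentiating. *)
Lemma affine_ge0 (a b s0 : R) : 0 < s0 ->
  (forall s, 0 < s -> s <= s0 -> 0 <= a + s * b) -> 0 <= a.
Proof.
move=> s0p H; rewrite leNgt; apply/negP => a0.
have nb : 0 < 1 + `|b| by rewrite ltr_pwDl.
pose s := Num.min s0 (- a / (2 * (1 + `|b|))).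
have sp : 0 < s by rewrite /s lt_min s0p divr_gt0 ?oppr_gt0// mulr_gt0.
have sle : s * (2 * (1 + `|b|)) <= - a.
  by rewrite -ler_pdivlMr ?mulr_gt0// /s ge_min lexx orbT.
have := H s sp; rewrite /s ge_min lexx => /(_ isT); rewrite -/s.
have := ler_norm b; nra.
Qed.

End LinearProgramming.

Section ZeroEps.
Context (R : realType) (X0 X1 : finType).
Context (p : R) (k0 : X0 -> X0 -> R) (k1 : X1 -> X1 -> R).
Hypothesis Delta_sym : forall x y x' y',
  Delta p k0 k1 x y x' y' = Delta p k0 k1 x' y' x y.
Implicit Types (nu : fprob R X0) (rho : fprob R X1) (pi : fprob R (X0 * X1)%type).
Local Notation B := (bform (DD p k0 k1)).
Local Notation V := (EGW p k0 k1 0).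
Local Notation opt := (optimal_plans p k0 k1 0).
Local Notation cost := (plan_cost p k0 k1).
Let Dsym := DDsym Delta_sym.

Definition supp pi : pred (X0 * X1) := fun z => pi z != 0.

Lemma energy0 (a0 : X0 -> R) (a1 : X1 -> R) q : energy p k0 k1 0 a0 a1 q = B q q.
Proof. by rewrite /energy mul0r addr0. Qed.

Lemma opt0P nu rho pi : opt nu rho pi ->
  [/\ forall z, 0 <= pi z, marg pi nu rho & B pi pi = V nu rho].
Proof.
move=> /(optimalP p k0 k1 (lexx 0))[/couplingP/cpl_marg[? ?] <-].
by rewrite energy0.
Qed.

Lemma EGW0_le nu rho q : (forall z, 0 <= q z) -> marg q nu rho -> V nu rho <= B q q.
Proof.
move=> q0 mq; rewrite -(energy0 nu rho); apply: EGW_le => //.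
by apply/cpl_marg.
Qed.

(** Along [pi + r s] the form changes by [r * (2 * B pi s + r * B s s)]; the lack of convexity only
    affects the last term, which disappears as [r] tends to 0. *)
Lemma first_order0 nu rho pi s : opt nu rho pi ->
  marg s (fun=> 0) (fun=> 0) -> (forall z, ~~ supp pi z -> 0 <= s z) -> 0 <= B pi s.
Proof.
move=> /opt0P[pi0 mpi BV] ms s0.
have [e e0 he] := small_step pi0 (fun z h => s0 z ltac:(by rewrite /supp h eqxx)).
suff : 0 <= 2 * B pi s by rewrite pmulr_rge0.
apply: (@affine_ge0 _ _ (B s s) e) => // r r0 re.
have : V nu rho <= B (fun z => pi z + r * s z) (fun z => pi z + r * s z).
  apply: EGW0_le; first exact: he (ltW r0) re.
  have [m0 m1] := marg_lin r mpi ms.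
  by split=> t; rewrite (m0, m1) mulr0 addr0.
rewrite -BV bform_sqD// => h; have : 0 <= r * (2 * B pi s + r * B s s) by nra.
by rewrite pmulr_rge0.
Qed.

Lemma tight_potentials0 nu rho pi : opt nu rho pi ->
  exists phi, tight (cost pi) (supp pi) phi.
Proof.
move=> o; apply: tight_ex => s ms s0.
by rewrite (plan_cost_bform Delta_sym) mulr_ge0// (first_order0 o).
Qed.

(** The plan also solves its own linearised problem: weak duality holds for all feasible pairs and a
    tight pair attains it. The slack of a maximiser therefore integrates to 0 against [pi]. *)
Lemma OT_potentialsE nu rho pi phi : opt nu rho pi ->
  OT_potentials (cost pi) nu rho phi <-> tight (cost pi) (supp pi) phi.
Proof.
move=> o; have [pi0 mpi _] := opt0P o.
have dualE ps : OT_dual nu rho ps = \sum_z (ps.1 z.1 + ps.2 z.2) * pi z.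
  by rewrite -(pairf_marg ps mpi).
have weak ps : OT_feasible (cost pi) ps ->
    OT_dual nu rho ps <= \sum_z cost pi z.1 z.2 * pi z.
  by move=> h; rewrite dualE; apply: ler_sum => z _; rewrite ler_wpM2r.
have strong ps : tight (cost pi) (supp pi) ps ->
    OT_dual nu rho ps = \sum_z cost pi z.1 z.2 * pi z.
  move=> [_ h]; rewrite dualE; apply: eq_bigr => -[x y] _ /=.
  have [->|n0] := eqVneq (pi (x, y)) 0; first by rewrite !mulr0.
  by rewrite h.
split=> [[feas mx]|t]; last first.
  split; first by case: t.
  by move=> ps /weak; rewrite (strong _ t).
split=> // x y Sxy.
have [ps ts] := tight_potentials0 o.
have := mx ps (proj1 ts); rewrite (strong _ ts) dualE => le1.
have /psumr_eq0P : forall z : X0 * X1, true ->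
    0 <= (cost pi z.1 z.2 - (phi.1 z.1 + phi.2 z.2)) * pi z.
  by move=> z _; rewrite mulr_ge0// subr_ge0; apply: feas.
have -> : \sum_z (cost pi z.1 z.2 - (phi.1 z.1 + phi.2 z.2)) * pi z = 0.
  under eq_bigr do rewrite mulrBl.
  rewrite sumrB; apply/eqP; rewrite subr_eq0 eq_le le1/=.
  by rewrite -dualE weak.
move=> /(_ erefl (x, y) isT)/eqP; rewrite mulf_eq0 (negPf Sxy) orbF subr_eq0.
by move=> /eqP.
Qed.

(** Full support lets the marginals move a little along [h]; gluing then gives a nearby coupling
    [q']. Feasibility and slackness bound the pairing by the cost of [q' - pi], so the constant is
    uniform in the plan and the potentials: 2 from the cost and 3 from gluing make up the 6 of
    [Kq]. *)
Lemma pairf_bound_aux nu rho pi phi (h0 : X0 -> R) (h1 : X1 -> R) :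
  full_support nu -> full_support rho -> opt nu rho pi ->
  OT_potentials (cost pi) nu rho phi ->
  \sum_x h0 x = 0 -> \sum_y h1 y = 0 ->
  pairf phi h0 h1 <= Kq p k0 k1 * (l1 h0 + l1 h1).
Proof.
move=> nu0 rho0 o /(OT_potentialsE _ o)[feas tg] s0 s1.
have [pi0 mpi _] := opt0P o.
have [e e0 he] := small_step (fun x => ltW (nu0 x))
  (fun x h => False_ind (0 <= h0 x) (eq_ind (nu x) (fun u => (u == 0) = false -> False)
     ltac:(by rewrite h eqxx) (nu x) erefl (gt_eqF (nu0 x)))).
have [e' e'0 he'] := small_step (fun y => ltW (rho0 y))
  (fun y h => False_ind (0 <= h1 y) (eq_ind (rho y) (fun u => (u == 0) = false -> False)
     ltac:(by rewrite h eqxx) (rho y) erefl (gt_eqF (rho0 y)))).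
pose t := Num.min e e'.
have t0 : 0 < t by rewrite lt_min e0.
have te : t <= e by rewrite ge_min lexx.
have te' : t <= e' by rewrite ge_min lexx orbT.
have cp : cpl nu rho pi by apply/cpl_marg.
have [q' /cpl_marg[q'0 mq'] lq'] := cpl_glue cp (he _ (ltW t0) te) (he' _ (ltW t0) te')
  ltac:(by rewrite !big_split/= -!mulr_sumr s0 s1 !pmass_sum1).
have md := marg_lin (-1) mq' mpi.
have E : t * pairf phi h0 h1 = \sum_z (phi.1 z.1 + phi.2 z.2) * (q' z + -1 * pi z).
  rewrite -(pairf_marg phi md) -pairfZ; congr pairf; apply/funext => x; ring.
have : t * pairf phi h0 h1 <= \sum_z cost pi z.1 z.2 * (q' z + -1 * pi z).
  rewrite E; apply: ler_sum => -[x y] _ /=; rewrite !mulrDr; apply: lerD.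
    by rewrite ler_wpM2r.
  have [->|n0] := eqVneq (pi (x, y)) 0; first by rewrite !mulr0.
  by rewrite tg.
rewrite (plan_cost_bform Delta_sym) => h.
have hB : B pi (fun z => q' z + -1 * pi z) <= bsum (DD p k0 k1) * (3 * (t * (l1 h0 + l1 h1))).
  apply: le_trans (ler_norm _) _; apply: le_trans (bform_le _ _ _) _.
  rewrite l1_pmass mul1r ler_wpM2l ?bsum_ge0//.
  rewrite (_ : (fun z => q' z + -1 * pi z) = (fun z => q' z - pi z)); last first.
    by apply/funext => z; rewrite mulN1r.
  apply: le_trans lq' _; rewrite ler_pM2l//.
  rewrite mulrDr /l1 !mulr_sumr; apply: lerD; apply: ler_sum => x _.
    by rewrite addrAC subrr add0r normrM gtr0_norm.
  by rewrite addrAC subrr add0r normrM gtr0_norm.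
rewrite -(ler_pM2l t0); apply: le_trans h _.
by apply: le_trans (ler_wpM2l _ hB) _ => //; rewrite /Kq le_eqVlt; apply/orP; left; apply/eqP; ring.
Qed.

Lemma OT_pairf_bound nu rho pi phi (h0 : X0 -> R) (h1 : X1 -> R) :
  full_support nu -> full_support rho -> opt nu rho pi ->
  OT_potentials (cost pi) nu rho phi ->
  \sum_x h0 x = 0 -> \sum_y h1 y = 0 ->
  `|pairf phi h0 h1| <= Kq p k0 k1 * (l1 h0 + l1 h1).
Proof.
move=> f0 f1 o ph s0 s1; rewrite ler_norml (pairf_bound_aux f0 f1 o ph s0 s1) andbT.
have N0 : \sum_x -1 * h0 x = 0 by rewrite -mulr_sumr s0 mulr0.
have N1 : \sum_x -1 * h1 x = 0 by rewrite -mulr_sumr s1 mulr0.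
have := pairf_bound_aux f0 f1 o ph N0 N1; rewrite pairfZ mulN1r.
have l1N (T : finType) (f : T -> R) : l1 (fun x => -1 * f x) = l1 f.
  by apply: eq_bigr => x _; rewrite mulN1r normrN.
by rewrite !l1N lerNl.
Qed.

(** The form along [pi + t eta] is an exact quadratic in [t]: duality bounds its linear coefficient
    by [M], and the remainder is [t ^+ 2 * B eta eta]. *)
Lemma EGW0_upper nu rho pi (h0 : X0 -> R) (h1 : X1 -> R) M : opt nu rho pi ->
  (forall phi, OT_potentials (cost pi) nu rho phi -> pairf phi h0 h1 <= M) ->
  exists C t0, 0 < t0 /\ forall t (nu' : fprob R X0) (rho' : fprob R X1),
    0 < t -> t <= t0 -> (forall x, nu' x = nu x + t * h0 x) ->
    (forall y, rho' y = rho y + t * h1 y) -> V nu' rho' <= V nu rho + t * M + t ^+ 2 * C.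
Proof.
move=> o HM; have [pi0 mpi BV] := opt0P o.
have [eta [meta eta0 etaM]] := tight_dual (tight_potentials0 o)
  (fun phi ht => HM phi (proj2 (OT_potentialsE phi o) ht)).
have [e e0 he] := small_step pi0 (fun z h => eta0 z ltac:(by rewrite /supp h eqxx)).
exists (B eta eta), e; split=> // t nu' rho' t0 te nuE rhoE.
apply: le_trans (EGW0_le (he t (ltW t0) te) _) _.
  by have [m0 m1] := marg_lin t mpi meta; split=> x; rewrite (m0, m1) (nuE, rhoE).
move: etaM; rewrite (plan_cost_bform Delta_sym) bform_sqD// BV => etaM.
by rewrite lerD2r lerD2l mulrAC (mulrC _ t) ler_pM2l.
Qed.

(* The plans with support in S that are critical on S form a convex set, on which
   the quadratic form depends on the marginals only: this linear structure is
   what replaces convexity in the lower bound. *)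
Definition critical (S : pred (X0 * X1)) (q : X0 * X1 -> R) :=
  (forall z, ~~ S z -> q z = 0) /\
  forall s, marg s (fun=> 0) (fun=> 0) -> (forall z, ~~ S z -> 0 <= s z) -> 0 <= B q s.

Lemma critical_conv S q q' (t : R) : 0 <= t <= 1 -> critical S q -> critical S q' ->
  critical S (fun z => q z + t * (q' z - q z)).
Proof.
move=> /andP[t0 t1] [q0 qs] [q'0 q's]; split=> [z Sz|s ms s0].
  by rewrite q0// q'0// subrr mulr0 addr0.
have -> : (fun z => q z + t * (q' z - q z)) =
    (fun z => (q z + t * q' z) + (- t) * q z) by apply/funext => z; ring.
have := qs _ ms s0; have := q's _ ms s0; rewrite !bformDl; nra.
Qed.

(** Both [q - q'] and [q' - q] are admissible test directions, so [B q q = B q q' = B q' q']. *)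
Lemma critical_value S q q' h0 h1 : critical S q -> critical S q' ->
  marg q h0 h1 -> marg q' h0 h1 -> B q q = B q' q'.
Proof.
move=> [q0 qs] [q'0 q's] mq mq'.
have zm (a b : X0 * X1 -> R) : marg a h0 h1 -> marg b h0 h1 ->
    marg (fun z => a z + -1 * b z) (fun=> 0) (fun=> 0).
  move=> ma mb; have [m0 m1] := marg_lin (-1) ma mb.
  by split=> x; rewrite (m0, m1) mulN1r subrr.
have S0 (a b : X0 * X1 -> R) : (forall z, ~~ S z -> a z = 0) ->
   (forall z, ~~ S z -> b z = 0) -> forall z, ~~ S z -> 0 <= a z + -1 * b z.
  by move=> a0 b0 z Sz; rewrite a0// b0// mulr0 addr0.
have := qs _ (zm _ _ mq mq') (S0 _ _ q0 q'0).
have := qs _ (zm _ _ mq' mq) (S0 _ _ q'0 q0).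
have := q's _ (zm _ _ mq mq') (S0 _ _ q0 q'0).
have := q's _ (zm _ _ mq' mq) (S0 _ _ q'0 q0).
rewrite !(bformDr Dsym) (bformC Dsym q' q); lra.
Qed.

Lemma EGW0_lower nu rho (h0 : X0 -> R) (h1 : X1 -> R) (F : set_system nat)
  (t : nat -> R) (nu' : nat -> fprob R X0) (rho' : nat -> fprob R X1) :
  UltraFilter F -> (forall k, 0 < t k) -> t @ F --> (0 : R) ->
  (forall k x, nu' k x = nu x + t k * h0 x) ->
  (forall k y, rho' k y = rho y + t k * h1 y) ->
  exists2 pi, opt nu rho pi & exists C, \forall k \near F,
    forall phi, OT_potentials (cost pi) nu rho phi ->
      V nu rho + t k * pairf phi h0 h1 + t k ^+ 2 * C <= V (nu' k) (rho' k).
Proof.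
move=> UF t0 tc nuE rhoE; have PF := @ultra_proper _ _ UF.
have [pk pkP] := choice (fun k => optimal_ex p k0 k1 (lexx 0) (nu' k) (rho' k)).
have [pi pic] := fprob_ultra UF pk.
have nuc x : (fun k => nu' k x) @ F --> nu x.
  under eq_fun do rewrite nuE.
  suff : (fun k => nu x + t k * h0 x) @ F --> nu x + 0 * h0 x by rewrite mul0r addr0.
  apply: cvgD; first exact: cvg_cst.
  by apply: cvgM => //; exact: cvg_cst.
have rhoc y : (fun k => rho' k y) @ F --> rho y.
  under eq_fun do rewrite rhoE.
  suff : (fun k => rho y + t k * h1 y) @ F --> rho y + 0 * h1 y by rewrite mul0r addr0.
  apply: cvgD; first exact: cvg_cst.
  by apply: cvgM => //; exact: cvg_cst.
have o : opt nu rho pi by apply: (optimal_cvg Delta_sym (lexx 0) PF nuc rhoc pic pkP).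
exists pi => //; have [pi0 mpi BV] := opt0P o.
have [S FS] := ultra_finite UF (fun k => [set z | supp (pk k) z]%SET).
pose Sp : pred (X0 * X1) := fun z => z \in S.
have SpE k : [set z | supp (pk k) z]%SET = S -> forall z, Sp z = supp (pk k) z.
  by move=> h z; rewrite /Sp -h inE.
have crk k : [set z | supp (pk k) z]%SET = S -> critical Sp (pk k).
  move=> /SpE h; split=> [z|s ms s0]; first by rewrite h /supp negbK => /eqP.
  by apply: first_order0 (pkP k) ms _ => z; rewrite -h; exact: s0.
(* The support of the limit may be smaller than [S], but vanishing off [S] and the sign conditions
   are closed under limits. *)
have crpi : critical Sp pi.
  split=> [z Sz|s ms s0].
    apply/eqP; rewrite eq_le pi0 andbT; apply: (cvgr_to_le (pic z)).
    by apply: filterS FS => k /= /crk[h _]; rewrite h.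
  have c : (fun k => B (pk k) s) @ F --> B pi s.
    apply: cvg_sumr => z; apply: cvg_sumr => z'; apply: cvgM; first exact: cvg_cst.
    by apply: cvgM => //; exact: cvg_cst.
  apply: (cvgr_to_ge c); apply: filterS FS => k /= /crk[_]; exact.
(* Any single index with support [S] supplies the far end of the segment; [eta] is its slope from
   [pi] and has marginals exactly [h0] and [h1]. *)
have [k1' /= Sk1] := filter_ex FS.
set t1 := t k1'; have t10 : 0 < t1 := t0 k1'.
have [p10 mp1 _] := opt0P (pkP k1').
pose eta z := (pk k1' z - pi z) / t1.
have meta : marg eta h0 h1.
  have [m0 m1] := mp1; have [n0 n1] := mpi; split=> x.
    by rewrite -mulr_suml sumrB m0 n0 nuE addrAC subrr add0r mulrC mulKf// gt_eqF.
  by rewrite -mulr_suml sumrB m1 n1 rhoE addrAC subrr add0r mulrC mulKf// gt_eqF.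
exists (B eta eta).
have tle : \forall k \near F, t k <= t1 by move/cvgr_le: tc; apply.
apply: filterS (filterI FS tle) => k [/= Sk tk] phi /(OT_potentialsE _ o)[feas tg].
have [pk0 mpk <-] := opt0P (pkP k).
have qE : (fun z => pi z + t k * eta z) = (fun z => pi z + (t k / t1) * (pk k1' z - pi z)).
  by apply/funext => z; rewrite /eta; ring.
(* For [t k <= t1] this is a point of the segment, critical on [S] with the marginals of [pk k]; by
   [critical_value] it has the same energy. *)
have crq : critical Sp (fun z => pi z + t k * eta z).
  rewrite qE; apply: critical_conv => //; last exact: crk.
  by rewrite (divr_ge0 (ltW (t0 k)) (ltW t10))/= ler_pdivrMr// mul1r.
have mq : marg (fun z => pi z + t k * eta z) (nu' k) (rho' k).
  by have [m0 m1] := marg_lin (t k) mpi meta; split=> x; rewrite (m0, m1) (nuE, rhoE).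
rewrite (critical_value (crk _ Sk) crq mpk mq) bform_sqD// BV lerD2r lerD2l.
rewrite mulrAC (mulrC _ (t k)) ler_pM2l// -(plan_cost_bform Delta_sym).
(* Weak duality term by term: on the support of [pi] the slack of [phi] is 0, off it the slack and
   [eta] are both nonnegative. *)
rewrite (pairf_marg phi meta) -subr_ge0 -sumrB; apply: sumr_ge0 => -[x y] _ /=.
rewrite -mulrBl /eta mulrA divr_ge0 ?(ltW t10)// mulrBr subr_ge0.
have [->|n0] := eqVneq (pi (x, y)) 0.
  by rewrite mulr0 mulr_ge0// subr_ge0 feas.
by rewrite tg// subrr !mul0r.
Qed.

End ZeroEps.

(** * The entropic problem *)

Section PositiveEps.
Context (R : realType) (X0 X1 : finType).
Context (p : R) (k0 : X0 -> X0 -> R) (k1 : X1 -> X1 -> R).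
Hypothesis Delta_sym : forall x y x' y',
  Delta p k0 k1 x y x' y' = Delta p k0 k1 x' y' x y.
Context (eps : R) (eps0 : 0 < eps).
Implicit Types (pi : fprob R (X0 * X1)%type) (q s eta : X0 * X1 -> R).
Local Notation B := (bform (DD p k0 k1)).
Local Notation V := (EGW p k0 k1 eps).
Local Notation opt := (optimal_plans p k0 k1 eps).
Local Notation cost := (plan_cost p k0 k1).
Local Notation J := (energy p k0 k1 eps).
Let Dsym := DDsym Delta_sym.
Let eps_ge0 : 0 <= eps := ltW eps0.

Lemma optP nu rho pi : opt nu rho pi ->
  [/\ forall z, 0 <= pi z, marg pi nu rho & J nu rho pi = V nu rho].
Proof. by move=> /(optimalP p k0 k1 eps_ge0)[/couplingP/cpl_marg[? ?] <-]. Qed.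

Lemma EGW_le_marg (nu : fprob R X0) (rho : fprob R X1) q :
  (forall z, 0 <= q z) -> marg q nu rho -> V nu rho <= J nu rho q.
Proof. by move=> q0 mq; apply: EGW_le => //; apply/cpl_marg. Qed.

Lemma fin_lower (T : finType) (f : T -> R) : (forall t, 0 < f t) ->
  exists2 d : R, 0 < d & forall t, d <= f t.
Proof.
move=> f0; have [|e e0 he] := small_step (s := fun=> -1) (fun t => ltW (f0 t)).
  by move=> t ft; have := f0 t; rewrite ft ltxx.
by exists e => // t; have := he e (ltW e0) (lexx _) t; rewrite mulrN1 subr_ge0.
Qed.

Section Full.
Context (nu : fprob R X0) (rho : fprob R X1).
Context (nu_full : full_support nu) (rho_full : full_support rho).

(* Perturbing an optimal plan towards the product plan decreases the entropy term
   at an infinite rate wherever the plan vanishes. *)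
Lemma optimal_lower_at z0 : exists2 d : R, 0 < d &
  forall pi, opt nu rho pi -> d <= pi z0.
Proof.
have [m m0 mm] : exists2 m : fprob R (X0 * X1)%type, forall z, 0 < m z & marg m nu rho.
  exists (fprob_prod nu rho); first by move=> z /=; rewrite mulr_gt0.
  by case: (coupling_prod nu rho).
pose b := bsum (DD p k0 k1).
pose W := \sum_z (1 - ln (m z)).
(* Solved from [0 <= 8 * b + eps * (W + 1 + m z0 / 2 * ln q)], with [q] the perturbed mass at [z0]
   and [8 * b] collecting [2 * (2 * b)] and [4 * b] from the two terms of the form. *)
pose Q := (8 * b / eps + W + 1) * 2 / m z0.
exists (Num.min (m z0 / 2) (expR (- Q))).
  by rewrite lt_min expR_gt0 divr_gt0.
move=> pi /optP[pi0 mpi JV].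
(* One may assume that the mass at [z0] is at most half of that of [m], so the direction gains at
   least [m z0 / 2] there. *)
rewrite ge_min; have [//|/ltW pm] := leP (m z0 / 2) (pi z0); rewrite orFb.
(* The bound is proved for the perturbed mass, which is positive, and then [s] tends to 0. *)
rewrite -subr_ge0; apply: (@affine_ge0 R _ (m z0 - pi z0) 1 ltr01) => s s0 s1.
pose sg z := m z - pi z.
have qp z : 0 < pi z + s * sg z.
  by have := pi0 z; have := m0 z; rewrite /sg => ? ?; nra.
have q1 z : pi z + s * sg z <= 1.
  have := pmass_le1 pi z; have := pmass_le1 m z; rewrite /sg => ? ?; nra.
have lnq z : ln (pi z + s * sg z) <= 0 by rewrite ln_le0.
have mq : marg (fun z => pi z + s * sg z) nu rho.
  have [a0 a1] := marg_lin s mpi (marg_lin (-1) mm mpi).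
  rewrite (_ : (fun z => pi z + s * sg z) = fun z => pi z + s * (m z + -1 * pi z)); last first.
    by apply/funext => z; rewrite mulN1r.
  by split=> x; rewrite (a0, a1) mulN1r subrr mulr0 addr0.
have JB : 0 <= (2 * s * B pi sg + s ^+ 2 * B sg sg) +
    eps * (ent (fun z => pi z + s * sg z) - ent pi).
  have := EGW_le_marg (fun z => ltW (qp z)) mq; rewrite -JV /J bform_sqD//.
  by rewrite -subr_ge0; lra.
have l1sg : l1 sg <= 2.
  have -> : 2 = l1 m + l1 pi :> R by rewrite !l1_pmass.
  by rewrite /l1 -big_split; apply: ler_sum => z _; exact: ler_normB.
have b0 : 0 <= b by exact: bsum_ge0.
have B1 : B pi sg <= 2 * b.
  apply: le_trans (ler_norm _) _; apply: le_trans (bform_le _ _ _) _.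
  by rewrite l1_pmass mul1r mulrC ler_wpM2r.
have B2 : B sg sg <= 4 * b.
  apply: le_trans (ler_norm _) _; apply: le_trans (bform_le _ _ _) _.
  rewrite mulrC ler_wpM2r//; have := l1_ge0 sg; nra.
have entb : ent (fun z => pi z + s * sg z) - ent pi <=
    s * (W + 1 + m z0 / 2 * ln (pi z0 + s * sg z0)).
  (* The tangent is taken at the perturbed point, because [pi z] may be 0. *)
  have tb z : xlnx (pi z + s * sg z) - xlnx (pi z) <= s * (sg z * (ln (pi z + s * sg z) + 1)).
    by have := xlnx_tangent (pi0 z) (qp z); lra.
  have sg1 z : sg z <= 1 by have := pmass_le1 m z; have := pi0 z; rewrite /sg; lra.
  have lnm z : ln (m z) <= 0 by rewrite ln_le0// pmass_le1.
  (* Where mass is gained the logarithm is nonpositive; where it is lost the perturbed mass stays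
     above [m z]. *)
  have t1 z : sg z * (ln (pi z + s * sg z) + 1) <= 1 - ln (m z).
    have [sz|sz] := leP 0 (sg z).
      have := mulr_ge0_le0 sz (lnq z); have := lnm z; have := sg1 z; lra.
    have sz1 : -1 <= sg z by have := pmass_le1 pi z; have := m0 z; rewrite /sg; lra.
    have : ln (m z) <= ln (pi z + s * sg z).
      by rewrite ler_ln ?posrE//; move: sz; rewrite /sg => sz; nra.
    have := lnm z; have := lnq z => ? ? ?; nra.
  have t0 : sg z0 * (ln (pi z0 + s * sg z0) + 1) <= 1 + m z0 / 2 * ln (pi z0 + s * sg z0).
    have h : m z0 / 2 <= sg z0 by rewrite /sg; lra.
    by have := sg1 z0; have := lnq z0 => ? ?; nra.
  rewrite /ent -sumrB.
  apply: (@le_trans _ _ (\sum_z s * (sg z * (ln (pi z + s * sg z) + 1)))).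
    exact: ler_sum.
  rewrite -mulr_sumr ler_pM2l// /W (bigD1 z0)//= [X in _ <= X + 1 + _](bigD1 z0)//=.
  have h : \sum_(i | i != z0) sg i * (ln (pi i + s * sg i) + 1) <=
         \sum_(i | i != z0) (1 - ln (m i)) by apply: ler_sum.
  apply: le_trans (lerD t0 h) _; have := lnm z0; lra.
have L : - Q <= ln (pi z0 + s * sg z0).
  have h1 : 0 <= 8 * b + eps * (W + 1 + m z0 / 2 * ln (pi z0 + s * sg z0)).
    rewrite -(pmulr_rge0 _ s0).
    have a1 := ler_wpM2l (ltW s0) B1.
    have a2 : s ^+ 2 * B sg sg <= s * (4 * b).
      apply: le_trans (ler_wpM2l (sqr_ge0 s) B2) _.
      by rewrite expr2 -mulrA ler_piMl// !mulr_ge0// ltW.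
    by have := ler_wpM2l eps_ge0 entb; lra.
  have h2 : 0 <= 8 * b / eps + (W + 1 + m z0 / 2 * ln (pi z0 + s * sg z0)).
    rewrite -(pmulr_rge0 _ eps0) mulrDr (_ : eps * (8 * b / eps) = 8 * b)//.
    by rewrite mulrC divfK// gt_eqF.
  rewrite /Q -mulNr -mulNr ler_pdivrMr//; lra.
rewrite -ler_expR lnK ?posrE// in L.
by rewrite addrAC subr_ge0.
Qed.

(** Uniformity over the optimal plans is what makes their log-densities, hence the pairings in
    [EOT_pairf_bound], uniformly bounded. *)
Lemma optimal_lower : exists2 d : R, 0 < d &
  forall pi, opt nu rho pi -> forall z, d <= pi z.
Proof.
have /choice[f fP] : forall z, exists d : R, 0 < d /\ forall pi, opt nu rho pi -> d <= pi z.
  by move=> z; have [d d0 dP] := optimal_lower_at z; exists d.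
have [d d0 dP] := fin_lower (fun z => (fP z).1).
by exists d => // pi o z; apply: le_trans (dP z) _; apply: (fP z).2.
Qed.

Lemma optimal_gt0 pi : opt nu rho pi -> forall z, 0 < pi z.
Proof.
by have [d d0 dP] := optimal_lower => o z; apply: lt_le_trans (dP pi o z).
Qed.

(** First variation of the energy at [pi] in directions of zero total mass, the change of the
    marginals included: linearised cost plus [eps] times the log-density against the product. *)
Definition grad pi (z : X0 * X1) : R :=
  cost pi z.1 z.2 + eps * (ln (pi z) - ln (nu z.1) - ln (rho z.2)).

(** The left side is the limit found in [energy_quotient]. The constants 1 cancel since all
    directions have zero mass, and the marginal logarithms become integrals against [eta]. *)
Lemma grad_marg pi eta h0 h1 : marg eta h0 h1 ->
  \sum_x h0 x = 0 -> \sum_y h1 y = 0 ->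
  2 * B pi eta + eps * (\sum_z eta z * (ln (pi z) + 1) -
    \sum_x h0 x * (ln (nu x) + 1) - \sum_y h1 y * (ln (rho y) + 1)) =
  \sum_z grad pi z * eta z.
Proof.
move=> [m0 m1] s0 s1.
have e0 : \sum_z eta z = 0.
  by rewrite sum_pair; apply: etrans s0; apply: eq_bigr => x _; exact: m0.
have l1p (T : finType) (f g : T -> R) : \sum_t f t = 0 ->
    \sum_t f t * (ln (g t) + 1) = \sum_t f t * ln (g t).
  by move=> f0; under eq_bigr do rewrite mulrDr mulr1; rewrite big_split/= f0 addr0.
rewrite !l1p//.
have -> : \sum_x h0 x * ln (nu x) = \sum_z eta z * ln (nu z.1).
  by rewrite sum_pair; apply: eq_bigr => x _ /=; rewrite -mulr_suml m0.
have -> : \sum_y h1 y * ln (rho y) = \sum_z eta z * ln (rho z.2).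
  by rewrite sum_pair_swap; apply: eq_bigr => y _ /=; rewrite -mulr_suml m1.
rewrite -(plan_cost_bform Delta_sym) -!sumrB mulr_sumr -big_split/=.
by apply: eq_bigr => z _; rewrite /grad; ring.
Qed.

(** The base plan varies with [k] because the lower bound steps from plans that only converge to
    [pi]; the upper bound uses a fixed base. *)
Lemma energy_quotient (F : set_system nat) (FF : ProperFilter F) (t : nat -> R) pi
    (q eta : nat -> X0 * X1 -> R) (a0 g0 : nat -> X0 -> R) (a1 g1 : nat -> X1 -> R)
    (e : X0 * X1 -> R) (h0 : X0 -> R) (h1 : X1 -> R) :
  (forall z, 0 < pi z) -> (forall k, 0 < t k) -> t @ F --> (0 : R) ->
  (forall z, (fun k => q k z) @ F --> pi z) ->
  (forall z, (fun k => eta k z) @ F --> e z) ->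
  (forall x, (fun k => a0 k x) @ F --> nu x) ->
  (forall x, (fun k => g0 k x) @ F --> h0 x) ->
  (forall x, (fun k => a1 k x) @ F --> rho x) ->
  (forall x, (fun k => g1 k x) @ F --> h1 x) ->
  (fun k => (J (fun x => a0 k x + t k * g0 k x) (fun x => a1 k x + t k * g1 k x)
               (fun z => q k z + t k * eta k z) - J (a0 k) (a1 k) (q k)) / t k) @ F -->
  2 * B pi e + eps * (\sum_z e z * (ln (pi z) + 1) -
    \sum_x h0 x * (ln (nu x) + 1) - \sum_y h1 y * (ln (rho y) + 1)).
Proof.
move=> pi0 t0 tc qc ec a0c g0c a1c g1c.
have bc (u v : nat -> X0 * X1 -> R) (u' v' : X0 * X1 -> R) :
   (forall z, (fun k => u k z) @ F --> u' z) -> (forall z, (fun k => v k z) @ F --> v' z) ->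
   (fun k => B (u k) (v k)) @ F --> B u' v'.
  move=> uc vc; apply: cvg_sumr => z; apply: cvg_sumr => z'.
  by apply: cvgM; [exact: cvg_cst|apply: cvgM].
have ec' (T : finType) (u v : nat -> T -> R) (u' v' : T -> R) : (forall x, 0 < u' x) ->
   (forall z, (fun k => u k z) @ F --> u' z) -> (forall z, (fun k => v k z) @ F --> v' z) ->
   (fun k => (ent (fun z => u k z + t k * v k z) - ent (u k)) / t k) @ F -->
     \sum_z v' z * (ln (u' z) + 1).
  move=> u0 uc vc; under eq_fun do rewrite /ent -sumrB mulr_suml.
  by apply: cvg_sumr => z; apply: xlnx_quotient.
have E k : (J (fun x => a0 k x + t k * g0 k x) (fun x => a1 k x + t k * g1 k x)
               (fun z => q k z + t k * eta k z) - J (a0 k) (a1 k) (q k)) / t k =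
  (2 * B (q k) (eta k) + t k * B (eta k) (eta k)) + eps *
   ((ent (fun z => q k z + t k * eta k z) - ent (q k)) / t k -
    (ent (fun z => a0 k z + t k * g0 k z) - ent (a0 k)) / t k -
    (ent (fun z => a1 k z + t k * g1 k z) - ent (a1 k)) / t k).
  rewrite /energy bform_sqD//; have := t0 k; move: (t k) => s s0.
  by field; rewrite gt_eqF.
under eq_fun do rewrite E.
apply: cvgD.
  rewrite -[X in _ --> X]addr0 -(mul0r (B e e)); apply: cvgD.
    by apply: cvgM; [exact: cvg_cst|exact: bc].
  by apply: cvgM => //; exact: bc.
apply: cvgM; first exact: cvg_cst.
by apply: cvgB; [apply: cvgB|]; apply: ec'.
Qed.

Lemma first_order pi s : opt nu rho pi -> marg s (fun=> 0) (fun=> 0) ->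
  0 <= \sum_z grad pi z * s z.
Proof.
move=> o ms; have [pi0 mpi JV] := optP o; have pip := optimal_gt0 o.
have [e e0 he] := small_step pi0 (fun z h => False_ind (0 <= s z)
  (eq_ind (pi z) (fun u => (u == 0) = false -> False)
     ltac:(by rewrite h eqxx) _ erefl (gt_eqF (pip z)))).
have z0 (T : finType) : \sum_(i : T) (0 : R) = 0 by rewrite big1.
rewrite -(grad_marg pi ms (z0 _) (z0 _)).
pose t (k : nat) : R := k.+1%:R^-1.
have t0 k : 0 < t k by rewrite invr_gt0.
have tc : t @ \oo --> (0 : R) by exact: cvg_harmonic.
have c (T : Type) (f : T -> R) z : (fun=> f z) @ \oo --> f z by exact: cvg_cst.
have := energy_quotient eventually_filter pip t0 tc (c _ pi) (c _ s) (c _ nu) (c _ (fun=> 0))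
  (c _ rho) (c _ (fun=> 0)).
move=> /cvgr_to_ge; apply.
have te : \forall k \near \oo, t k <= e by move/cvgr_le: tc; apply.
apply: filterS te => k tk; rewrite divr_ge0 ?(ltW (t0 k))// subr_ge0 JV.
have E (T : Type) (f : T -> R) : (fun x => f x + t k * 0) = f.
  by apply/funext => x; rewrite mulr0 addr0.
rewrite !E; apply: EGW_le_marg; first exact: he (ltW (t0 k)) tk.
by have [m0 m1] := marg_lin (t k) mpi ms; split=> x; rewrite (m0, m1) mulr0 addr0.
Qed.

Lemma first_order_eq pi s : opt nu rho pi -> marg s (fun=> 0) (fun=> 0) ->
  \sum_z grad pi z * s z = 0.
Proof.
move=> o ms; apply/eqP; rewrite eq_le (first_order o ms) andbT.
have mN : marg (fun z => - s z) (fun=> 0) (fun=> 0).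
  by have [m0 m1] := ms; split=> x; rewrite sumrN (m0, m1) oppr0.
have := first_order o mN; under eq_bigr do rewrite mulrN.
by rewrite sumrN oppr_ge0.
Qed.

Lemma sum_pair_eqr (x x' : X0) (y0 : X1) : \sum_y (((x', y) == (x, y0))%:R : R) = (x' == x)%:R.
Proof.
rewrite -[RHS](sum_eqZ y0 (fun=> (x' == x)%:R)); apply: eq_bigr => y _.
by rewrite xpair_eqE -natrM mulnb andbC.
Qed.

Lemma sum_pair_eql (y y' : X1) (x0 : X0) : \sum_x (((x, y') == (x0, y))%:R : R) = (y' == y)%:R.
Proof.
rewrite -[RHS](sum_eqZ x0 (fun=> (y' == y)%:R)); apply: eq_bigr => x _.
by rewrite xpair_eqE -natrM mulnb.
Qed.

(** The gradient vanishes on null-marginal directions, in particular on the alternating sum over the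
    four corners of a rectangle; this makes it a sum of a function of [x] and a function of [y]. *)
Lemma grad_split pi : opt nu rho pi ->
  exists phi : (X0 -> R) * (X1 -> R), forall z, phi.1 z.1 + phi.2 z.2 = grad pi z.
Proof.
move=> o.
have [[xs ys] _] := fprob_inhabited pi.
exists (fun x => grad pi (x, ys), fun y => grad pi (xs, y) - grad pi (xs, ys)).
move=> [x y] /=.
pose d (z0 z : X0 * X1) : R := (z == z0)%:R.
have dE z0 : \sum_z grad pi z * d z0 z = grad pi z0.
  by rewrite -(sum_eqZ z0 (grad pi)); apply: eq_bigr => z _; rewrite mulrC.
pose s z := d (x, y) z - d (x, ys) z - d (xs, y) z + d (xs, ys) z.
have ms : marg s (fun=> 0) (fun=> 0).
  split=> u; rewrite /s big_split/= !sumrB /d.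
    by rewrite !sum_pair_eqr; ring.
  by rewrite !sum_pair_eql; ring.
have := first_order_eq o ms.
rewrite (_ : \sum_z _ = \sum_z (grad pi z * d (x, y) z - grad pi z * d (x, ys) z -
   grad pi z * d (xs, y) z + grad pi z * d (xs, ys) z)); last first.
  by apply: eq_bigr => z _; rewrite /s; ring.
rewrite big_split/= !sumrB !dE; lra.
Qed.

(** By definition of [grad], the plan is the product measure times the exponential of
    [(grad - cost) / eps]. The dual gap becomes an integral of [exp u - 1 - u], which yields
    optimality by its sign and uniqueness by its strict positivity away from 0. *)
Lemma EOT_dualB pi phi psi : opt nu rho pi ->
  (forall z, phi.1 z.1 + phi.2 z.2 = grad pi z) ->
  EOT_dual (cost pi) nu rho eps phi - EOT_dual (cost pi) nu rho eps psi =
  \sum_z eps * pi z * (expR ((psi.1 z.1 + psi.2 z.2 - grad pi z) / eps) -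
                       (1 + (psi.1 z.1 + psi.2 z.2 - grad pi z) / eps)).
Proof.
move=> o hphi; have [_ mpi _] := optP o; have pip := optimal_gt0 o.
have dE ps : EOT_dual (cost pi) nu rho eps ps = pairf ps nu rho
   - eps * (\sum_z expR ((ps.1 z.1 + ps.2 z.2 - cost pi z.1 z.2) / eps) *
       (nu z.1 * rho z.2)) + eps by [].
have ex ps z : expR ((ps.1 z.1 + ps.2 z.2 - cost pi z.1 z.2) / eps) *
       (nu z.1 * rho z.2) =
     pi z * expR ((ps.1 z.1 + ps.2 z.2 - grad pi z) / eps).
  have -> : (ps.1 z.1 + ps.2 z.2 - cost pi z.1 z.2) / eps =
     (ps.1 z.1 + ps.2 z.2 - grad pi z) / eps + (ln (pi z) - ln (nu z.1) - ln (rho z.2)).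
    by rewrite /grad; field; rewrite gt_eqF.
  have n0 := nu_full z.1; have r0 := rho_full z.2.
  rewrite expRD !expRB !lnK ?posrE//.
  by field; rewrite !gt_eqF.
rewrite !dE !(pairf_marg _ mpi).
under [X in _ - eps * X + _ - _]eq_bigr do rewrite ex hphi subrr mul0r expR0 mulr1.
under [X in _ - (_ - eps * X + _)]eq_bigr do rewrite ex.
rewrite !mulr_sumr.
transitivity (\sum_z ((phi.1 z.1 + phi.2 z.2) * pi z - eps * pi z -
   (psi.1 z.1 + psi.2 z.2) * pi z + eps * (pi z *
     expR ((psi.1 z.1 + psi.2 z.2 - grad pi z) / eps)))).
  by rewrite big_split/= !sumrB; ring.
apply: eq_bigr => z _; rewrite hphi.
by field; rewrite gt_eqF.
Qed.

Lemma EOT_potentials_of_grad pi phi : opt nu rho pi ->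
  (forall z, phi.1 z.1 + phi.2 z.2 = grad pi z) ->
  EOT_potentials (cost pi) nu rho eps phi.
Proof.
move=> o hphi psi; rewrite -subr_ge0 (EOT_dualB _ o hphi); apply: sumr_ge0 => z _.
by rewrite mulr_ge0 ?mulr_ge0 ?pmass_ge0// subr_ge0 expR_ge1Dx.
Qed.

Lemma EOT_potentialsE pi psi : opt nu rho pi ->
  EOT_potentials (cost pi) nu rho eps psi ->
  forall z, psi.1 z.1 + psi.2 z.2 = grad pi z.
Proof.
move=> o mx z; have [phi hphi] := grad_split o; have pip := optimal_gt0 o.
pose T z := eps * pi z * (expR ((psi.1 z.1 + psi.2 z.2 - grad pi z) / eps) -
                       (1 + (psi.1 z.1 + psi.2 z.2 - grad pi z) / eps)).
have T0 u : 0 <= T u.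
  by rewrite /T mulr_ge0 ?mulr_ge0 ?pmass_ge0// subr_ge0 expR_ge1Dx.
have sT : \sum_u T u = 0.
  apply/eqP; rewrite eq_le sumr_ge0 ?andbT//.
  by rewrite -(EOT_dualB psi o hphi) subr_le0; apply: mx.
have /psumr_eq0P : forall u, true -> 0 <= T u by [].
move=> /(_ sT z isT)/eqP; rewrite /T mulf_eq0 mulf_eq0 (gt_eqF eps0) (gt_eqF (pip z))/= subr_eq0.
have [e0|e0] := eqVneq ((psi.1 z.1 + psi.2 z.2 - grad pi z) / eps) 0.
  move=> _; move/eqP: e0; rewrite mulf_eq0 invr_eq0 (gt_eqF eps0) orbF subr_eq0.
  by move=> /eqP.
by rewrite (gt_eqF (expR_gt1Dx e0)).
Qed.

Lemma EOT_potentials_unique pi : opt nu rho pi ->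
  exists2 phi, EOT_potentials (cost pi) nu rho eps phi &
    forall psi, EOT_potentials (cost pi) nu rho eps psi ->
      exists a : R, psi = (fun x => phi.1 x + a, fun y => phi.2 y - a).
Proof.
move=> o; have [phi hphi] := grad_split o.
exists phi; first exact: EOT_potentials_of_grad.
move=> psi /(EOT_potentialsE o) hpsi.
have [[xs ys] _] := fprob_inhabited pi.
exists (phi.2 ys - psi.2 ys).
rewrite [LHS]surjective_pairing; congr pair; apply/funext => u.
  by have := hphi (u, ys); have := hpsi (u, ys) => /= <-; lra.
have := hphi (xs, u); have := hpsi (xs, u) => /= <-.
have := hphi (xs, ys); have := hpsi (xs, ys) => /= <-; lra.
Qed.

Lemma pairf_grad pi phi eta h0 h1 : opt nu rho pi ->
  EOT_potentials (cost pi) nu rho eps phi -> marg eta h0 h1 ->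
  pairf phi h0 h1 = \sum_z grad pi z * eta z.
Proof.
move=> o /(EOT_potentialsE o) h me; rewrite (pairf_marg phi me).
by apply: eq_bigr => z _; rewrite h.
Qed.

(** A direction with prescribed zero-sum marginals that depends linearly, hence continuously, on
    them; positivity of the plan makes it feasible for small steps. *)
Definition lift (h0 : X0 -> R) (h1 : X1 -> R) (z : X0 * X1) : R :=
  h0 z.1 * rho z.2 + nu z.1 * h1 z.2.

Lemma marg_lift h0 h1 : \sum_x h0 x = 0 -> \sum_y h1 y = 0 ->
  marg (lift h0 h1) h0 h1.
Proof.
move=> s0 s1; split=> [x|y]; rewrite /lift big_split/=.
  by rewrite -!mulr_sumr pmass_sum1 s1 mulr0 mulr1 addr0.
by rewrite -!mulr_suml pmass_sum1 s0 mul0r mul1r add0r.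
Qed.

Lemma l1_lift h0 h1 : l1 (lift h0 h1) <= l1 h0 + l1 h1.
Proof.
apply: (@le_trans _ _ (\sum_z (`|h0 z.1| * rho z.2 + nu z.1 * `|h1 z.2|))).
  apply: ler_sum => z _; apply: le_trans (ler_normD _ _) _.
  by rewrite !normrM (ger0_norm (pmass_ge0 nu _)) (ger0_norm (pmass_ge0 rho _)).
rewrite big_split/= sum_pair (sum_pair_swap (fun z => nu z.1 * `|h1 z.2|)) /=.
rewrite le_eqVlt; apply/orP; left; apply/eqP; congr (_ + _); apply: eq_bigr => x _.
  by rewrite -mulr_sumr pmass_sum1 mulr1.
by rewrite -mulr_suml pmass_sum1 mul1r.
Qed.

(** The pairing is the integral of [grad] against [lift h0 h1], and [K] is a bound of [grad]
    obtained from the uniform lower bound [d] on the plans. *)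
Lemma EOT_pairf_bound : exists K : R, forall pi phi h0 h1, opt nu rho pi ->
  EOT_potentials (cost pi) nu rho eps phi ->
  \sum_x h0 x = 0 -> \sum_y h1 y = 0 -> `|pairf phi h0 h1| <= K * (l1 h0 + l1 h1).
Proof.
have [d d0 dP] := optimal_lower.
pose K := 2 * bsum (DD p k0 k1) +
  eps * (- ln d + l1 (fun x => ln (nu x)) + l1 (fun y => ln (rho y))).
exists K => pi phi h0 h1 o ph s0 s1.
rewrite (pairf_grad o ph (marg_lift s0 s1)).
have gK z : `|grad pi z| <= K.
  apply: le_trans (ler_normD _ _) _; apply: lerD.
    rewrite /plan_cost normrM ger0_norm// ler_pM2l// /integ.
    apply: le_trans (ler_norm_sum _ _ _) _.
    rewrite -[leRHS]mulr1 -(pmass_sum1 pi) mulr_sumr; apply: ler_sum => z' _.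
    rewrite normrM (ger0_norm (pmass_ge0 pi _)) ler_wpM2r ?pmass_ge0//.
    exact: (D_le_bsum (DD p k0 k1) z z').
  rewrite normrM (gtr0_norm eps0) ler_pM2l//.
  apply: le_trans (ler_normB _ _) _; apply: lerD; last exact: (le_l1 (fun y => ln (rho y))).
  apply: le_trans (ler_normB _ _) _; apply: lerD; last exact: (le_l1 (fun y => ln (nu y))).
  rewrite ler0_norm ?ln_le0 ?pmass_le1// lerN2 ler_ln ?posrE//; first exact: dP.
  exact: optimal_gt0.
have K0 : 0 <= K.
  rewrite addr_ge0 ?mulr_ge0 ?bsum_ge0 ?eps_ge0// !addr_ge0 ?l1_ge0//.
  have [z _] := fprob_inhabited pi.
  by rewrite oppr_ge0 ln_le0// (le_trans (dP pi o z))// pmass_le1.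
apply: le_trans (ler_norm_sum _ _ _) _.
apply: (@le_trans _ _ (K * l1 (lift h0 h1))); last by rewrite ler_wpM2l// l1_lift.
by rewrite mulr_sumr; apply: ler_sum => z _; rewrite normrM ler_wpM2r.
Qed.

Section Sequences.
Context (F : set_system nat) (UF : UltraFilter F) (t : nat -> R).
Context (g0 : nat -> X0 -> R) (g1 : nat -> X1 -> R) (h0 : X0 -> R) (h1 : X1 -> R).
Context (nu' : nat -> fprob R X0) (rho' : nat -> fprob R X1).
Hypothesis t0 : forall k, 0 < t k.
Hypothesis tc : t @ F --> (0 : R).
Hypothesis g0c : forall x, (fun k => g0 k x) @ F --> h0 x.
Hypothesis g1c : forall x, (fun k => g1 k x) @ F --> h1 x.
Hypothesis nuE : forall k x, nu' k x = nu x + t k * g0 k x.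
Hypothesis rhoE : forall k y, rho' k y = rho y + t k * g1 k y.

Let PF : ProperFilter F := @ultra_proper _ _ UF.
#[local] Existing Instance PF.

Let tg (T : Type) (a : T -> R) (g : nat -> T -> R) (h : T -> R) (x : T) :
  (fun k => g k x) @ F --> h x -> (fun k => a x + t k * g k x) @ F --> a x.
Proof.
move=> gc; suff : (fun k => a x + t k * g k x) @ F --> a x + 0 * h x by rewrite mul0r addr0.
by apply: cvgD; [exact: cvg_cst|apply: cvgM].
Qed.

Let sg0 k : \sum_x g0 k x = 0.
Proof.
have := pmass_sum1 (nu' k); under eq_bigr do rewrite nuE.
rewrite big_split/= pmass_sum1 -mulr_sumr => /eqP.
by rewrite -subr_eq0 addrAC subrr add0r mulf_eq0 (gt_eqF (t0 k)) => /eqP.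
Qed.

Let sg1 k : \sum_x g1 k x = 0.
Proof.
have := pmass_sum1 (rho' k); under eq_bigr do rewrite rhoE.
rewrite big_split/= pmass_sum1 -mulr_sumr => /eqP.
by rewrite -subr_eq0 addrAC subrr add0r mulf_eq0 (gt_eqF (t0 k)) => /eqP.
Qed.

Let sh (T : finType) (g : nat -> T -> R) (h : T -> R) : (forall k, \sum_x g k x = 0) ->
  (forall x, (fun k => g k x) @ F --> h x) -> \sum_x h x = 0.
Proof.
move=> g0' gc; have : (fun k => \sum_x g k x) @ F --> \sum_x h x by exact: cvg_sumr.
by under eq_fun do rewrite g0'; move=> c; apply: (cvg_unique _ c (cvg_cst _)).
Qed.

Let eta k := lift (g0 k) (g1 k).

Let etac z : (fun k => eta k z) @ F --> lift h0 h1 z.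
Proof.
by apply: cvgD; apply: cvgM => //; exact: cvg_cst.
Qed.

Lemma EGW_upper pi phi e : opt nu rho pi -> EOT_potentials (cost pi) nu rho eps phi ->
  0 < e -> \forall k \near F, V (nu' k) (rho' k) <= V nu rho + t k * (pairf phi h0 h1 + e).
Proof.
move=> o ph e0; have [pi0 mpi JV] := optP o; have pip := optimal_gt0 o.
have s0 := sh sg0 g0c; have s1 := sh sg1 g1c.
have c (T : Type) (f : T -> R) z : (fun=> f z) @ F --> f z by exact: cvg_cst.
have := energy_quotient PF pip t0 tc (c _ pi) etac (c _ nu) g0c (c _ rho) g1c.
rewrite (grad_marg pi (marg_lift s0 s1))// -(pairf_grad o ph (marg_lift s0 s1)).
move=> /cvgr_le /(_ (pairf phi h0 h1 + e)); rewrite ltrDl => /(_ e0).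
have qpos : \forall k \near F, forall z, 0 < pi z + t k * eta k z.
  apply: filter_forall => z.
  have /cvgr_gt : (fun k => pi z + t k * eta k z) @ F --> pi z.
    suff : (fun k => pi z + t k * eta k z) @ F --> pi z + 0 * lift h0 h1 z.
      by rewrite mul0r addr0.
    by apply: cvgD; [exact: cvg_cst|apply: cvgM].
  by apply; exact: pip.
move=> H; apply: filterS (filterI H qpos) => k [/= h qk].
move: h; rewrite ler_pdivrMr// lerBlDl JV mulrC; apply: le_trans.
rewrite (_ : (fun x => nu x + t k * g0 k x) = nu' k); last by apply/funext => x; rewrite nuE.
rewrite (_ : (fun x => rho x + t k * g1 k x) = rho' k); last by apply/funext => x; rewrite rhoE.
apply: EGW_le_marg => [z|]; first exact: ltW.
have [m0 m1] := marg_lin (t k) mpi (marg_lift (sg0 k) (sg1 k)).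
by split=> x; rewrite (m0, m1) (nuE, rhoE).
Qed.

Lemma EGW_lower : exists2 pi, opt nu rho pi &
  forall phi e, EOT_potentials (cost pi) nu rho eps phi -> 0 < e ->
  \forall k \near F, V nu rho + t k * (pairf phi h0 h1 - e) <= V (nu' k) (rho' k).
Proof.
have [pk pkP] := choice (fun k => optimal_ex p k0 k1 eps_ge0 (nu' k) (rho' k)).
have [pi pic] := fprob_ultra UF pk.
have nuc x : (fun k => nu' k x) @ F --> nu x.
  by under eq_fun do rewrite nuE; exact: tg.
have rhoc x : (fun k => rho' k x) @ F --> rho x.
  by under eq_fun do rewrite rhoE; exact: tg.
have o : opt nu rho pi by apply: (optimal_cvg Delta_sym eps_ge0 PF nuc rhoc pic pkP).
exists pi => // phi e ph e0; have pip := optimal_gt0 o.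
have s0 := sh sg0 g0c; have s1 := sh sg1 g1c.
(* The perturbed optimal plan is pulled back to the original marginals; it converges to [pi], is
   eventually positive, and competes for [V nu rho]. *)
pose q k z := pk k z - t k * eta k z.
have qc z : (fun k => q k z) @ F --> pi z.
  suff : (fun k => q k z) @ F --> pi z - 0 * lift h0 h1 z by rewrite mul0r subr0.
  by apply: cvgB => //; apply: cvgM.
have c (T : Type) (f : T -> R) z : (fun=> f z) @ F --> f z by exact: cvg_cst.
have := energy_quotient PF pip t0 tc qc etac (c _ nu) g0c (c _ rho) g1c.
rewrite (grad_marg pi (marg_lift s0 s1))// -(pairf_grad o ph (marg_lift s0 s1)).
move=> /cvgr_ge /(_ (pairf phi h0 h1 - e)); rewrite gtrDl oppr_lt0 => /(_ e0) H.
have qpos : \forall k \near F, forall z, 0 < q k z.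
  by apply: filter_forall => z; have := qc z => /cvgr_gt /(_ 0); apply; exact: pip.
apply: filterS (filterI H qpos) => k [/= h qk].
have [_ mpk JVk] := optP (pkP k).
have E1 : (fun x => nu x + t k * g0 k x) = nu' k by apply/funext => x; rewrite nuE.
have E2 : (fun x => rho x + t k * g1 k x) = rho' k by apply/funext => x; rewrite rhoE.
have E3 : (fun z => q k z + t k * eta k z) = pk k.
  by apply/funext => z; rewrite /q subrK.
move: h; rewrite E1 E2 E3 JVk ler_pdivlMr// lerBrDr mulrC addrC; apply: le_trans.
rewrite lerD2r; apply: EGW_le_marg => [z|]; first exact: ltW.
have [m0 m1] := marg_lin (- t k) mpk (marg_lift (sg0 k) (sg1 k)).
have qE z : q k z = pk k z + - t k * eta k z by rewrite mulNr.
split=> x; under eq_bigr do rewrite qE.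
  by rewrite m0 nuE mulNr addrK.
by rewrite m1 rhoE mulNr addrK.
Qed.

End Sequences.
End Full.
End PositiveEps.

(** * Uniform first-order expansion *)

Section MinMax.
Context (R : realType) (X0 X1 : finType).
Local Notation plan := (fprob R (X0 * X1)%type).
Context (Opt : set plan) (D : plan -> set ((X0 -> R) * (X1 -> R))) (K : R).
Hypothesis Opt0 : Opt !=set0.
Hypothesis D0 : forall pi, Opt pi -> D pi !=set0.

Definition tangent (h0 : X0 -> R) (h1 : X1 -> R) :=
  \sum_x h0 x = 0 /\ \sum_y h1 y = 0.

Hypothesis bnd : forall pi phi h0 h1, Opt pi -> D pi phi -> tangent h0 h1 ->
  `|pairf phi h0 h1| <= K * (l1 h0 + l1 h1).

(** Extended values are needed: off the tangent directions the additive constants of the potentials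
    count and the value may be infinite. *)
Definition Lval (h0 : X0 -> R) (h1 : X1 -> R) : \bar R :=
  ereal_inf [set ereal_sup [set (pairf phi h0 h1)%:E | phi in D pi] | pi in Opt].

Definition Lam h0 h1 := fine (Lval h0 h1).

Lemma Lval_fin h0 h1 : tangent h0 h1 -> Lval h0 h1 \is a fin_num.
Proof.
move=> th; have [pi o] := Opt0.
rewrite fin_real//; apply/andP; split.
  apply: (@lt_le_trans _ _ (- (K * (l1 h0 + l1 h1)))%:E); first by rewrite ltNyr.
  apply/ereal_infP => _ [pi' o' <-]; have [phi ph] := D0 o'.
  apply: (@le_trans _ _ (pairf phi h0 h1)%:E).
    by have := bnd o' ph th; rewrite ler_norml lee_fin => /andP[].
  by apply: ereal_sup_ubound; exists phi.
apply: (@le_lt_trans _ _ (K * (l1 h0 + l1 h1))%:E); last by rewrite ltry.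
apply: ge_ereal_inf; eexists; first by exists pi.
apply: ge_ereal_sup => _ [phi ph <-].
by have := bnd o ph th; rewrite ler_norml lee_fin => /andP[].
Qed.

Lemma LamE h0 h1 : tangent h0 h1 -> (Lam h0 h1)%:E = Lval h0 h1.
Proof. by move=> th; rewrite fineK// Lval_fin. Qed.

Lemma Lam_sup h0 h1 pi e : tangent h0 h1 -> Opt pi -> 0 < e ->
  exists2 phi, D pi phi & Lam h0 h1 - e < pairf phi h0 h1.
Proof.
move=> th o e0.
have lt : ((Lam h0 h1 - e)%:E < ereal_sup [set (pairf phi h0 h1)%:E | phi in D pi])%E.
  apply: (@lt_le_trans _ _ (Lam h0 h1)%:E); first by rewrite lte_fin gtrBl.
  by rewrite LamE//; apply: ereal_inf_lbound; exists pi.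
by have [_ [phi ph <-]] := ereal_sup_gt lt; rewrite lte_fin => ?; exists phi.
Qed.

Lemma Lam_inf h0 h1 e : tangent h0 h1 -> 0 < e ->
  exists2 pi, Opt pi & forall phi, D pi phi -> pairf phi h0 h1 <= Lam h0 h1 + e.
Proof.
move=> th e0.
have lt : (Lval h0 h1 < (Lam h0 h1 + e)%:E)%E.
  by rewrite -LamE// lte_fin ltrDl.
have [_ [pi o <-] lt'] := ereal_inf_lt lt; exists pi => // phi ph.
rewrite -lee_fin; apply: le_trans (ltW lt').
by apply: ereal_sup_ubound; exists phi.
Qed.

Let tlin (a0 b0 : X0 -> R) (a1 b1 : X1 -> R) (s : R) : tangent a0 a1 -> tangent b0 b1 ->
  tangent (fun x => a0 x + s * b0 x) (fun x => a1 x + s * b1 x).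
Proof.
move=> [sa0 sa1] [sb0 sb1].
by split; rewrite big_split/= -mulr_sumr (sa0, sa1) (sb0, sb1) mulr0 addr0.
Qed.

(** Take a plan almost optimal at [g], then a potential of that plan almost optimal at [h], and
    compare its pairings with the two directions. *)
Lemma Lam_lip_le h0 h1 g0 g1 : tangent h0 h1 -> tangent g0 g1 ->
  Lam h0 h1 <= Lam g0 g1 + K * (l1 (fun x => h0 x - g0 x) + l1 (fun x => h1 x - g1 x)).
Proof.
move=> th tg; apply/ler_addgt0Pr => e e0.
have e2 : 0 < e / 2 by rewrite divr_gt0.
have [pi o le1] := Lam_inf tg e2; have [phi ph lt1] := Lam_sup th o e2.
have := le1 _ ph; have td := tlin (-1) th tg.
have := bnd o ph td; rewrite ler_norml => /andP[_].
have dE (T : Type) (a b : T -> R) : (fun x => a x + -1 * b x) = (fun x => a x - b x).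
  by apply/funext => x; rewrite mulN1r.
rewrite !dE.
have : pairf phi h0 h1 = pairf phi (fun x => h0 x - g0 x) (fun x => h1 x - g1 x) +
   pairf phi g0 g1.
  by rewrite -pairfD; congr pairf; apply/funext => x; rewrite subrK.
move: lt1; lra.
Qed.

Lemma Lam_lip h0 h1 g0 g1 : tangent h0 h1 -> tangent g0 g1 ->
  `|Lam h0 h1 - Lam g0 g1| <=
     K * (l1 (fun x => h0 x - g0 x) + l1 (fun x => h1 x - g1 x)).
Proof.
move=> th tg; have le1 := Lam_lip_le th tg; have := Lam_lip_le tg th.
have sym (T : finType) (a b : T -> R) : l1 (fun x => a x - b x) = l1 (fun x => b x - a x).
  by apply: eq_bigr => t _; rewrite distrC.
rewrite (sym _ g0) (sym _ g1) ler_norml => le2; apply/andP; split; lra.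
Qed.

Lemma Lam_bound h0 h1 : tangent h0 h1 -> `|Lam h0 h1| <= K * (l1 h0 + l1 h1).
Proof.
move=> th; apply/ler_addgt0Pr => e e0.
have [pi o le1] := Lam_inf th e0; have [phi ph lt1] := Lam_sup th o e0.
have := le1 _ ph; have := bnd o ph th; rewrite !ler_norml => /andP[? ?] ?.
by apply/andP; split; lra.
Qed.

Lemma LamZ_le t h0 h1 : 0 < t -> tangent h0 h1 ->
  Lam (fun x => t * h0 x) (fun x => t * h1 x) <= t * Lam h0 h1.
Proof.
move=> t0 th; apply/ler_addgt0Pr => e e0.
have tth : tangent (fun x => t * h0 x) (fun x => t * h1 x).
  by have [s0 s1] := th; split; rewrite -mulr_sumr (s0, s1) mulr0.
have e2 : 0 < e / 2 by rewrite divr_gt0.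
have e2t : 0 < e / 2 / t by rewrite divr_gt0.
have [pi o le1] := Lam_inf th e2t; have [phi ph lt1] := Lam_sup tth o e2.
have := ler_wpM2l (ltW t0) (le1 _ ph).
have -> : t * (Lam h0 h1 + e / 2 / t) = t * Lam h0 h1 + e / 2.
  by field; rewrite gt_eqF.
by move: lt1; rewrite pairfZ; lra.
Qed.

Lemma LamZ t h0 h1 : 0 < t -> tangent h0 h1 ->
  Lam (fun x => t * h0 x) (fun x => t * h1 x) = t * Lam h0 h1.
Proof.
move=> t0 th; apply/eqP; rewrite eq_le LamZ_le//=.
have tth : tangent (fun x => t * h0 x) (fun x => t * h1 x).
  by have [s0 s1] := th; split; rewrite -mulr_sumr (s0, s1) mulr0.
have ti : 0 < t^-1 by rewrite invr_gt0.
have := LamZ_le ti tth.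
have E (T : Type) (h : T -> R) : (fun x => t^-1 * (t * h x)) = h.
  by apply/funext => x; rewrite mulKf// gt_eqF.
by rewrite !E mulrC ler_pdivlMr// mulrC.
Qed.

Section BDifferentiability.
Context (V : fprob R X0 -> fprob R X1 -> R) (nu : fprob R X0) (rho : fprob R X1).

(** The test sequences of Hadamard directional differentiability, taken along an ultrafilter. *)
Definition approaching (F : set_system nat) (t : nat -> R)
    (g0 : nat -> X0 -> R) (g1 : nat -> X1 -> R) (h0 : X0 -> R) (h1 : X1 -> R)
    (nu' : nat -> fprob R X0) (rho' : nat -> fprob R X1) : Prop :=
  [/\ UltraFilter F, forall k, 0 < t k, t @ F --> (0 : R),
      (forall x, (fun k => g0 k x) @ F --> h0 x) /\
      (forall y, (fun k => g1 k y) @ F --> h1 y) &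
      (forall k x, nu' k x = nu x + t k * g0 k x) /\
      (forall k y, rho' k y = rho y + t k * g1 k y)].

Hypothesis Vext : forall (nu' : fprob R X0) (rho' : fprob R X1),
  nu' =1 nu -> rho' =1 rho -> V nu' rho' = V nu rho.

(** The quantifiers mirror the inf-sup: the upper bound is available for each plan, the lower one
    for some plan and all its potentials. *)
Hypothesis Vup : forall F t g0 g1 h0 h1 nu' rho',
  approaching F t g0 g1 h0 h1 nu' rho' ->
  forall pi M e, Opt pi -> (forall phi, D pi phi -> pairf phi h0 h1 <= M) -> 0 < e ->
  \forall k \near F, V (nu' k) (rho' k) <= V nu rho + t k * (M + e).

Hypothesis Vlow : forall F t g0 g1 h0 h1 nu' rho',
  approaching F t g0 g1 h0 h1 nu' rho' ->
  exists2 pi, Opt pi & forall phi e, D pi phi -> 0 < e ->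
  \forall k \near F, V nu rho + t k * (pairf phi h0 h1 - e) <= V (nu' k) (rho' k).

(* By compactness of the unit sphere, the one-sided limits along sequences give a
   uniform first-order expansion. *)
Lemma B_differentiable e : 0 < e -> exists2 d : R, 0 < d &
  forall (nu' : fprob R X0) (rho' : fprob R X1),
  l1 (fun x => nu' x - nu x) + l1 (fun y => rho' y - rho y) <= d ->
  `|V nu' rho' - V nu rho - Lam (fun x => nu' x - nu x) (fun y => rho' y - rho y)| <=
    e * (l1 (fun x => nu' x - nu x) + l1 (fun y => rho' y - rho y)).
Proof.
move=> e0; apply: contrapT => no.
pose N (nu' : fprob R X0) (rho' : fprob R X1) :=
  l1 (fun x => nu' x - nu x) + l1 (fun y => rho' y - rho y).
pose E (nu' : fprob R X0) (rho' : fprob R X1) :=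
  V nu' rho' - V nu rho - Lam (fun x => nu' x - nu x) (fun y => rho' y - rho y).
have H k : exists q : fprob R X0 * fprob R X1,
    N q.1 q.2 <= k.+1%:R^-1 /\ e * N q.1 q.2 < `|E q.1 q.2|.
  apply: contrapT => /forallNP no'; apply: no.
  exists k.+1%:R^-1; first by rewrite invr_gt0.
  move=> nu' rho' le1; rewrite leNgt; apply/negP => lt1.
  by apply: (no' (nu', rho')).
have [q qP] := choice H.
pose nu' k := (q k).1; pose rho' k := (q k).2.
pose t k := N (nu' k) (rho' k).
have tan k : tangent (fun x => nu' k x - nu x) (fun y => rho' k y - rho y).
  by split; rewrite sumrB !pmass_sum1 subrr.
have N0 nu'' rho'' : 0 <= N nu'' rho'' by rewrite addr_ge0 ?l1_ge0.
(* At zero displacement the error [E] is 0, so a counterexample has positive norm and can be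
   normalised. *)
have t0 k : 0 < t k.
  rewrite lt_neqAle N0 andbT; apply/eqP => tk0.
  have [_] := qP k; rewrite -/(nu' k) -/(rho' k) -/(t k) -tk0 mulr0 => /lt_eqF/negP; apply.
  have z0 (T : finType) (f : T -> R) : l1 f = 0 -> forall x, f x = 0.
    move=> f0 x; apply/eqP; rewrite -normr_le0 -f0; exact: le_l1.
  have l0 := l1_ge0 (fun x => nu' k x - nu x).
  have l1' := l1_ge0 (fun y => rho' k y - rho y).
  have hsum : l1 (fun x => nu' k x - nu x) + l1 (fun y => rho' k y - rho y) = 0.
    by rewrite [RHS]tk0.
  have a0 : l1 (fun x => nu' k x - nu x) = 0 by apply/eqP; rewrite eq_le l0 andbT; lra.
  have a1 : l1 (fun x => rho' k x - rho x) = 0 by apply/eqP; rewrite eq_le l1' andbT; lra.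
  have V0 : V (nu' k) (rho' k) = V nu rho.
    apply: Vext => x; apply/eqP; rewrite -subr_eq0; apply/eqP.
      exact: (z0 _ _ a0).
    exact: (z0 _ _ a1).
  have := Lam_bound (tan k); rewrite a0 a1 addr0 mulr0 normr_le0 => /eqP L0.
  by rewrite /E L0 V0 subrr subr0 normr0.
have [F [UF Foo]] := @nat_ultra; have PF := @ultra_proper _ _ UF.
have tc : t @ F --> (0 : R).
  apply: (@squeeze_cvgr _ _ _ _ (fun=> 0) (fun k => k.+1%:R^-1)); last 2 first.
  - exact: cvg_cst.
  - by apply: ultra_ninfty => //; exact: cvg_harmonic.
  by apply: filterE => k; rewrite (ltW (t0 k)); case: (qP k).
pose g0 k x := (nu' k x - nu x) / t k; pose g1 k y := (rho' k y - rho y) / t k.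
have b0 k x : `|g0 k x| <= 1.
  rewrite normrM normfV (gtr0_norm (t0 k)) ler_pdivrMr// mul1r.
  by apply: le_trans (le_l1 (fun x => nu' k x - nu x) x) _; rewrite lerDl l1_ge0.
have b1 k x : `|g1 k x| <= 1.
  rewrite normrM normfV (gtr0_norm (t0 k)) ler_pdivrMr// mul1r.
  by apply: le_trans (le_l1 (fun x => rho' k x - rho x) x) _; rewrite lerDr l1_ge0.
have [h0 g0c] := choice (fun x => ultra_cvg UF (fun k => b0 k x)).
have [h1 g1c] := choice (fun x => ultra_cvg UF (fun k => b1 k x)).
have tg k : tangent (g0 k) (g1 k).
  by have [s0 s1] := tan k; split; rewrite -mulr_suml (s0, s1) mul0r.
have th : tangent h0 h1.
  split.
    have : (fun k => \sum_x g0 k x) @ F --> \sum_x h0 x by exact: cvg_sumr.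
    under eq_fun do rewrite (tg _).1.
    by move=> c; apply: (cvg_unique _ c (cvg_cst _)).
  have : (fun k => \sum_x g1 k x) @ F --> \sum_x h1 x by exact: cvg_sumr.
  under eq_fun do rewrite (tg _).2.
  by move=> c; apply: (cvg_unique _ c (cvg_cst _)).
have tgE k x : t k * g0 k x = nu' k x - nu x by rewrite mulrC divfK// gt_eqF.
have tgE1 k x : t k * g1 k x = rho' k x - rho x by rewrite mulrC divfK// gt_eqF.
have ap : approaching F t g0 g1 h0 h1 nu' rho'.
  by split=> //; split=> k x; rewrite (tgE, tgE1) addrC subrK.
(* On each side there are three errors of [e / 4]: the almost optimal plan or potential, the
   one-sided expansion, and the passage from [g k] to its limit. *)
have e4 : 0 < e / 4 by rewrite divr_gt0.
have [pi o le1] := Lam_inf th e4.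
have up := Vup ap o le1 e4.
have [pi' o' low'] := Vlow ap.
have [phi ph lt1] := Lam_sup th o' e4.
have low := low' phi _ ph e4.
pose dl k := l1 (fun x => g0 k x - h0 x) + l1 (fun x => g1 k x - h1 x).
have dlc : (fun k => K * dl k) @ F --> (0 : R).
  suff : (fun k => K * dl k) @ F --> K * (0 + 0) by rewrite addr0 mulr0.
  by apply: cvgM; [exact: cvg_cst|apply: cvgD; exact: l1_cvg0].
have dle : \forall k \near F, K * dl k <= e / 4 by move/cvgr_le: dlc; apply.
have [k [/= [upk lowk] dlk]] := filter_ex (filterI (filterI up low) dle).
have [_] := qP k; rewrite -/(nu' k) -/(rho' k) -/(t k) ltNge => /negP; apply.
have LE : Lam (fun x => nu' k x - nu x) (fun y => rho' k y - rho y) = t k * Lam (g0 k) (g1 k).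
  rewrite -LamZ//; congr Lam; apply/funext => x; first by rewrite tgE.
  by rewrite tgE1.
have := Lam_lip (tg k) th; rewrite -/(dl k) ler_norml => /andP[L1 L2].
have tk := t0 k.
rewrite /E LE ler_norml; apply/andP; split.
  have : t k * (Lam (g0 k) (g1 k) - pairf phi h0 h1 + e / 4) <= t k * e.
    by rewrite ler_pM2l//; lra.
  by move: lowk; lra.
have : t k * (Lam h0 h1 + e / 4 + e / 4 - Lam (g0 k) (g1 k)) <= t k * e.
  by rewrite ler_pM2l//; lra.
by move: upk; lra.
Qed.

End BDifferentiability.
End MinMax.

(** * Varying directions in the unregularised problem *)

Section ApproachGW.
Context (R : realType) (X0 X1 : finType).
Context (p : R) (k0 : X0 -> X0 -> R) (k1 : X1 -> X1 -> R).
Hypothesis Delta_sym : forall x y x' y',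
  Delta p k0 k1 x y x' y' = Delta p k0 k1 x' y' x y.
Context (nu : fprob R X0) (rho : fprob R X1).
Context (nu_full : full_support nu) (rho_full : full_support rho).
Local Notation V := (EGW p k0 k1 0).

Lemma full_step (T : finType) (mu : fprob R T) (h : T -> R) : full_support mu ->
  exists2 s, 0 < s & forall r, 0 <= r -> r <= s -> forall x, 0 <= mu x + r * h x.
Proof.
move=> full; apply: small_step => x; first exact: ltW.
by move=> mx; have := full x; rewrite mx ltxx.
Qed.

Section Seq.
Context (F : set_system nat) (t : nat -> R).
Context (g0 : nat -> X0 -> R) (g1 : nat -> X1 -> R) (h0 : X0 -> R) (h1 : X1 -> R).
Context (nu' : nat -> fprob R X0) (rho' : nat -> fprob R X1).
Hypothesis ap : approaching nu rho F t g0 g1 h0 h1 nu' rho'.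

(* The Lipschitz property lets the directions g k be replaced by their limit h. *)
Lemma fixed_direction : exists (t' : nat -> R) (nu'' : nat -> fprob R X0)
    (rho'' : nat -> fprob R X1),
  [/\ forall k, 0 < t' k, t' @ F --> (0 : R),
      (forall k x, nu'' k x = nu x + t' k * h0 x) /\
      (forall k y, rho'' k y = rho y + t' k * h1 y) &
      forall e, 0 < e -> \forall k \near F, t' k = t k /\
        `|V (nu' k) (rho' k) - V (nu'' k) (rho'' k)| <= t k * e].
Proof.
have [UF t0 tc [g0c g1c] [nuE rhoE]] := ap; have PF := @ultra_proper _ _ UF.
have sg (T : finType) (mu : fprob R T) (mu' : nat -> fprob R T) (g : nat -> T -> R) (h : T -> R) :
   (forall k x, mu' k x = mu x + t k * g k x) ->
   (forall x, (fun k => g k x) @ F --> h x) -> \sum_x h x = 0.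
  move=> muE gc; have sk k : \sum_x g k x = 0.
    have := pmass_sum1 (mu' k); under eq_bigr do rewrite muE.
    rewrite big_split/= pmass_sum1 -mulr_sumr => /eqP.
    by rewrite -subr_eq0 addrAC subrr add0r mulf_eq0 (gt_eqF (t0 k)) => /eqP.
  have : (fun k => \sum_x g k x) @ F --> \sum_x h x by exact: cvg_sumr.
  by under eq_fun do rewrite sk; move=> c; apply: (cvg_unique _ c (cvg_cst _)).
have s0 := sg _ _ _ _ _ nuE g0c; have s1 := sg _ _ _ _ _ rhoE g1c.
have [a a0 ha] := full_step h0 nu_full; have [b b0 hb] := full_step h1 rho_full.
(* The truncation keeps the masses nonnegative for every [k], so that probability measures exist
   throughout; eventually it is inactive. *)
pose t' k := Num.min (t k) (Num.min a b).
have ab : 0 < Num.min a b by rewrite lt_min a0.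
have t'0 k : 0 < t' k by rewrite /t' lt_min t0.
have t'a k : t' k <= a by rewrite /t' !ge_min lexx !orbT.
have t'b k : t' k <= b by rewrite /t' !ge_min lexx !orbT.
have mk (T : finType) (mu : fprob R T) (h : T -> R) : \sum_x h x = 0 ->
   (forall k x, 0 <= mu x + t' k * h x) ->
   exists mu'' : nat -> fprob R T, forall k x, mu'' k x = mu x + t' k * h x.
  move=> sh pos; have : forall k, exists m : fprob R T, forall x, m x = mu x + t' k * h x.
    move=> k; have [|m mE] := fprob_of (pos k); last by exists m => x; rewrite mE.
    by rewrite big_split/= -mulr_sumr sh mulr0 addr0 pmass_sum1.
  by move=> h'; have [f fP] := choice h'; exists f.
have [nu'' nu''E] := mk _ nu h0 s0 (fun k => ha _ (ltW (t'0 k)) (t'a k)).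
have [rho'' rho''E] := mk _ rho h1 s1 (fun k => hb _ (ltW (t'0 k)) (t'b k)).
have ev : \forall k \near F, t' k = t k.
  have : \forall k \near F, t k <= Num.min a b by move/cvgr_le: tc; apply.
  by apply: filterS => k tk; rewrite /t' (min_idPl tk).
exists t', nu'', rho''; split=> //.
  apply: cvg_trans tc; apply: near_eq_cvg; apply: filterS ev => k ->//.
move=> e e0.
pose dl k := l1 (fun x => g0 k x - h0 x) + l1 (fun x => g1 k x - h1 x).
have dlc : (fun k => Kq p k0 k1 * dl k) @ F --> (0 : R).
  suff : (fun k => Kq p k0 k1 * dl k) @ F --> Kq p k0 k1 * (0 + 0) by rewrite addr0 mulr0.
  by apply: cvgM; [exact: cvg_cst|apply: cvgD; exact: l1_cvg0].
have dle : \forall k \near F, Kq p k0 k1 * dl k <= e by move/cvgr_le: dlc; apply.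
apply: filterS (filterI ev dle) => k [/= tk dk]; split=> //.
have := EGW_modulus Delta_sym (lexx 0) (lexx (l1 (fun x => nu' k x - nu'' k x) +
   l1 (fun y => rho' k y - rho'' k y))).
rewrite mul0r addr0; move/le_trans; apply.
have lE (T : finType) (m m' : fprob R T) (mu : fprob R T) (g h : T -> R) :
   (forall x, m x = mu x + t k * g x) -> (forall x, m' x = mu x + t k * h x) ->
   l1 (fun x => m x - m' x) = t k * l1 (fun x => g x - h x).
  move=> mE m'E; rewrite /l1 mulr_sumr; apply: eq_bigr => x _.
  rewrite mE m'E (_ : _ - _ = t k * (g x - h x)); last by ring.
  by rewrite normrM gtr0_norm.
have nk x : nu'' k x = nu x + t k * h0 x by rewrite nu''E tk.
have rk x : rho'' k x = rho x + t k * h1 x by rewrite rho''E tk.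
rewrite (lE _ _ _ _ _ _ (nuE k) nk) (lE _ _ _ _ _ _ (rhoE k) rk) -mulrDr mulrCA.
by rewrite ler_pM2l.
Qed.

Lemma EGW0_upper_seq pi M e : optimal_plans p k0 k1 0 nu rho pi ->
  (forall phi, OT_potentials (plan_cost p k0 k1 pi) nu rho phi -> pairf phi h0 h1 <= M) ->
  0 < e -> \forall k \near F, V (nu' k) (rho' k) <= V nu rho + t k * (M + e).
Proof.
move=> o HM e0; have [UF t0 tc _ _] := ap; have PF := @ultra_proper _ _ UF.
have [t' [nu'' [rho'' [t'0 t'c [nuE rhoE] H]]]] := fixed_direction.
have [C [s0 [s00 up]]] := EGW0_upper Delta_sym o HM.
have e2 : 0 < e / 2 by rewrite divr_gt0.
have t's : \forall k \near F, t' k <= s0 by move/cvgr_le: t'c; apply.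
have tC : \forall k \near F, t k * C <= e / 2.
  have : (fun k => t k * C) @ F --> 0 * C by apply: cvgM => //; exact: cvg_cst.
  by rewrite mul0r => /cvgr_le; apply.
apply: filterS (filterI (filterI t's tC) (H _ e2)) => k [/= [tks tkC] [tk le1]].
have := up (t' k) (nu'' k) (rho'' k) (t'0 k) tks (nuE k) (rhoE k).
move: le1; rewrite tk ler_norml => /andP[_ le1].
have := ler_wpM2l (ltW (t0 k)) tkC; rewrite expr2 mulrDr; lra.
Qed.

Lemma EGW0_lower_seq : exists2 pi, optimal_plans p k0 k1 0 nu rho pi &
  forall phi e, OT_potentials (plan_cost p k0 k1 pi) nu rho phi -> 0 < e ->
  \forall k \near F, V nu rho + t k * (pairf phi h0 h1 - e) <= V (nu' k) (rho' k).
Proof.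
have [UF t0 tc _ _] := ap; have PF := @ultra_proper _ _ UF.
have [t' [nu'' [rho'' [t'0 t'c [nuE rhoE] H]]]] := fixed_direction.
have [pi o [C low]] := EGW0_lower Delta_sym UF t'0 t'c nuE rhoE.
exists pi => // phi e ph e0; have e2 : 0 < e / 2 by rewrite divr_gt0.
have tC : \forall k \near F, - (e / 2) <= t k * C.
  have : (fun k => t k * C) @ F --> 0 * C by apply: cvgM => //; exact: cvg_cst.
  by rewrite mul0r => /cvgr_ge; apply; rewrite oppr_lt0.
apply: filterS (filterI (filterI low tC) (H _ e2)) => k [/= [lk tkC] [tk le1]].
have := lk phi ph.
move: le1; rewrite tk ler_norml => /andP[le1 _].
have := ler_wpM2l (ltW (t0 k)) tkC; rewrite expr2 mulrBr; lra.
Qed.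

End Seq.
End ApproachGW.

(** * Delta method *)

Section RandomElements.
Context (R : realType) d (Om : measurableType d) (P : probability Om R).
Implicit Types Z : Om -> R.

Lemma random_element_measurable Z : random_element Z -> measurable_fun setT Z.
Proof.
move=> h; apply: (measurability _ (RGenInftyO.measurableE R)) => _ [_ [a ->] <-].
by rewrite setTI; apply: h; exact: interval_open.
Qed.

Lemma measurable_random_element Z : measurable_fun setT Z -> random_element Z.
Proof.
move=> mZ U oU; rewrite -[X in measurable X]setTI; apply: mZ => //.
exact: open_measurable.
Qed.

Lemma random_element_comp (T U : topologicalType) (X : Om -> T) (f : T -> U) :
  random_element X -> continuous f -> random_element (f \o X).
Proof.
move=> h /continuousP cf A oA; rewrite comp_preimage; exact: h (cf _ oA).
Qed.

(** Under local control of [Z] by [X], the preimage of an open set under [Z] is that of an open set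
    under [X]. This serves the values of random measures that are observed only through their mass
    vectors. *)
Lemma random_element_local (T : topologicalType) (X : Om -> T) Z :
  random_element X ->
  (forall w e, 0 < e -> exists A : set T, [/\ open A, A (X w) &
     forall w', A (X w') -> `|Z w' - Z w| < e]) ->
  random_element Z.
Proof.
move=> hX loc U oU.
pose W : set T := \bigcup_(A in [set A | open A /\ forall w, A (X w) -> U (Z w)]) A.
have -> : Z @^-1` U = X @^-1` W.
  apply/seteqP; split=> w /= h; last by case: h => A [_ hA]; exact: hA.
  have /nbhs_ballP[e /= e0 be] : nbhs (Z w) U by exact: open_nbhs_nbhs.
  have [A [oA Aw hA]] := loc w e e0.
  exists A => //; split=> // w' Aw'; apply: be.
  by rewrite /ball/= distrC hA.
by apply: hX; apply: bigcup_open => A [].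
Qed.

Lemma bounded_integrable Z M : random_element Z -> (forall w, `|Z w| <= M) ->
  P.-integrable setT (EFin \o Z).
Proof.
move=> /random_element_measurable mZ ZM; apply: measurable_bounded_integrable => //.
  by apply: le_lt_trans (probability_le1 _ _) _ => //; rewrite ltry.
exists M; split=> [|r Mr w _]; first exact: num_real.
exact: le_trans (ZM w) (ltW Mr).
Qed.

Lemma expectation_Rintegral Z M : random_element Z -> (forall w, `|Z w| <= M) ->
  'E_P[Z]%E = (Rintegral P setT Z)%:E.
Proof.
move=> mZ ZM; rewrite unlock /Rintegral fineK//.
by apply: integrable_fin_num => //; exact: bounded_integrable ZM.
Qed.

Lemma Rintegral_prob_cst c : Rintegral P setT (fun=> c) = c.
Proof. by rewrite /Rintegral; have := expectation_cst P c; rewrite unlock => ->. Qed.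

End RandomElements.

Lemma uniform_continuity (R : realType) (f : R -> R) (A e : R) : continuous f -> 0 < e ->
  exists2 dl : R, 0 < dl & forall a b, `|a| <= A -> `|b| <= A -> `|a - b| <= dl ->
    `|f a - f b| <= e.
Proof.
move=> cf e0; apply: contrapT => no.
have H k : exists q : R * R, [/\ `|q.1| <= A, `|q.2| <= A, `|q.1 - q.2| <= k.+1%:R^-1 &
    e < `|f q.1 - f q.2| ].
  apply: contrapT => /forallNP no'; apply: no.
  exists k.+1%:R^-1; first by rewrite invr_gt0.
  move=> a b aA bA ab; rewrite leNgt; apply/negP => lt1.
  by apply: (no' (a, b)).
have [q qP] := choice H.
have [F [UF Foo]] := nat_ultra; have PF := @ultra_proper _ _ UF.
have [a ac] := @ultra_cvg R F UF (fun k => (q k).1) A (fun k => let: And4 h _ _ _ := qP k in h).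
have [b bc] := @ultra_cvg R F UF (fun k => (q k).2) A (fun k => let: And4 _ h _ _ := qP k in h).
have dc : (fun k => `|(q k).1 - (q k).2|) @ F --> `|a - b|.
  by apply: cvg_norm; exact: cvgB.
have dc0 : (fun k => `|(q k).1 - (q k).2|) @ F --> (0 : R).
  apply: (@squeeze_cvgr _ _ _ _ (fun=> 0) (fun k => k.+1%:R^-1)); last 2 first.
  - exact: cvg_cst.
  - by apply: ultra_ninfty => //; exact: cvg_harmonic.
  by apply: filterE => k; rewrite normr_ge0; case: (qP k).
have : `|a - b| = 0 by apply: (cvg_unique _ dc dc0).
move=> /eqP; rewrite normr_eq0 subr_eq0 => /eqP ab.
have fc : (fun k => `|f (q k).1 - f (q k).2|) @ F --> `|f a - f b|.
  apply: cvg_norm; apply: cvgB; first exact: (continuous_cvg _ (cf a) ac).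
  exact: (continuous_cvg _ (cf b) bc).
have : e <= `|f a - f b|.
  by apply: (cvgr_to_ge fc); apply: filterE => k; case: (qP k) => _ _ _ /ltW.
by rewrite ab subrr normr0 leNgt e0.
Qed.

Section Tail.
Context (R : realType) (T : topologicalType) (N : T -> R).
Hypothesis cN : continuous N.

(** A piecewise linear cutoff, 0 for [N u <= M] and 1 for [N u >= M + 1]; being continuous and
    bounded, it passes to the limit and transfers tightness from the limit law to the sequence. *)
Definition tail (M : R) (u : T) : R := (`|N u - M| - `|N u - M - 1| + 1) / 2.

Lemma tail_continuous M : continuous (tail M).
Proof.
move=> u; apply: cvgM; last exact: cvg_cst.
apply: cvgD; last exact: cvg_cst.
have h : (fun x => N x - M) @ u --> N u - M by apply: cvgB; [exact: cN|exact: cvg_cst].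
apply: cvgB; first exact: cvg_norm.
by apply: cvg_norm; apply: cvgB => //; exact: cvg_cst.
Qed.

Lemma tail_ge0 M u : 0 <= tail M u.
Proof.
rewrite /tail divr_ge0//; have := ler_normB (N u - M) 1.
by have := ler_normB (N u - M - 1) (N u - M); rewrite addrAC subrr add0r normrN normr1; lra.
Qed.

Lemma tail_le1 M u : tail M u <= 1.
Proof.
rewrite /tail ler_pdivrMr//; have := ler_normD (N u - M - 1) 1.
by rewrite subrK normr1; lra.
Qed.

Lemma tail1 M u : M + 1 <= N u -> tail M u = 1.
Proof. by move=> h; rewrite /tail !ger0_norm; lra. Qed.

Lemma tail0 M u : N u <= M -> tail M u = 0.
Proof. by move=> h; rewrite /tail !ler0_norm; lra. Qed.

End Tail.

Section ConvergenceInDistribution.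
Context (R : realType) (d : nat -> measure_display) (Om : forall n, measurableType (d n)).
Context (P : forall n, probability (Om n) R).
Context (dG : measure_display) (OmG : measurableType dG) (PG : probability OmG R).

Lemma cvg_in_distribution_Rintegral (T : topologicalType) (X : forall n, Om n -> T)
    (Y : OmG -> T) (f : T -> R) M :
  cvg_in_distribution P X PG Y -> continuous f -> (forall u, `|f u| <= M) ->
  Rintegral (P n) setT (f \o X n) @[n --> \oo] --> Rintegral PG setT (f \o Y).
Proof.
move=> [mX mY H] cf fM; have := H f cf (ex_intro _ M fM).
rewrite (expectation_Rintegral PG (random_element_comp mY cf) (fun w => fM (Y w))).
move=> /fine_cvg; rewrite (_ : fine \o _ = fun n => Rintegral (P n) setT (f \o X n))//.
apply/funext => n /=.
by rewrite (expectation_Rintegral (P n) (random_element_comp (mX n) cf) (fun w => fM (X n w))).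
Qed.

(** Convergence in law is tested on a bounded continuous function with the same zeros as [g]. It
    shows that the limit vector almost surely has zero coordinate sums. *)
Lemma vanishing_limit (T : topologicalType) (X : forall n, Om n -> T)
    (Y : OmG -> T) (g : T -> R) : cvg_in_distribution P X PG Y -> continuous g ->
  (forall n w, g (X n w) = 0) -> {ae PG, forall w, g (Y w) = 0}.
Proof.
move=> XY cg g0; have [mX mY _] := XY.
pose h u := `|g u| / (1 + `|g u|).
have n0 u : 0 < 1 + `|g u| by rewrite ltr_pwDl.
have ch : continuous h.
  move=> u; have cn : (fun u => `|g u|) @ u --> `|g u| by apply: cvg_norm; exact: cg.
  apply: cvgM => //; apply: cvgV; first by rewrite gt_eqF.
  by apply: cvgD => //; exact: cvg_cst.
have h0 u : 0 <= h u by rewrite divr_ge0// ltW.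
have h1 u : `|h u| <= 1 by rewrite ger0_norm// ler_pdivrMr// mul1r lerDr.
have := cvg_in_distribution_Rintegral XY ch h1.
have hX n : h \o X n = fun=> 0 by apply/funext => w; rewrite /h /= g0 normr0 mul0r.
under eq_fun do rewrite hX Rintegral_prob_cst.
move=> c; have I0 : Rintegral PG setT (h \o Y) = 0.
  by apply: (cvg_unique _ c (cvg_cst _)).
have mhY := random_element_comp mY ch.
have := expectation_Rintegral PG mhY (fun w => h1 (Y w)).
rewrite unlock I0 => E0.
have mh : measurable_fun setT (fun w => (h (Y w))%:E : \bar R).
  by apply/measurable_EFinP; exact: random_element_measurable.
have := (ae_eq_integral_abs PG measurableT mh).1.
have -> : (\int[PG]_x `|(h (Y x))%:E| = 0)%E.
  by rewrite -[RHS]E0; apply: eq_integral => w _ /=; rewrite ger0_norm.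
move=> /(_ erefl); apply: filterS => w /(_ I) /= [] /eqP.
rewrite /h mulf_eq0 invr_eq0 (gt_eqF (n0 _)) orbF normr_eq0.
by move=> /eqP.
Qed.

Lemma tail_small (T : topologicalType) (N : T -> R) (Y : OmG -> T) (e : R) :
  continuous N -> random_element Y -> 0 < e ->
  exists m : nat, Rintegral PG setT (tail N m%:R \o Y) <= e.
Proof.
move=> cN mY e0.
have mt m : random_element (tail N m%:R \o Y).
  by apply: random_element_comp => //; exact: tail_continuous.
have tb m w : `|(tail N m%:R \o Y) w| <= 1.
  by rewrite ger0_norm ?tail_ge0// tail_le1.
have c0 : (\int[PG]_w ((tail N m%:R \o Y) w)%:E)%E @[m --> \oo] --> (\int[PG]_w cst 0%E w)%E.
  apply: (@dominated_cvg _ _ R PG setT measurableT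
    (fun m w => ((tail N m%:R \o Y) w)%:E) (cst 0%E) (cst 1%E)).
  - by move=> m; apply/measurable_EFinP; exact: random_element_measurable.
  - move=> w _; apply: cvg_near_cst; near=> m; rewrite /= tail0//.
    near: m; exact: nbhs_infty_ger.
  - by [].
  - by apply: finite_measure_integrable_cst.
  - by move=> m w _; have := tb m w; rewrite /= lee_fin.
rewrite integral_cst// mul0e in c0.
have c1 : Rintegral PG setT (tail N m%:R \o Y) @[m --> \oo] --> (0 : R).
  by move/fine_cvg: c0.
have : \forall m \near \oo, Rintegral PG setT (tail N m%:R \o Y) <= e.
  by move/cvgr_le: c1; apply.
by move=> /filter_ex[m]; exists m.
Unshelve. all: by end_near. Qed.

(** [L] need not be linear. As [f] is only continuous, the linear growth of [L] confines the
    arguments to a segment, where [f] is uniformly continuous, except on an event of small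
    probability. *)
Lemma delta_method (T : topologicalType) (X : forall n, Om n -> T) (Y : OmG -> T)
    (N L : T -> R) (K : R) (Z : forall n, Om n -> R) (ZG : OmG -> R) :
  cvg_in_distribution P X PG Y -> continuous N -> continuous L ->
  (forall u, `|L u| <= K * N u) -> 0 <= K ->
  (forall n, random_element (Z n)) -> random_element ZG ->
  {ae PG, forall w, ZG w = L (Y w)} ->
  (forall M e, 0 < e -> \forall n \near \oo, forall w, N (X n w) <= M ->
     `|Z n w - L (X n w)| <= e) ->
  cvg_in_distribution P Z PG ZG.
Proof.
move=> XY cN cL LK K0 mZ mZG aeZ H; have [mX mY _] := XY.
split=> // f cf [M0 fM0].
pose Bd := `|M0| + 1.
have Bd0 : 0 < Bd by rewrite ltr_wpDl.
have fB u : `|f u| <= Bd.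
  by apply: le_trans (fM0 u) _; rewrite /Bd; have := ler_norm M0; lra.
have mfZ n : random_element (f \o Z n) := random_element_comp (mZ n) cf.
have mfZG : random_element (f \o ZG) := random_element_comp mZG cf.
have cfL : continuous (f \o L) by move=> u; exact: (continuous_comp (cL u) (cf _)).
have mfLX n : random_element ((f \o L) \o X n) := random_element_comp (mX n) cfL.
have mfLY : random_element ((f \o L) \o Y) := random_element_comp mY cfL.
have EG : Rintegral PG setT (f \o ZG) = Rintegral PG setT ((f \o L) \o Y).
  congr fine; apply: ae_eq_integral => //.
  - by apply/measurable_EFinP; exact: random_element_measurable.
  - by apply/measurable_EFinP; exact: random_element_measurable.
  - by apply: filterS aeZ => w h _ /=; rewrite h.
rewrite (expectation_Rintegral PG mfZG (fun w => fB _)) EG.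
rewrite (_ : (fun n => _) = fun n => (Rintegral (P n) setT (f \o Z n))%:E); last first.
  by apply/funext => n; rewrite (expectation_Rintegral (P n) (mfZ n) (fun w => fB _)).
apply: cvg_EFin; first by apply: filterE.
apply/cvgrPdist_le => e e0.
(* The tail mass is at most [2 * eta] for large [n] and is weighted by [2 * Bd], which gives
   [e / 2]; uniform continuity and convergence in law use [e / 4] each. *)
pose eta := e / (8 * Bd).
have eta0 : 0 < eta by rewrite divr_gt0// mulr_gt0.
have [m mP] := tail_small cN mY eta0.
have e4 : 0 < e / 4 by rewrite divr_gt0.
(* Where [N <= m + 1], [L] is at most [K * (m + 1)] in absolute value, and [Z] differs from it by at
   most 1. *)
have [dl dl0 dlP] := uniform_continuity (K * (m%:R + 1) + 1) cf e4.
pose dl1 := Num.min dl 1.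
have dl10 : 0 < dl1 by rewrite lt_min dl0 ltr01.
have ct := tail_continuous cN (M := m%:R).
have tb u : `|tail N m%:R u| <= 1 by rewrite ger0_norm ?tail_ge0// tail_le1.
have c1 := cvg_in_distribution_Rintegral XY ct tb.
have n1 : \forall n \near \oo, Rintegral (P n) setT (tail N m%:R \o X n) <= 2 * eta.
  by move/cvgr_le: c1; apply; apply: le_lt_trans mP _; rewrite ltr_pMl// ltr1n.
have c2 := cvg_in_distribution_Rintegral XY cfL (fun u => fB (L u)).
have n2 : \forall n \near \oo, `|Rintegral PG setT ((f \o L) \o Y) -
    Rintegral (P n) setT ((f \o L) \o X n)| <= e / 4.
  by move/cvgrPdist_le: c2; apply.
have n3 := H (m%:R + 1) dl1 dl10.
apply: filterS (filterI (filterI n1 n2) n3) => n [/= [h1 h2] h3].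
have pw w : `|f (Z n w) - f (L (X n w))| <= e / 4 + 2 * Bd * tail N m%:R (X n w).
  have [le1|/ltW ge1] := leP (N (X n w)) (m%:R + 1).
    have LA : `|L (X n w)| <= K * (m%:R + 1).
      by apply: le_trans (LK _) _; rewrite ler_wpM2l.
    have hd := h3 w le1.
    have d1 : `|Z n w - L (X n w)| <= 1 by apply: le_trans hd _; rewrite ge_min lexx orbT.
    have d2 : `|Z n w - L (X n w)| <= dl by apply: le_trans hd _; rewrite ge_min lexx.
    have ZA : `|Z n w| <= K * (m%:R + 1) + 1.
      by have := ler_normD (Z n w - L (X n w)) (L (X n w)); rewrite subrK; lra.
    apply: (@le_trans _ _ (e / 4)); first by apply: dlP => //; lra.
    by rewrite lerDl mulr_ge0 ?tail_ge0// mulr_ge0// ltW.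
  rewrite tail1// mulr1; apply: le_trans (ler_normB _ _) _.
  by have := fB (Z n w); have := fB (L (X n w)); lra.
have iZ : (P n).-integrable setT (EFin \o (f \o Z n)).
  exact: bounded_integrable (mfZ n) (fun w => fB _).
have iL : (P n).-integrable setT (EFin \o ((f \o L) \o X n)).
  exact: bounded_integrable (mfLX n) (fun w => fB _).
have it : (P n).-integrable setT (EFin \o (tail N m%:R \o X n)).
  exact: bounded_integrable (random_element_comp (mX n) ct) (fun w => tb _).
have ic c : (P n).-integrable setT (EFin \o (fun=> c : R)).
  by apply: finite_measure_integrable_cst.
have it2 : (P n).-integrable setT (EFin \o (fun w => 2 * Bd * tail N m%:R (X n w))).
  by apply: (integrableZl measurableT (2 * Bd) it).
have ib : (P n).-integrable setT (EFin \o (fun w => e / 4 + 2 * Bd * tail N m%:R (X n w))).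
  by apply: (integrableD measurableT (ic (e / 4)) it2).
have id : (P n).-integrable setT (EFin \o (fun w => f (Z n w) - f (L (X n w)))).
  by apply: (integrableB measurableT iZ iL).
have up : Rintegral (P n) setT (f \o Z n) - Rintegral (P n) setT ((f \o L) \o X n) <=
    e / 4 + 2 * Bd * Rintegral (P n) setT (tail N m%:R \o X n).
  rewrite -RintegralB// -RintegralZl// -[X in X + _](Rintegral_prob_cst (P n) (e / 4)).
  rewrite -RintegralD//; apply: le_Rintegral => // w _.
  by have := pw w; rewrite ler_norml => /andP[].
have lo : Rintegral (P n) setT ((f \o L) \o X n) - Rintegral (P n) setT (f \o Z n) <=
    e / 4 + 2 * Bd * Rintegral (P n) setT (tail N m%:R \o X n).
  rewrite -RintegralB// -RintegralZl// -[X in X + _](Rintegral_prob_cst (P n) (e / 4)).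
  rewrite -RintegralD//; apply: le_Rintegral => // [|w _].
    by apply: (integrableB measurableT iL iZ).
  by have := pw w; rewrite distrC ler_norml => /andP[].
have h4 : 2 * Bd * Rintegral (P n) setT (tail N m%:R \o X n) <= e / 2.
  apply: (@le_trans _ _ (2 * Bd * (2 * eta))); first by rewrite ler_pM2l// mulr_gt0.
  by rewrite /eta le_eqVlt; apply/orP; left; apply/eqP; field; rewrite gt_eqF.
by move: h2; rewrite !ler_norml => /andP[? ?]; apply/andP; split; lra.
Qed.

End ConvergenceInDistribution.

(** * Limit laws *)

Section Coordinates.
Context (R : realType) (X : finType).

Definition coordv (u : 'cV[R]_#|X|) (x : X) : R := u (enum_rank x) ord0.

Lemma dotvE (f : X -> R) (u : 'cV[R]_#|X|) : dotv (fvec f) u = \sum_x f x * coordv u x.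
Proof.
rewrite /dotv mxE (reindex (@enum_rank X))/=; last exact: onW_bij (@enum_rank_bij X).
by apply: eq_bigr => x _; rewrite !mxE enum_rankK.
Qed.

(** The projection along [mu] onto zero-sum vectors; using [mu] itself makes the discarded part a
    multiple of the marginal, as [Lval_balanced] exploits. *)
Definition recenter (mu : fprob R X) (h : X -> R) (x : X) : R := h x - (\sum_t h t) * mu x.

Lemma sum_recenter mu h : \sum_x recenter mu h x = 0.
Proof. by rewrite sumrB -mulr_sumr pmass_sum1 mulr1 subrr. Qed.

Lemma recenter_id mu h : \sum_x h x = 0 -> recenter mu h = h.
Proof. by move=> h0; apply/funext => x; rewrite /recenter h0 mul0r subr0. Qed.

Lemma l1_recenter mu h : l1 (recenter mu h) <= 2 * l1 h.
Proof.
apply: (@le_trans _ _ (\sum_x (`|h x| + `|\sum_t h t| * mu x))).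
  apply: ler_sum => x _; apply: le_trans (ler_normB _ _) _.
  by rewrite normrM (ger0_norm (pmass_ge0 mu x)).
rewrite big_split/= -mulr_sumr pmass_sum1 mulr1.
by have := sum_le_l1 h; rewrite /l1; lra.
Qed.

End Coordinates.

Section Limit.
Context (R : realType) (X0 X1 : finType).
Local Notation E := ('cV[R]_#|X0| * 'cV[R]_#|X1|)%type.

Lemma coordv1_continuous (x : X0) : continuous (fun u : E => coordv u.1 x).
Proof.
by move=> u; apply: (continuous_comp (f := fst) (g := fun v : 'cV[R]_#|X0| => coordv v x));
  [exact: cvg_fst|exact: coord_continuous].
Qed.

Lemma coordv2_continuous (x : X1) : continuous (fun u : E => coordv u.2 x).
Proof.
by move=> u; apply: (continuous_comp (f := snd) (g := fun v : 'cV[R]_#|X1| => coordv v x));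
  [exact: cvg_snd|exact: coord_continuous].
Qed.

Lemma pairf_continuous phi : continuous (fun u : E => pairf phi (coordv u.1) (coordv u.2)).
Proof.
move=> u; apply: cvgD; apply: cvg_sumr => x; apply: cvgM; try exact: cvg_cst.
  exact: coordv1_continuous.
exact: coordv2_continuous.
Qed.

Lemma sumv1_continuous : continuous (fun u : E => \sum_x coordv u.1 x).
Proof. by move=> u; apply: cvg_sumr => x; exact: coordv1_continuous. Qed.

Lemma sumv2_continuous : continuous (fun u : E => \sum_x coordv u.2 x).
Proof. by move=> u; apply: cvg_sumr => x; exact: coordv2_continuous. Qed.

Definition nrm (u : E) : R := l1 (coordv u.1) + l1 (coordv u.2).

Lemma nrm_continuous : continuous nrm.
Proof.
move=> u; apply: cvgD; apply: cvg_sumr => x; apply: cvg_norm.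
  exact: coordv1_continuous.
exact: coordv2_continuous.
Qed.

Context (Opt : set (fprob R (X0 * X1)%type))
  (D : fprob R (X0 * X1)%type -> set ((X0 -> R) * (X1 -> R))) (K : R).
Hypothesis Opt0 : Opt !=set0.
Hypothesis D0 : forall pi, Opt pi -> D pi !=set0.
Hypothesis K0 : 0 <= K.
Hypothesis bnd : forall pi phi h0 h1, Opt pi -> D pi phi -> tangent h0 h1 ->
  `|pairf phi h0 h1| <= K * (l1 h0 + l1 h1).

Context (mu0 : fprob R X0) (mu1 : fprob R X1).

(* The limit functional extended from the tangent space by a linear projection. *)
Definition limitf (u : E) : R :=
  Lam Opt D (recenter mu0 (coordv u.1)) (recenter mu1 (coordv u.2)).

Let trec h0 h1 : tangent (recenter mu0 h0) (recenter mu1 h1).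
Proof. by split; exact: sum_recenter. Qed.

Lemma limitf_bound u : `|limitf u| <= K * 2 * nrm u.
Proof.
apply: le_trans (Lam_bound Opt0 D0 bnd (trec _ _)) _.
rewrite -mulrA ler_wpM2l// /nrm mulrDr.
by apply: lerD; exact: l1_recenter.
Qed.

Lemma limitf_continuous : continuous limitf.
Proof.
move=> u; apply/cvgrPdist_le => e e0.
pose a (v : E) := l1 (fun x => recenter mu0 (coordv u.1) x - recenter mu0 (coordv v.1) x) +
   l1 (fun x => recenter mu1 (coordv u.2) x - recenter mu1 (coordv v.2) x).
have ca : (fun v => K * a v) @ u --> K * a u.
  apply: cvgM; first exact: cvg_cst.
  apply: cvgD; apply: cvg_sumr => x; apply: cvg_norm; apply: cvgB; try exact: cvg_cst.
    apply: cvgB; first exact: coordv1_continuous.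
    by apply: cvgM; [exact: sumv1_continuous|exact: cvg_cst].
  apply: cvgB; first exact: coordv2_continuous.
  by apply: cvgM; [exact: sumv2_continuous|exact: cvg_cst].
have a0 : K * a u = 0.
  by rewrite /a /l1 !big1 ?addr0 ?mulr0// => x _; rewrite subrr normr0.
rewrite a0 in ca.
have : \forall v \near u, K * a v <= e by move/cvgr_le: ca; apply.
apply: filterS => v; apply: le_trans.
exact: (Lam_lip Opt0 D0 bnd).
Qed.

Context (V : fprob R X0 -> fprob R X1 -> R).
Hypothesis Vcont : forall (nu : fprob R X0) (rho : fprob R X1) e, 0 < e -> exists2 dl : R, 0 < dl &
  forall (nu' : fprob R X0) (rho' : fprob R X1),
  l1 (fun x => nu' x - nu x) + l1 (fun y => rho' y - rho y) <= dl ->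
  `|V nu' rho' - V nu rho| < e.
Hypothesis Vdiff : forall e, 0 < e -> exists2 dl : R, 0 < dl &
  forall (nu' : fprob R X0) (rho' : fprob R X1),
  l1 (fun x => nu' x - mu0 x) + l1 (fun y => rho' y - mu1 y) <= dl ->
  `|V nu' rho' - V mu0 mu1 -
     Lam Opt D (fun x => nu' x - mu0 x) (fun y => rho' y - mu1 y)| <=
    e * (l1 (fun x => nu' x - mu0 x) + l1 (fun y => rho' y - mu1 y)).

Context (d : nat -> measure_display) (Om : forall n, measurableType (d n)).
Context (P : forall n, probability (Om n) R).
Context (mu0n : forall n, Om n -> fprob R X0) (mu1n : forall n, Om n -> fprob R X1).
Context (dG : measure_display) (OmG : measurableType dG) (PG : probability OmG R).
Context (G0 : OmG -> 'cV[R]_#|X0|) (G1 : OmG -> 'cV[R]_#|X1|).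
Local Notation Xn := (fun n (w : Om n) => Num.sqrt n%:R *:
      ((fvec (mu0n w), fvec (mu1n w)) - (fvec mu0, fvec mu1)) : E).
Hypothesis mun_cvg : cvg_in_distribution P Xn PG (fun w => (G0 w, G1 w)).
Hypothesis mL : random_element (fun w => fine (Lval Opt D (coordv (G0 w)) (coordv (G1 w)))).

Let coord_Xn1 n (w : Om n) : coordv (Xn n w).1 = fun x => Num.sqrt n%:R * (mu0n w x - mu0 x).
Proof.
apply/funext => x; rewrite /coordv /= !mxE.
by rewrite enum_rankK.
Qed.

Let coord_Xn2 n (w : Om n) : coordv (Xn n w).2 = fun x => Num.sqrt n%:R * (mu1n w x - mu1 x).
Proof.
apply/funext => x; rewrite /coordv /= !mxE.
by rewrite enum_rankK.
Qed.

Let sum0 (T : finType) (m m' : fprob R T) : \sum_x (m x - m' x) = 0.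
Proof. by rewrite sumrB !pmass_sum1 subrr. Qed.

Let l1Z (T : finType) (t : R) (f : T -> R) : 0 <= t -> l1 (fun x => t * f x) = t * l1 f.
Proof.
by move=> t0; rewrite /l1 mulr_sumr; apply: eq_bigr => x _; rewrite normrM ger0_norm.
Qed.

(** The random measures enter only through the rescaled vectors; undoing the scaling turns
    continuity of [V] into the local control asked for by [random_element_local]. *)
Lemma random_element_value n :
  random_element (fun w : Om n => Num.sqrt n%:R * (V (mu0n w) (mu1n w) - V mu0 mu1)).
Proof.
(* At index 0 the scaling is degenerate and the variable is constant. *)
have [n0|n0] := posnP n.
  apply: measurable_random_element; rewrite (_ : (fun w => _) = cst 0)//.
  have s0 : Num.sqrt n%:R = 0 :> R by rewrite n0 sqrtr0.
  by apply/funext => w; rewrite s0 mul0r.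
have s0 : 0 < Num.sqrt n%:R :> R by rewrite sqrtr_gt0 ltr0n.
have [mX _ _] := mun_cvg.
apply: (random_element_local (mX n)) => w e e0.
have e1 : 0 < e / Num.sqrt n%:R by rewrite divr_gt0.
have [dl dl0 H] := Vcont (mu0n w) (mu1n w) e1.
pose g (u : E) := l1 (fun x => coordv u.1 x - coordv (Xn n w).1 x) +
   l1 (fun x => coordv u.2 x - coordv (Xn n w).2 x).
have cg : continuous g.
  move=> u; apply: cvgD; apply: cvg_sumr => x; apply: cvg_norm; apply: cvgB;
    try exact: cvg_cst.
    exact: coordv1_continuous.
  exact: coordv2_continuous.
exists (g @^-1` [set r | r < Num.sqrt n%:R * dl]); split.
- by apply: open_comp => [u _|]; [exact: cg|exact: open_lt].
- rewrite /= /g /l1 !big1 ?addr0 ?mulr_gt0// => x _; by rewrite subrr normr0.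
move=> w' /=; rewrite /g !coord_Xn1 !coord_Xn2.
have E1 (T : finType) (a b c : fprob R T) :
    (fun x => Num.sqrt n%:R * (a x - c x) - Num.sqrt n%:R * (b x - c x)) =
    (fun x => Num.sqrt n%:R * (a x - b x)).
  by apply/funext => x; ring.
rewrite !E1 !l1Z ?(ltW s0)// -mulrDr ltr_pM2l// => /ltW /H.
rewrite -mulrBr normrM (gtr0_norm s0) -ltr_pdivlMl// mulrC.
by congr (_ < _); congr `|_|; ring.
Qed.

Lemma limit_theorem :
  {ae PG, forall w, Lval Opt D (coordv (G0 w)) (coordv (G1 w)) \is a fin_num} /\
  cvg_in_distribution P
    (fun n (w : Om n) => Num.sqrt n%:R * (V (mu0n w) (mu1n w) - V mu0 mu1))
    PG (fun w => fine (Lval Opt D (coordv (G0 w)) (coordv (G1 w)))).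
Proof.
have aet : {ae PG, forall w, tangent (coordv (G0 w)) (coordv (G1 w))}.
  pose g (u : E) := `|\sum_x coordv u.1 x| + `|\sum_x coordv u.2 x|.
  have cg : continuous g.
    by move=> u; apply: cvgD; apply: cvg_norm; [exact: sumv1_continuous|exact: sumv2_continuous].
  have g0 n (w : Om n) : g (Xn n w) = 0.
    by rewrite /g coord_Xn1 coord_Xn2 -!mulr_sumr !sum0 !mulr0 !normr0 addr0.
  have := vanishing_limit mun_cvg cg g0; apply: filterS => w /=; rewrite /g /=.
  move=> /eqP; rewrite paddr_eq0// !normr_eq0 => /andP[/eqP ? /eqP ?].
  by split.
split; first by apply: filterS aet => w; exact: (Lval_fin Opt0 D0 bnd).
apply: (@delta_method R d Om P dG OmG PG E Xn (fun w => (G0 w, G1 w)) nrm limitf (K * 2)) => //.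
- exact: nrm_continuous.
- exact: limitf_continuous.
- exact: limitf_bound.
- by rewrite mulr_ge0.
- exact: random_element_value.
- by apply: filterS aet => w [t0 t1] /=; rewrite /limitf /= !recenter_id.
move=> M e e0.
(* The remainder scaled by the root of [n] is at most this constant times [M]; adding 1 avoids a
   zero denominator. *)
have e1 : 0 < e / (`|M| + 1) by rewrite divr_gt0// ltr_wpDl.
have [dl dl0 H] := Vdiff e1.
(* The square brings vectors of norm at most [M] within distance [dl] once unscaled; the added 1
   makes [n] positive. *)
have : \forall n \near \oo, (M / dl) ^+ 2 + 1 <= n%:R by exact: nbhs_infty_ger.
apply: filterS => n nM w.
have s0 : 0 < Num.sqrt n%:R :> R.
  by rewrite sqrtr_gt0; apply: lt_le_trans nM; rewrite ltr_wpDl// sqr_ge0.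
rewrite /nrm coord_Xn1 coord_Xn2 !l1Z ?(ltW s0)// -mulrDr.
set r := _ + _ => rM.
have r0 : 0 <= r by rewrite addr_ge0 ?l1_ge0.
have sM : M / dl <= Num.sqrt n%:R.
  apply: le_trans (ler_norm _) _; rewrite -sqrtr_sqr ler_wsqrtr//.
  by apply: le_trans nM; rewrite lerDl.
have rd : r <= dl.
  rewrite -(ler_pM2l s0); apply: le_trans rM _.
  by rewrite -ler_pdivrMr.
have := H _ _ rd; rewrite -/r => h.
have tt : tangent (fun x => mu0n w x - mu0 x) (fun x => mu1n w x - mu1 x).
  by split; exact: sum0.
have -> : limitf (Xn n w) = Num.sqrt n%:R *
    Lam Opt D (fun x => mu0n w x - mu0 x) (fun x => mu1n w x - mu1 x).
  rewrite /limitf coord_Xn1 coord_Xn2 !recenter_id -?mulr_sumr ?sum0 ?mulr0//.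
  exact: (LamZ Opt0 D0 bnd).
rewrite -mulrBr normrM (gtr0_norm s0).
apply: (@le_trans _ _ (e / (`|M| + 1) * (Num.sqrt n%:R * r))).
  by rewrite mulrCA ler_pM2l.
apply: (@le_trans _ _ (e / (`|M| + 1) * (`|M| + 1))).
  rewrite ler_pM2l//; apply: le_trans rM _; have := ler_norm M; lra.
by rewrite divfK// gt_eqF// ltr_wpDl.
Qed.

End Limit.

(** * Verification of the abstract hypotheses for both problems *)

Section Assembly.
Context (R : realType) (X0 X1 : finType).
Context (p : R) (k0 : X0 -> X0 -> R) (k1 : X1 -> X1 -> R).
Hypothesis p_gt0 : 0 < p.
Hypothesis Delta_sym : forall x y x' y',
  Delta p k0 k1 x y x' y' = Delta p k0 k1 x' y' x y.
Context (mu0 : fprob R X0) (mu1 : fprob R X1).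
Context (mu0_full : full_support mu0) (mu1_full : full_support mu1).

Lemma EGW_continuous eps (eps0 : 0 <= eps) (nu : fprob R X0) (rho : fprob R X1) e : 0 < e ->
  exists2 dl : R, 0 < dl & forall (nu' : fprob R X0) (rho' : fprob R X1),
    l1 (fun x => nu' x - nu x) + l1 (fun y => rho' y - rho y) <= dl ->
    `|EGW p k0 k1 eps nu' rho' - EGW p k0 k1 eps nu rho| < e.
Proof.
move=> e0; have [dl dl0 H] := modulus_small (X0 := X0) (X1 := X1) p k0 k1 eps e0.
exists dl => // nu' rho' le1; apply: le_lt_trans (EGW_modulus Delta_sym eps0 (lexx _)) _.
by apply: H => //; rewrite addr_ge0 ?l1_ge0.
Qed.

Lemma EGW_ext eps (eps0 : 0 <= eps) (nu nu' : fprob R X0) (rho rho' : fprob R X1) :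
  nu' =1 nu -> rho' =1 rho -> EGW p k0 k1 eps nu' rho' = EGW p k0 k1 eps nu rho.
Proof.
move=> nE rE; apply/eqP; rewrite -subr_eq0 -normr_le0.
have z : l1 (fun x => nu' x - nu x) + l1 (fun y => rho' y - rho y) <= 0.
  by rewrite /l1 !big1 ?addr0// => x _; rewrite (nE, rE) subrr normr0.
by apply: le_trans (EGW_modulus Delta_sym eps0 z) _; rewrite !mulr0 sqrtr0 !mulr0 addr0.
Qed.

Lemma EGW0_ge0 nu rho : 0 <= EGW p k0 k1 0 nu rho.
Proof.
have [pi _ <-] := EGW_attained p k0 k1 (lexx (0 : R)) nu rho.
rewrite energy0; do 2![apply: sumr_ge0 => ? _].
by rewrite !mulr_ge0 ?DD_ge0 ?pmass_ge0.
Qed.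

Lemma GW_powR nu rho : GW p k0 k1 nu rho `^ p = EGW p k0 k1 0 nu rho.
Proof. by rewrite /GW -powRrM mulVf ?gt_eqF// powRr1// EGW0_ge0. Qed.

Let Opt0 eps (eps0 : 0 <= eps) : optimal_plans p k0 k1 eps mu0 mu1 !=set0.
Proof. by have [pi o] := optimal_ex p k0 k1 eps0 mu0 mu1; exists pi. Qed.

Section GW.
Let Opt := optimal_plans p k0 k1 0 mu0 mu1.
Let D pi := OT_potentials (plan_cost p k0 k1 pi) mu0 mu1.

Lemma OT_potentials_ex pi : Opt pi -> D pi !=set0.
Proof.
move=> o; have [phi t] := tight_potentials0 Delta_sym o.
by exists phi; apply/(OT_potentialsE Delta_sym _ o).
Qed.

Lemma Kq_ge0 : 0 <= Kq p k0 k1.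
Proof. by rewrite /Kq mulr_ge0// bsum_ge0. Qed.

Lemma OT_bound pi phi h0 h1 : Opt pi -> D pi phi -> tangent h0 h1 ->
  `|pairf phi h0 h1| <= Kq p k0 k1 * (l1 h0 + l1 h1).
Proof. by move=> o ph [s0 s1]; apply: (OT_pairf_bound Delta_sym mu0_full mu1_full o ph). Qed.

Lemma GW_differentiable e : 0 < e -> exists2 dl : R, 0 < dl &
  forall (nu' : fprob R X0) (rho' : fprob R X1),
  l1 (fun x => nu' x - mu0 x) + l1 (fun y => rho' y - mu1 y) <= dl ->
  `|EGW p k0 k1 0 nu' rho' - EGW p k0 k1 0 mu0 mu1 -
     Lam Opt D (fun x => nu' x - mu0 x) (fun y => rho' y - mu1 y)| <=
    e * (l1 (fun x => nu' x - mu0 x) + l1 (fun y => rho' y - mu1 y)).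
Proof.
apply: (B_differentiable (Opt0 (lexx 0)) OT_potentials_ex OT_bound).
- by move=> nu' rho'; exact: EGW_ext.
- move=> F t g0 g1 h0 h1 nu' rho' ap pi M e' o HM e'0.
  exact: (EGW0_upper_seq Delta_sym mu0_full mu1_full ap o HM e'0).
- move=> F t g0 g1 h0 h1 nu' rho' ap.
  exact: (EGW0_lower_seq Delta_sym mu0_full mu1_full ap).
Qed.

Lemma OT_shift pi phi a : D pi phi ->
  D pi (fun x => phi.1 x + a, fun y => phi.2 y - a).
Proof.
move=> [feas mx]; split=> [x y|psi fp] /=.
  by rewrite addrACA subrr addr0; exact: feas.
apply: le_trans (mx psi fp) _; rewrite /OT_dual /integ /=.
have -> : \sum_x (phi.1 x + a) * mu0 x = \sum_x phi.1 x * mu0 x + a.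
  under eq_bigr do rewrite mulrDl.
  by rewrite big_split/= -mulr_sumr pmass_sum1 mulr1.
have -> : \sum_y (phi.2 y - a) * mu1 y = \sum_y phi.2 y * mu1 y - a.
  under eq_bigr do rewrite mulrBl.
  by rewrite sumrB -mulr_sumr pmass_sum1 mulr1.
by rewrite addrACA subrr addr0.
Qed.

(* Potentials are defined up to opposite shifts, so the limit is infinite unless
   both coordinate sums agree. *)
Lemma Lval_pinfty h0 h1 : \sum_x h0 x != \sum_y h1 y -> Lval Opt D h0 h1 = +oo%E.
Proof.
move=> ne; apply/ereal_inf_pinfty => _ [pi o <-].
have [phi ph] := OT_potentials_ex o.
apply/eqyP => A A0; pose s := \sum_x h0 x - \sum_y h1 y.
have s0 : s != 0 by rewrite subr_eq0.
pose a := (A - pairf phi h0 h1) / s.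
apply: ereal_sup_ubound; eexists; first exact: (OT_shift a ph).
congr EFin; rewrite /pairf/=.
under eq_bigr do rewrite mulrDl.
under [X in _ + X]eq_bigr do rewrite mulrBl.
rewrite big_split/= sumrB -!mulr_sumr.
transitivity (pairf phi h0 h1 + a * s); first by rewrite /pairf /s; ring.
by rewrite /a divfK// addrC subrK.
Qed.

(** With equal sums the discarded part is a multiple of the pair of marginals, on which every
    potential of every optimal plan has the same pairing: the dual value [2 * B pi pi], that is,
    twice the optimal value. *)
Lemma Lval_balanced h0 h1 : \sum_x h0 x = \sum_y h1 y ->
  Lval Opt D h0 h1 = (Lam Opt D (recenter mu0 h0) (recenter mu1 h1) +
     (\sum_x h0 x) * (2 * EGW p k0 k1 0 mu0 mu1))%:E.
Proof.
move=> sE; set s := \sum_x h0 x.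
have tr : tangent (recenter mu0 h0) (recenter mu1 h1) by split; exact: sum_recenter.
have dual pi phi : Opt pi -> D pi phi -> pairf phi h0 h1 =
    pairf phi (recenter mu0 h0) (recenter mu1 h1) + s * (2 * EGW p k0 k1 0 mu0 mu1).
  move=> o ph; have [pi0 mpi BV] := opt0P o.
  have [_ tg] := (OT_potentialsE Delta_sym phi o).1 ph.
  have -> : 2 * EGW p k0 k1 0 mu0 mu1 = pairf phi mu0 mu1.
    rewrite -BV -(plan_cost_bform Delta_sym) (pairf_marg phi mpi).
    apply: eq_bigr => -[x y] _ /=.
    by have [->|n0] := eqVneq (pi (x, y)) 0; [rewrite !mulr0|rewrite tg].
  rewrite -pairfZ -pairfD; congr pairf; apply/funext => x; rewrite /recenter.
    by rewrite subrK.
  by rewrite -sE subrK.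
apply/eqP; rewrite eq_le; apply/andP; split.
  apply/lee_addgt0Pr => e e0.
  have [pi o le1] := Lam_inf (Opt0 (lexx 0)) OT_potentials_ex OT_bound tr e0.
  apply: ge_ereal_inf; eexists; first by exists pi.
  apply: ge_ereal_sup => _ [phi ph <-]; rewrite -EFinD lee_fin (dual _ _ o ph).
  by have := le1 _ ph; lra.
apply/ereal_infP => _ [pi o <-]; apply/lee_addgt0Pr => e e0.
have [phi ph lt1] := Lam_sup (Opt0 (lexx 0)) OT_potentials_ex OT_bound tr o e0.
apply: (@le_trans _ _ ((pairf phi h0 h1)%:E + e%:E)%E).
  by rewrite -EFinD lee_fin (dual _ _ o ph); lra.
by rewrite leeD2r//; apply: ereal_sup_ubound; exists phi.
Qed.

(** A formula valid at every sample point: a continuous expression when the coordinate sums agree,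
    and otherwise 0, the value of [fine] at infinity. *)
Lemma random_element_GW_limit dG (OmG : measurableType dG)
    (G : OmG -> ('cV[R]_#|X0| * 'cV[R]_#|X1|)%type) : random_element G ->
  random_element (fun w => fine (Lval Opt D (coordv (G w).1) (coordv (G w).2))).
Proof.
move=> mG; apply: measurable_random_element.
rewrite (_ : (fun w => _) = fun w =>
   if \sum_x coordv (G w).1 x == \sum_x coordv (G w).2 x then
     limitf Opt D mu0 mu1 (G w) +
       (\sum_x coordv (G w).1 x) * (2 * EGW p k0 k1 0 mu0 mu1) else 0); last first.
  apply/funext => w; case: ifPn => [/eqP|] h; first by rewrite Lval_balanced.
  by rewrite Lval_pinfty.
have m1 := random_element_measurable (random_element_comp mG (@sumv1_continuous R X0 X1)).
have m2 := random_element_measurable (random_element_comp mG (@sumv2_continuous R X0 X1)).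
apply: measurable_fun_ifT; first exact: measurable_fun_eqr.
  apply: measurable_funD.
    apply: random_element_measurable.
    apply: (random_element_comp (f := limitf Opt D mu0 mu1) mG).
    exact: (limitf_continuous (Opt0 (lexx 0)) OT_potentials_ex OT_bound).
  by apply: measurable_funM => //; exact: measurable_cst.
exact: measurable_cst.
Qed.

End GW.

Section EGW.
Context (eps : R) (eps0 : 0 < eps).
Context (phi : fprob R (X0 * X1)%type -> (X0 -> R) * (X1 -> R)).
Let Opt := optimal_plans p k0 k1 eps mu0 mu1.
Hypothesis phiP : forall pi, Opt pi ->
  EOT_potentials (plan_cost p k0 k1 pi) mu0 mu1 eps (phi pi).
Let D pi : set ((X0 -> R) * (X1 -> R)) := [set phi pi].

Lemma selection_ex pi : Opt pi -> D pi !=set0.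
Proof. by exists (phi pi). Qed.

Lemma selection_bound : exists2 K : R, 0 <= K & forall pi ph h0 h1,
  Opt pi -> D pi ph -> tangent h0 h1 -> `|pairf ph h0 h1| <= K * (l1 h0 + l1 h1).
Proof.
have [K KP] := EOT_pairf_bound Delta_sym eps0 mu0_full mu1_full.
exists `|K| => // pi ph h0 h1 o -> [s0 s1].
apply: le_trans (KP pi (phi pi) h0 h1 o (phiP o) s0 s1) _.
by rewrite ler_wpM2r ?addr_ge0 ?l1_ge0// ler_norm.
Qed.

Lemma EGW_differentiable e : 0 < e -> exists2 dl : R, 0 < dl &
  forall (nu' : fprob R X0) (rho' : fprob R X1),
  l1 (fun x => nu' x - mu0 x) + l1 (fun y => rho' y - mu1 y) <= dl ->
  `|EGW p k0 k1 eps nu' rho' - EGW p k0 k1 eps mu0 mu1 -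
     Lam Opt D (fun x => nu' x - mu0 x) (fun y => rho' y - mu1 y)| <=
    e * (l1 (fun x => nu' x - mu0 x) + l1 (fun y => rho' y - mu1 y)).
Proof.
have [K K0 bnd] := selection_bound.
apply: (B_differentiable (Opt0 (ltW eps0)) selection_ex bnd).
- by move=> nu' rho'; apply: EGW_ext; exact: ltW.
- move=> F t g0 g1 h0 h1 nu' rho' [UF t0 tc [g0c g1c] [nuE rhoE]] pi M e' o HM e'0.
  have := EGW_upper Delta_sym eps0 mu0_full mu1_full UF t0 tc g0c g1c nuE rhoE o (phiP o) e'0.
  have PF := @ultra_proper _ _ UF.
  apply: filterS => k /le_trans; apply; rewrite lerD2l ler_pM2l// lerD2r.
  exact: HM.
- move=> F t g0 g1 h0 h1 nu' rho' [UF t0 tc [g0c g1c] [nuE rhoE]].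
  have [pi o H] := EGW_lower Delta_sym eps0 mu0_full mu1_full UF t0 tc g0c g1c nuE rhoE.
  by exists pi => // ph e' -> e'0; exact: H (phiP o) e'0.
Qed.

Lemma Lval_selection h0 h1 :
  Lval Opt D h0 h1 = ereal_inf [set (pairf (phi pi) h0 h1)%:E | pi in Opt].
Proof.
congr ereal_inf; congr image; apply/funext => pi.
by rewrite image_set1 ereal_sup1.
Qed.

(** An infimum of continuous functions is upper semicontinuous: its strict sublevel sets are unions
    of open sets, measurable even over an uncountable family of plans and without finiteness of the
    infimum. *)
Lemma random_element_EGW_limit dG (OmG : measurableType dG)
    (G : OmG -> ('cV[R]_#|X0| * 'cV[R]_#|X1|)%type) : random_element G ->
  random_element (fun w => fine (Lval Opt D (coordv (G w).1) (coordv (G w).2))).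
Proof.
move=> mG; apply: measurable_random_element.
apply: (measurableT_comp (f := fine)) => //.
under eq_fun do rewrite Lval_selection.
apply: (measurability _ (ErealGenInftyO.measurableE R)) => _ [_ [r ->] <-].
rewrite setTI.
rewrite [X in measurable X](_ : _ = G @^-1` (\bigcup_(pi in Opt)
   ((fun u => pairf (phi pi) (coordv u.1) (coordv u.2)) @^-1` [set t | t < r]))).
  apply: mG; apply: bigcup_open => pi _.
  by apply: open_comp => [u _|]; [exact: pairf_continuous|exact: open_lt].
apply/seteqP; split=> w /=; rewrite in_itv/=.
  by move=> /ereal_inf_lt[_ [pi o <-]]; rewrite lte_fin => h; exists pi.
move=> [pi o h]; apply: (@le_lt_trans _ _ (pairf (phi pi) (coordv (G w).1) (coordv (G w).2))%:E).
  by apply: ereal_inf_lbound; exists pi.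
by rewrite lte_fin.
Qed.

End EGW.
End Assembly.

Unset Implicit Arguments.
Set Printing Implicit Defensive.

Theorem theorem3 (R : realType) (X0 X1 : finType)
  (p : R) (k0 : X0 -> X0 -> R) (k1 : X1 -> X1 -> R)
  (p_gt0 : 0 < p)
  (Delta_sym : forall x y x' y',
    Delta p k0 k1 x y x' y' = Delta p k0 k1 x' y' x y)
  (mu0 : fprob R X0) (mu1 : fprob R X1)
  (mu0_full : full_support mu0) (mu1_full : full_support mu1)
  (d : nat -> measure_display) (Om : forall n, measurableType (d n))
  (P : forall n, probability (Om n) R)
  (mu0n : forall n, Om n -> fprob R X0) (mu1n : forall n, Om n -> fprob R X1)
  (dG : measure_display) (OmG : measurableType dG) (PG : probability OmG R)
  (G0 : OmG -> 'cV[R]_#|X0|) (G1 : OmG -> 'cV[R]_#|X1|)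
  (mun_cvg : cvg_in_distribution P
    (fun n w => Num.sqrt n%:R *:
      ((fvec (mu0n n w), fvec (mu1n n w)) - (fvec mu0, fvec mu1)))
    PG (fun w => (G0 w, G1 w))) :
  (let L := fun w : OmG =>
     ereal_inf [set ereal_sup
       [set (dotv (fvec phi.1) (G0 w) + dotv (fvec phi.2) (G1 w))%:E
          | phi in OT_potentials (plan_cost p k0 k1 pi) mu0 mu1]
       | pi in optimal_plans p k0 k1 0 mu0 mu1] in
   {ae PG, forall w, L w \is a fin_num} /\
   cvg_in_distribution P
     (fun n w => Num.sqrt n%:R *
       (GW p k0 k1 (mu0n n w) (mu1n n w) `^ p - GW p k0 k1 mu0 mu1 `^ p))
     PG (fun w => fine (L w)))
  /\
  (forall eps : R, 0 < eps ->
   (forall pi, optimal_plans p k0 k1 eps mu0 mu1 pi ->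
      exists2 phi, EOT_potentials (plan_cost p k0 k1 pi) mu0 mu1 eps phi &
        forall psi, EOT_potentials (plan_cost p k0 k1 pi) mu0 mu1 eps psi ->
          exists a : R, psi = (fun x => phi.1 x + a, fun y => phi.2 y - a)) /\
   (forall phi : fprob R (X0 * X1)%type -> (X0 -> R) * (X1 -> R),
      (forall pi, optimal_plans p k0 k1 eps mu0 mu1 pi ->
         EOT_potentials (plan_cost p k0 k1 pi) mu0 mu1 eps (phi pi)) ->
      let L := fun w : OmG =>
        ereal_inf
          [set (dotv (fvec (phi pi).1) (G0 w) + dotv (fvec (phi pi).2) (G1 w))%:E
             | pi in optimal_plans p k0 k1 eps mu0 mu1] in
      {ae PG, forall w, L w \is a fin_num} /\
      cvg_in_distribution P
        (fun n w => Num.sqrt n%:R *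
          (EGW p k0 k1 eps (mu0n n w) (mu1n n w) - EGW p k0 k1 eps mu0 mu1))
        PG (fun w => fine (L w)))).
Proof.
have [_ mG _] := mun_cvg.
have pairE ps w : dotv (fvec ps.1) (G0 w) + dotv (fvec ps.2) (G1 w) =
    pairf ps (coordv (G0 w)) (coordv (G1 w)) by rewrite !dotvE.
split=> [L|eps eps0].
  pose Opt := optimal_plans p k0 k1 0 mu0 mu1.
  pose D pi := OT_potentials (plan_cost p k0 k1 pi) mu0 mu1.
  have LE : L = fun w => Lval Opt D (coordv (G0 w)) (coordv (G1 w)).
    apply/funext => w; congr ereal_inf; congr image; apply/funext => pi.
    by congr ereal_sup; congr image; apply/funext => ps; rewrite pairE.
  clearbody L; rewrite {}LE.
  (* The expansion is proved for [EGW] at [eps = 0], which [GW_powR] identifies with the [p]-th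
     power of [GW]. *)
  apply: (limit_theorem (K := Kq p k0 k1)
    (V := fun nu rho => GW p k0 k1 nu rho `^ p) _ _ _ _ _ _ mun_cvg).
  - by have [pi o] := optimal_ex p k0 k1 (lexx (0 : R)) mu0 mu1; exists pi.
  - exact: (OT_potentials_ex Delta_sym).
  - exact: Kq_ge0.
  - exact: (OT_bound Delta_sym mu0_full mu1_full).
  - move=> nu rho e e0; have [dl dl0 H] := EGW_continuous Delta_sym (lexx 0) nu rho e0.
    by exists dl => // nu' rho' h; rewrite !GW_powR//; exact: H.
  - move=> e e0; have [dl dl0 H] := GW_differentiable Delta_sym mu0_full mu1_full e0.
    by exists dl => // nu' rho' h; rewrite !GW_powR//; exact: H.
  - exact: (random_element_GW_limit Delta_sym mu0_full mu1_full mG).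
split=> [pi o|phi phiP L]; first exact: (EOT_potentials_unique Delta_sym eps0 mu0_full mu1_full o).
pose Opt := optimal_plans p k0 k1 eps mu0 mu1.
pose D pi : set ((X0 -> R) * (X1 -> R)) := [set phi pi].
have LE : L = fun w => Lval Opt D (coordv (G0 w)) (coordv (G1 w)).
  apply/funext => w; rewrite /Opt /D Lval_selection.
  by congr ereal_inf; congr image; apply/funext => pi; rewrite pairE.
clearbody L; rewrite {}LE.
have [K K0 bnd] := selection_bound Delta_sym mu0_full mu1_full eps0 phiP.
apply: (limit_theorem (K := K) (V := EGW p k0 k1 eps) _ _ _ _ _ _ mun_cvg) => //.
- by have [pi o] := optimal_ex p k0 k1 (ltW eps0) mu0 mu1; exists pi.
- by move=> pi _; exists (phi pi).
- move=> nu rho e e0; exact: (EGW_continuous Delta_sym (ltW eps0) nu rho e0).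
- exact: (EGW_differentiable Delta_sym mu0_full mu1_full eps0 phiP).
- exact: (random_element_EGW_limit p k0 k1 mu0 mu1 eps phi mG).
Qed.
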